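(* Let $a, b \in \mathbb{C}\setminus\{0\}$, $c>0$, $|a|\ne1$, $|b|\ne1,2$, $c>\max\{|a|+1,|a|+|b|-1\}$ and $0\le\beta<1$. Assume that $$\frac{\Gamma(c)\,\Gamma(c-|a|-|b|)}{\Gamma(c-|a|)\,\Gamma(c-|b|)}\left[2\;{}_2F_1(|a|,|b|;c-|a|;-1)-\frac{(c-|a|-1)(c-|a|-|b|)}{(|a|-1)(|b|-1)(|b|-2)}\;{}_2F_1(|a|-1,|b|-2;c-|a|-1;-1)\right]$$ $$+\frac{(c-1)(c-2)}{(|a|-1)(|b|-1)(|b|-2)}\le\frac1{2(1-\beta)}+1.$$ Then $\mathcal{I}^{a,\frac b2,\frac{b+1}2}_{\frac c2,\frac{c+1}2}$ maps $\mathcal{R}(\beta)$ into $\mathcal{S}_p$.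
   Context: $\mathbb{D}=\{z\in\mathbb{C}:|z|<1\}$. $\mathcal{A}$ is the family of analytic functions $f$ on $\mathbb{D}$ of the form $f(z)=z+\sum_{n\ge2}a_nz^n$. $\mathcal{S}^*$ is the class of univalent $f\in\mathcal{A}$ that are starlike with respect to the origin. $\mathcal{UCV}$ is the class of uniformly convex functions: $f\in\mathcal{A}$ is in $\mathcal{UCV}$ if and only if $\operatorname{Re}\left(1+\frac{(z-\zeta)f''(z)}{f'(z)}\right)>0$ for all $z,\zeta\in\mathbb{D}$. $\mathcal{S}_p=\{F\in\mathcal{S}^*: F(z)=zf'(z),\ f\in\mathcal{UCV}\}$. For $\beta<1$, $\mathcal{R}(\beta)$ is the set of $f\in\mathcal{A}$ for which there exists $\phi\in\mathbb{R}$ with $\operatorname{Re}\left(e^{i\phi}(f'(z)-\beta)\right)>0$ for all $z\in\mathbb{D}$. Pochhammer symbol: $(x)_0=1$, $(x)_n=x(x+1)\cdots(x+n-1)$ for $n\ge1$. Clausen's hypergeometric function is ${}_3F_2(a,b,c;d,e;z)=\sum_{n=0}^\infty\frac{(a)_n(b)_n(c)_n}{(d)_n(e)_n(1)_n}z^n$ for $|z|<1$, with $d,e\ne0,-1,-2,\dots$. The integral operator is defined for $f(z)=z+\sum_{n\ge2}a_nz^n\in\mathcal{A}$ by the convolution (coefficientwise product) $$\mathcal{I}^{a,\frac b2,\frac{b+1}2}_{\frac c2,\frac{c+1}2}(f)(z)=z\,{}_3F_2\left(a,\tfrac b2,\tfrac{b+1}2;\tfrac c2,\tfrac{c+1}2;z\right)*f(z)=z+\sum_{n=2}^\infty\frac{(a)_{n-1}\left(\frac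 b2\right)_{n-1}\left(\frac{b+1}2\right)_{n-1}}{\left(\frac c2\right)_{n-1}\left(\frac{c+1}2\right)_{n-1}(1)_{n-1}}\,a_nz^n.$$ ${}_2F_1(a,b;c;z)$ is the Gauss hypergeometric function, i.e. $\sum_{n\ge0}\frac{(a)_n(b)_n}{(c)_n(1)_n}z^n$ for $|z|<1$, continued analytically to $\mathbb{C}\setminus[1,\infty)$ (so its value at $-1$ makes sense).
   Formalization: Γ is Euler's integral, so c > |a|+|b| is required; for |a|+|b|−1 < c < |a|+|b| the claim is false (e.g. a=2, b=3, c=4.99, β=0), and at c = |a|+|b| the expression is undefined. *)

(* Defs.v *)
(* Stdlib reals and Coquelicot complex numbers. *)
From Stdlib Require Import Reals Factorial.
From Coquelicot Require Import Coquelicot.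

Local Open Scope C_scope.

Definition disk (z : C) : Prop := (Cmod z < 1)%R.

Definition expands_on_disk (alpha : nat -> C) (f : C -> C) : Prop :=
  forall z : C, disk z ->
    is_pseries (K := C_AbsRing) (V := C_NormedModule) alpha z (f z).

(* Functions are total on C, but every class below constrains them only on the
   disk. An expansion converging on the disk makes f analytic there, so at
   points of the disk C_derive is the true derivative, for f and for f'. *)
Definition class_A (f : C -> C) : Prop :=
  exists alpha : nat -> C,
    alpha 0%nat = 0 /\ alpha 1%nat = 1 /\ expands_on_disk alpha f.

Definition univalent (f : C -> C) : Prop :=
  forall z w : C, disk z -> disk w -> f z = f w -> z = w.

(* The segment from 0 to f(z) stays in the image f(D). *)
Definition starlike_image (f : C -> C) : Prop :=
  forall (z : C) (t : R), disk z -> (0 <= t <= 1)%R ->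
    exists w : C, disk w /\ f w = RtoC t * f z.

Definition class_Sstar (f : C -> C) : Prop :=
  class_A f /\ univalent f /\ starlike_image f.

(* Division by 0 gives 0, so the condition f'(z) <> 0, implicit in the quotient
   f''/f', is stated separately. *)
Definition class_UCV (f : C -> C) : Prop :=
  class_A f /\
  forall z zeta : C, disk z -> disk zeta ->
    C_derive f z <> 0 /\
    (0 < Re (1 + (z - zeta) * C_derive (C_derive f) z / C_derive f z))%R.

Definition class_Sp (F : C -> C) : Prop :=
  class_Sstar F /\
  exists f : C -> C,
    class_UCV f /\ forall z : C, disk z -> F z = z * C_derive f z.

(* The pair (cos phi, sin phi) is e^{i phi}. *)
Definition class_R (beta : R) (f : C -> C) : Prop :=
  class_A f /\
  exists phi : R, forall z : C, disk z ->
    (0 < Re ((cos phi, sin phi) * (C_derive f z - RtoC beta)))%R.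

Fixpoint poch (x : C) (n : nat) : C :=
  match n with
  | O => 1
  | S m => poch x m * (x + RtoC (INR m))
  end.

Definition hyp2F1_coef (a b c : C) (n : nat) : C :=
  poch a n * poch b n / (poch c n * poch 1 n).

Definition hyp3F2_coef (a b c d e : C) (n : nat) : C :=
  poch a n * poch b n * poch c n / (poch d n * poch e n * poch 1 n).

(* C \ [1, +oo) *)
Definition slit_plane (z : C) : Prop := ~ (Im z = 0%R /\ (1 <= Re z)%R).

(* w is the value at z of the analytic continuation of the Gauss series to the
   slit plane; the continuation is unique since the slit plane is connected. *)
Definition is_hyp2F1 (a b c z w : C) : Prop :=
  slit_plane z /\
  exists F : C -> C,
    (forall u : C, slit_plane u ->
       ex_derive (K := C_AbsRing) (V := C_NormedModule) F u) /\
    expands_on_disk (hyp2F1_coef a b c) F /\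
    F z = w.

(* Euler's integral. It converges exactly when x > 0; no value is attached to
   x <= 0, so an assumption [is_Gamma x g] entails x > 0. *)
Definition is_Gamma (x g : R) : Prop :=
  is_RInt_gen (V := R_NormedModule)
    (fun t : R => (Rpower t (x - 1) * exp (- t))%R)
    (at_right 0) (Rbar_locally p_infty) g.

Definition taylor_coef (f : C -> C) (n : nat) : C :=
  Nat.iter n C_derive f 0 / RtoC (INR (fact n)).

(* Sum of the power series when it converges: Coquelicot's [Series] is only
   available for real terms. *)
Definition CPSeries (alpha : nat -> C) (z : C) : C :=
  (Series (fun n : nat => Re (alpha n * z ^ n)),
   Series (fun n : nat => Im (alpha n * z ^ n))).

(* Taylor coefficients of z 3F2(a, b/2, (b+1)/2; c/2, (c+1)/2; z). *)
Definition clausen_coef (a b c : C) (n : nat) : C :=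
  match n with
  | O => 0
  | S m => hyp3F2_coef a (b / 2) ((b + 1) / 2) (c / 2) ((c + 1) / 2) m
  end.

Definition clausen_op (a b c : C) (f : C -> C) (z : C) : C :=
  CPSeries (fun n : nat => clausen_coef a b c n * taylor_coef f n) z.

(* Main.v *)
(** Write A = |a|, B = |b| and t_m = (A)_m (B)_{2m} / ((c)_{2m} m!). The duplication
    formula bounds the m-th Clausen coefficient by t_m, and Caratheodory's estimate
    bounds the n-th coefficient of a function of R(beta) by 2 (1 - beta) / n; since
    sum_{n >= 2} (2n - 1) |A_n| <= 1 suffices for membership in S_p, it is enough that
    sum_m (2 - 1/(m+1)) t_m <= 1/(2 (1 - beta)) + 1. The left side of the hypothesis is
    exactly this sum. Indeed, (B)_n / (c)_n is a moment sequence; multiplying the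
    underlying measure by (1 - t)^{-A} turns it, by Gauss's theorem, into a multiple of
    (B)_n / (c - A)_n, and (1 - t)^{-A} (1 + t)^{-A} = (1 - t^2)^{-A} then gives
    sum_m t_m = K 2F1(A, B; c - A; -1), where the value at -1 is the Abel limit of the
    Gauss series because the continuation is continuous there. The sum of t_m / (m+1)
    is the same evaluation with (A, B, c) replaced by (A - 1, B - 2, c - 2). *)
Require Import Defs.
From Stdlib Require Import Reals Factorial Lra Lia Psatz.
From Coquelicot Require Import Coquelicot.

Local Open Scope R_scope.

(** No integral over a moment measure occurs. A measure enters only through the recurrence
    [(gam + N) * mu (S N) = (bet + N) * mu N], and multiplying it by [(1 - t)^(-al)] becomes a
    summation by parts that replaces [gam] by [gam - al]. The delicate point is the Abel limit at
    -1. Bounding the coefficients of [((1 + x t) (1 - t))^(-A)] termwise gives the size of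
    [(1 - t)^(-2A)], which would demand [c > 2A + B]; the sign cancellation has to be kept, and a
    three-term recurrence shows that [(1 - t)^(-A')] dominates uniformly in [x] for every [A' > A].
    In the second evaluation [A - 1], [B - 2] and [c - 2] need not be positive, so Gauss's theorem
    is not applied to them; the total mass is recovered from that of the first evaluation through
    the second moment. On the function side, univalence and starlikeness come from writing the
    function as the identity plus a map of Lipschitz constant 2/3, and Caratheodory's estimate comes
    from exact averages over roots of unity. *)

(** * Tails and dominated convergence of real series *)

Lemma is_lim_seq_sum_f_R0 (a : nat -> nat -> R) (l : nat -> R) (N : nat) :
  (forall n, is_lim_seq (fun j => a j n) (l n)) ->
  is_lim_seq (fun j => sum_f_R0 (a j) N) (sum_f_R0 l N).
Proof.
  intros H. induction N as [|N IH]; simpl.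
  - apply H.
  - apply is_lim_seq_plus'; [apply IH | apply H].
Qed.

Lemma Series_ge_0 (a : nat -> R) :
  (forall n, 0 <= a n) -> ex_series a -> 0 <= Series a.
Proof.
  intros Ha Hs. replace 0 with (Series (fun n => 0 * a n)).
  - apply Series_le; auto. intros n. specialize (Ha n). lra.
  - rewrite Series_scal_l. ring.
Qed.

Lemma Series_tail_lim (b : nat -> R) :
  ex_series b -> is_lim_seq (fun N => Series (fun k => b (S N + k)%nat)) 0.
Proof.
  intros Hb.
  apply is_lim_seq_ext with (fun N => Series b - sum_f_R0 b N).
  - intros N. rewrite (Series_incr_n b (S N)); [|lia|exact Hb]. simpl. ring.
  - replace (Finite 0) with (Finite (Series b - Series b)) by (f_equal; ring).
    apply is_lim_seq_minus'; [apply is_lim_seq_const|].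
    apply is_lim_seq_ext with (sum_n b).
    + intros; apply sum_n_Reals.
    + exact (Series_correct _ Hb).
Qed.

(** Dominated convergence for series. Beyond [N] the difference is at most twice the tail of [b],
    which costs 2 eps/4; the finitely many terms up to [N] converge one by one and cost another
    eps/4. *)
Lemma tannery (a : nat -> nat -> R) (l b : nat -> R) :
  (forall j n, Rabs (a j n) <= b n) -> ex_series b ->
  (forall n, is_lim_seq (fun j => a j n) (l n)) ->
  is_lim_seq (fun j => Series (a j)) (Series l).
Proof.
  intros Hab Hb Hl.
  assert (Hlb : forall n, Rabs (l n) <= b n).
  { intros n.
    apply (is_lim_seq_le (fun j => Rabs (a j n)) (fun _ => b n)
             (Rabs (l n)) (b n)); auto.
    - exact (is_lim_seq_abs _ _ (Hl n)).
    - apply is_lim_seq_const. }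
  assert (Ha : forall j, ex_series (a j)).
  { intros j. apply (ex_series_le (a j) b); auto. }
  assert (Hls : ex_series l) by (apply (ex_series_le l b); auto).
  set (d := fun j n => Rabs (a j n - l n)).
  assert (Hd : forall j n, 0 <= d j n <= 2 * b n).
  { intros j n. split; [apply Rabs_pos|]. unfold d.
    specialize (Hab j n). specialize (Hlb n).
    apply Rabs_le. revert Hab Hlb.
    unfold Rabs; repeat destruct Rcase_abs; lra. }
  assert (H2b : ex_series (fun n => 2 * b n)) by exact (ex_series_scal 2 b Hb).
  assert (Hde : forall j, ex_series (d j)).
  { intros j. apply (ex_series_le (d j) (fun n => 2 * b n)); auto.
    intros n. unfold norm; simpl. unfold abs; simpl.
    rewrite Rabs_pos_eq; apply Hd. }
  apply is_lim_seq_spec. intros eps.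
  assert (Ht := Series_tail_lim b Hb). apply is_lim_seq_spec in Ht.
  assert (He4 : 0 < eps / 4) by (destruct eps; simpl; lra).
  destruct (Ht (mkposreal _ He4)) as [N HN]. specialize (HN N (le_n N)).
  simpl in HN.
  assert (Hs : is_lim_seq (fun j => sum_f_R0 (d j) N) 0).
  { replace (Finite 0) with (Finite (sum_f_R0 (fun _ => 0) N)).
    - apply (is_lim_seq_sum_f_R0 d). intros n.
      apply -> is_lim_seq_abs_0. 
      replace (Finite 0) with (Finite (l n - l n)) by (f_equal; ring).
      apply is_lim_seq_minus'; [apply Hl | apply is_lim_seq_const].
    - f_equal. rewrite sum_cte. ring. }
  apply is_lim_seq_spec in Hs.
  destruct (Hs (mkposreal _ He4)) as [J HJ]. exists J. intros j Hj.
  specialize (HJ j Hj). simpl in HJ.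
  rewrite <- Series_minus by auto.
  apply Rle_lt_trans with (Series (d j)).
  { apply Series_Rabs. apply Hde. }
  rewrite (Series_incr_n (d j) (S N)); [|lia|apply Hde].
  change (Init.Nat.pred (S N)) with N.
  assert (Series (fun k => d j (S N + k)%nat)
          <= 2 * Series (fun k => b (S N + k)%nat)).
  { rewrite <- Series_scal_l. apply Series_le.
    - intros n; apply Hd.
    - apply (ex_series_incr_n (fun n => 2 * b n) (S N)). exact H2b. }
  rewrite Rminus_0_r in HN, HJ.
  apply Rabs_def2 in HN. apply Rabs_def2 in HJ. cbn [Nat.add] in *. lra.
Qed.

(** * Abel points and Pochhammer quotients *)

(** Abel limits are taken along one sequence tending to 1, so that they are limits of sequences; the
    2 keeps it inside (0, 1) already at [j = 0]. *)
Definition abel_seq (j : nat) : R := 1 - / (INR j + 2).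

Lemma abel_seq_bounds (j : nat) : 0 < abel_seq j < 1.
Proof.
  assert (0 <= INR j) by apply pos_INR. unfold abel_seq.
  assert (0 < / (INR j + 2)) by (apply Rinv_0_lt_compat; lra).
  assert (/ (INR j + 2) < 1) by (rewrite <- Rinv_1; apply Rinv_lt_contravar; lra).
  lra.
Qed.

Lemma abel_seq_lim : is_lim_seq abel_seq 1.
Proof.
  replace (Finite 1) with (Finite (1 - 0)) by (f_equal; ring).
  apply is_lim_seq_minus'; [apply is_lim_seq_const|].
  apply (is_lim_seq_inv _ p_infty); [|discriminate].
  apply (is_lim_seq_plus INR (fun _ => 2) p_infty 2 p_infty).
  - apply is_lim_seq_INR.
  - apply is_lim_seq_const.
  - reflexivity.
Qed.

(* Taylor coefficients of [(1 - t)^(-al)], that is [(al)_n / n!]. *)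
Fixpoint newton (al : R) (n : nat) : R :=
  match n with
  | O => 1
  | S m => newton al m * (al + INR m) / INR (S m)
  end.

(** For [0 < b < c] this is the n-th moment of the Beta distribution with parameters [b] and [c - b]
    on [0, 1], which explains its monotonicity in [n]. *)
Fixpoint poch_ratio (b c : R) (n : nat) : R :=
  match n with
  | O => 1
  | S m => poch_ratio b c m * (b + INR m) / (c + INR m)
  end.

Lemma newton_S (al : R) (n : nat) :
  INR (S n) * newton al (S n) = (al + INR n) * newton al n.
Proof.
  change (newton al (S n)) with (newton al n * (al + INR n) / INR (S n)).
  field. apply not_0_INR. lia.
Qed.

Lemma poch_ratio_S (b c : R) (n : nat) :
  c + INR n <> 0 ->
  (c + INR n) * poch_ratio b c (S n) = (b + INR n) * poch_ratio b c n.
Proof. intros H. cbn [poch_ratio]. field. exact H. Qed.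

Lemma newton_pos (al : R) (n : nat) : 0 < al -> 0 < newton al n.
Proof.
  intros Ha. induction n as [|n IH]; cbn [newton]; [lra|].
  assert (0 <= INR n) by apply pos_INR.
  assert (0 < INR (S n)) by (apply lt_0_INR; lia).
  apply Rdiv_lt_0_compat; [apply Rmult_lt_0_compat|]; lra.
Qed.

Lemma poch_ratio_pos (b c : R) (n : nat) :
  0 < b -> 0 < c -> 0 < poch_ratio b c n.
Proof.
  intros Hb Hc. induction n as [|n IH]; cbn [poch_ratio]; [lra|].
  assert (0 <= INR n) by apply pos_INR.
  apply Rdiv_lt_0_compat; [apply Rmult_lt_0_compat|]; lra.
Qed.

Lemma poch_ratio_decr (b c : R) (n k : nat) :
  0 < b -> b <= c -> poch_ratio b c (n + k) <= poch_ratio b c k.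
Proof.
  intros Hb Hc. induction n as [|n IH]; [simpl; lra|].
  apply Rle_trans with (2 := IH). simpl.
  assert (0 <= INR (n + k)) by apply pos_INR.
  assert (0 < poch_ratio b c (n + k)) by (apply poch_ratio_pos; lra).
  apply Rle_div_l; nra.
Qed.

Lemma ex_series_bounded_partial (v : nat -> R) (M : R) :
  (forall n, 0 <= v n) -> (forall N, sum_f_R0 v N <= M) -> ex_series v.
Proof.
  intros Hv HM.
  destruct (growing_cv (sum_f_R0 v)) as [l Hl].
  - intros n. simpl. specialize (Hv (S n)). lra.
  - exists M. intros x [n ->]. apply HM.
  - exists l. apply is_series_Reals. exact Hl.
Qed.

(** The [M + 1] terms of index [M + 1] to [2 M + 1] are each at least [l / (2 (M + 1))], so every
    such block contributes [l / 2], while tails of a convergent series become smaller than that. *)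
Lemma harmonic_not_dominated (v : nat -> R) (l : R) :
  ex_series v -> 0 < l -> (exists n0, forall n, (n0 <= n)%nat -> l <= INR n * v n) ->
  False.
Proof.
  intros Hv Hl [n0 Hn].
  assert (Ht := Series_tail_lim v Hv).
  assert (Hp : forall n, (n0 <= n)%nat -> 0 <= v n).
  { intros n H. specialize (Hn n H). assert (0 <= INR n) by apply pos_INR.
    destruct (Rlt_le_dec (v n) 0); auto. nra. }
  apply is_lim_seq_spec in Ht.
  assert (Hl2 : 0 < l / 2) by lra.
  destruct (Ht (mkposreal _ Hl2)) as [N HN].
  set (M := (n0 + N)%nat). specialize (HN M ltac:(lia)). simpl in HN.
  assert (Hx : ex_series (fun k => v (S M + k)%nat)).
  { apply (ex_series_incr_n v (S M)). exact Hv. }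
  rewrite Rminus_0_r in HN. apply Rabs_def2 in HN.
  rewrite (Series_incr_n _ (S M)) in HN; [|lia|exact Hx].
  assert (0 <= Series (fun k => v (S M + (S M + k))%nat)).
  { apply Series_ge_0.
    - intros n. apply Hp. lia.
    - apply (ex_series_incr_n (fun k => v (S M + k)%nat) (S M)). exact Hx. }
  assert (l / 2 <= sum_f_R0 (fun k => v (S M + k)%nat) (Init.Nat.pred (S M))).
  { apply Rle_trans with
      (sum_f_R0 (fun _ => l / (2 * INR (S M))) (Init.Nat.pred (S M))).
    - rewrite sum_cte. simpl Init.Nat.pred. right. field. apply not_0_INR. lia.
    - apply sum_Rle. intros n Hn'. simpl in Hn'.
      assert (0 < INR (S M)) by (apply lt_0_INR; lia).
      assert (H1 := Hn (S M + n)%nat ltac:(lia)).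
      assert (H2 : INR (S M + n) <= 2 * INR (S M)).
      { replace (2 * INR (S M)) with (INR (S M + S M)) by (rewrite plus_INR; ring).
        apply le_INR. lia. }
      assert (H3 := Hp (S M + n)%nat ltac:(lia)).
      apply Rle_div_l; [lra|]. nra. }
  cbn [Nat.add Init.Nat.pred] in *. lra.
Qed.

(** * Gauss's summation theorem *)

Lemma is_series_telescope (a u : nat -> R) (l : R) :
  (forall k, a k = u k - u (S k)) -> is_lim_seq u l -> is_series a (u O - l).
Proof.
  intros Ha Hu.
  assert (Hs : forall N, sum_n a N = u O - u (S N)).
  { induction N as [|N IH].
    - rewrite sum_O. apply Ha.
    - rewrite sum_Sn, IH, Ha. unfold plus; simpl. ring. }
  apply (is_lim_seq_ext (fun N => u O - u (S N)) (sum_n a) (u O - l)).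
  - intros N. symmetry. apply Hs.
  - apply is_lim_seq_minus'; [apply is_lim_seq_const|].
    apply -> is_lim_seq_incr_1. exact Hu.
Qed.

Lemma newton_poch_step (A B c : R) (k : nat) :
  0 < c ->
  INR k * (newton A k * poch_ratio B c k)
    - INR (S k) * (newton A (S k) * poch_ratio B c (S k))
  = newton A k * poch_ratio B c k
      * ((INR k * (c - A - B) - A * B) / (c + INR k)).
Proof.
  intros Hc. assert (0 <= INR k) by apply pos_INR.
  replace (INR (S k) * (newton A (S k) * poch_ratio B c (S k)))
    with (INR (S k) * newton A (S k) * poch_ratio B c (S k)) by ring.
  rewrite newton_S. cbn [poch_ratio]. field. lra.
Qed.

(** Raabe's argument. With [v] the general term, [k * v k] eventually drops by at least a fixed
    multiple of [v k] at each step, so the partial sums of [v] are bounded by telescoping. The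
    decreasing sequence [k * v k] then has a limit, and a positive limit would make [v] dominate a
    harmonic series. *)
Lemma newton_poch_summable (A B c : R) :
  0 < A -> 0 < B -> A + B < c ->
  ex_series (fun k => newton A k * poch_ratio B c k) /\
  is_lim_seq (fun k => INR k * (newton A k * poch_ratio B c k)) 0.
Proof.
  intros HA HB Hc.
  set (v := fun k => newton A k * poch_ratio B c k).
  set (u := fun k => INR k * v k).
  set (d := c - A - B). assert (Hd : 0 < d) by (unfold d; lra).
  assert (Hv : forall k, 0 < v k).
  { intros k. apply Rmult_lt_0_compat;
      [apply newton_pos | apply poch_ratio_pos]; lra. }
  assert (Hu0 : forall k, 0 <= u k).
  { intros k. apply Rmult_le_pos; [apply pos_INR | apply Rlt_le, Hv]. }
  (* From this index on, [k d - A B >= (d / 2) (c + k)], so the quotient in [newton_poch_step] is at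
     least [d / 2]. *)
  destruct (INR_unbounded ((A * B + c * d / 2) / (d / 2))) as [k0 Hk0].
  assert (Hk : forall k, (k0 <= k)%nat -> d / 2 * v k <= u k - u (S k)).
  { intros k Hk. unfold u, v. rewrite newton_poch_step by lra. fold d. fold (v k).
    apply le_INR in Hk.
    assert (A * B + c * d / 2 <= INR k * (d / 2)).
    { apply -> Rle_div_l; [|lra]. apply Rlt_le, Rlt_le_trans with (INR k0); auto. }
    rewrite Rmult_comm. apply Rmult_le_compat_l; [apply Rlt_le, Hv|].
    assert (0 <= INR k) by apply pos_INR.
    apply -> Rle_div_r; [|lra].
    assert (INR k * d - A * B >= d / 2 * (c + INR k)) by lra. lra. }
  assert (Hex : ex_series v).
  { apply (ex_series_incr_n v k0).
    apply ex_series_bounded_partial with (u k0 / (d / 2)).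
    - intros n. apply Rlt_le, Hv.
    - intros N.
      assert (Hs : d / 2 * sum_f_R0 (fun k => v (k0 + k)%nat) N
                   <= u k0 - u (k0 + S N)%nat).
      { induction N as [|N IH].
        - simpl. rewrite Nat.add_0_r, Nat.add_1_r. apply Hk. lia.
        - simpl sum_f_R0. specialize (Hk (k0 + S N)%nat ltac:(lia)).
          replace (k0 + S (S N))%nat with (S (k0 + S N)) by lia. lra. }
      specialize (Hu0 (k0 + S N)%nat). apply -> Rle_div_r; lra. }
  split; [exact Hex|].
  set (w := fun k => u (k0 + k)%nat).
  assert (Hw : forall k, w (S k) <= w k).
  { intros k. unfold w. specialize (Hk (k0 + k)%nat ltac:(lia)).
    specialize (Hv (k0 + k)%nat).
    replace (k0 + S k)%nat with (S (k0 + k)) by lia. nra. }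
  destruct (ex_finite_lim_seq_decr w 0 Hw) as [l Hl].
  { intros n. apply Hu0. }
  assert (Hl0 : 0 <= l).
  { apply (is_lim_seq_le (fun _ => 0) w 0 l); auto.
    - intros n; apply Hu0.
    - apply is_lim_seq_const. }
  assert (Hul : is_lim_seq u l).
  { apply is_lim_seq_incr_n with k0. apply is_lim_seq_ext with w; [|exact Hl].
    intros n. unfold w. f_equal. lia. }
  destruct (Req_dec l 0) as [->|Hne]; [exact Hul|exfalso].
  apply (harmonic_not_dominated v l Hex); [lra|].
  exists k0. intros n Hn.
  replace n with (k0 + (n - k0))%nat by lia.
  apply (is_lim_seq_decr_compare w l Hl Hw).
Qed.

(** Summation by parts: termwise, the difference of the two sides is the drop of
    [k * newton al k * mu (n + k)] from [k] to [k + 1], which telescopes to 0. The new moments thus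
    obey the recurrence of [mu] with [gam] lowered by [al] and the same [bet]. *)
Lemma newton_shift_sum (al gam bet : R) (mu : nat -> R) (n : nat) :
  (forall N, (gam + INR N) * mu (S N) = (bet + INR N) * mu N) ->
  ex_series (fun k => newton al k * mu (n + k)%nat) ->
  ex_series (fun k => newton al k * mu (S n + k)%nat) ->
  is_lim_seq (fun k => INR k * (newton al k * mu (n + k)%nat)) 0 ->
  (gam - al + INR n) * Series (fun k => newton al k * mu (S n + k)%nat)
  = (bet + INR n) * Series (fun k => newton al k * mu (n + k)%nat).
Proof.
  intros Hmu H0 H1 Hl.
  assert (Ht : is_series
    (fun k => (gam - al + INR n) * (newton al k * mu (S n + k)%nat)
              - (bet + INR n) * (newton al k * mu (n + k)%nat))
    (INR 0 * (newton al 0 * mu (n + 0)%nat) - 0)).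
  { apply (is_series_telescope _
      (fun k => INR k * (newton al k * mu (n + k)%nat))); [|exact Hl].
    intros k. specialize (Hmu (n + k)%nat). rewrite plus_INR in Hmu.
    replace (n + S k)%nat with (S (n + k)) by lia.
    replace (S n + k)%nat with (S (n + k)) by lia.
    assert (Hs := newton_S al k).
    replace (INR (S k) * (newton al (S k) * mu (S (n + k))))
      with (INR (S k) * newton al (S k) * mu (S (n + k))) by ring.
    rewrite Hs.
    replace ((gam - al + INR n) * (newton al k * mu (S (n + k))))
      with (newton al k * ((gam + (INR n + INR k)) * mu (S (n + k))
             - (al + INR k) * mu (S (n + k)))) by ring.
    rewrite Hmu. ring. }
  apply is_series_unique in Ht.
  rewrite Series_minus, !Series_scal_l in Ht.
  - change (INR 0) with 0 in Ht. lra.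
  - exact (ex_series_scal (gam - al + INR n) _ H1).
  - exact (ex_series_scal (bet + INR n) _ H0).
Qed.

Lemma poch_ratio_shift (b c : R) (k : nat) :
  0 < c -> poch_ratio b (c + 1) k * (c + INR k) = poch_ratio b c k * c.
Proof.
  intros Hc. induction k as [|k IH]; [simpl; ring|].
  assert (0 <= INR k) by apply pos_INR.
  cbn [poch_ratio]. rewrite S_INR.
  transitivity (poch_ratio b (c + 1) k * (c + INR k) * (b + INR k) / (c + INR k)).
  - field. lra.
  - rewrite IH. field. lra.
Qed.

(** Contiguity in the lower parameter. Termwise the difference of the two sides is the drop of
    [c * k * v k], where [v] is the general term at [c]; it vanishes at [k = 0] and in the limit. *)
Lemma gauss_shift (A B c : R) :
  0 < A -> 0 < B -> A + B < c ->
  c * (c - A - B) * Series (fun k => newton A k * poch_ratio B c k)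
  = (c - A) * (c - B) * Series (fun k => newton A k * poch_ratio B (c + 1) k).
Proof.
  intros HA HB Hc.
  destruct (newton_poch_summable A B c HA HB Hc) as [H0 Hl].
  destruct (newton_poch_summable A B (c + 1) HA HB ltac:(lra)) as [H1 _].
  assert (Ht : is_series
    (fun k => c * (c - A - B) * (newton A k * poch_ratio B c k)
              - (c - A) * (c - B) * (newton A k * poch_ratio B (c + 1) k))
    (c * (INR 0 * (newton A 0 * poch_ratio B c 0)) - c * 0)).
  { apply (is_series_telescope _
      (fun k => c * (INR k * (newton A k * poch_ratio B c k)))).
    - intros k. rewrite <- Rmult_minus_distr_l, newton_poch_step by lra.
      assert (0 <= INR k) by apply pos_INR.
      assert (Hp := poch_ratio_shift B c k ltac:(lra)).
      replace (poch_ratio B (c + 1) k)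
        with (poch_ratio B c k * c / (c + INR k)) by (rewrite <- Hp; field; lra).
      field. lra.
    - exact (is_lim_seq_scal_l _ c 0 Hl). }
  apply is_series_unique in Ht.
  rewrite Series_minus, !Series_scal_l in Ht.
  - change (INR 0) with 0 in Ht. lra.
  - exact (ex_series_scal (c * (c - A - B)) _ H0).
  - exact (ex_series_scal ((c - A) * (c - B)) _ H1).
Qed.

(** Both sides equal [b] at the first factor, and every later factor only decreases when [x] is
    added below. The terms [k >= 1] of the Gauss series therefore shrink at least like
    [c / (c + x)], so that only the constant term survives as the lower parameter grows. *)
Lemma poch_ratio_bound (b c x : R) (k : nat) :
  0 < b -> 0 < c -> 0 <= x ->
  poch_ratio b (c + x) (S k) * (c + x) <= poch_ratio b c (S k) * c.
Proof.
  intros Hb Hc Hx. induction k as [|k IH].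
  - simpl. right. field. lra.
  - change (poch_ratio b (c + x) (S (S k)))
      with (poch_ratio b (c + x) (S k) * (b + INR (S k)) / (c + x + INR (S k))).
    change (poch_ratio b c (S (S k)))
      with (poch_ratio b c (S k) * (b + INR (S k)) / (c + INR (S k))).
    assert (0 <= INR (S k)) by apply pos_INR.
    assert (0 < poch_ratio b c (S k)) by (apply poch_ratio_pos; lra).
    set (y := INR (S k)) in *. set (p := poch_ratio b (c + x) (S k)) in *.
    set (q := poch_ratio b c (S k)) in *.
    replace (p * (b + y) / (c + x + y) * (c + x))
      with (p * (c + x) * ((b + y) / (c + x + y))) by (field; lra).
    replace (q * (b + y) / (c + y) * c)
      with (q * c * ((b + y) / (c + y))) by (field; lra).
    apply Rle_trans with (q * c * ((b + y) / (c + x + y))).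
    + apply Rmult_le_compat_r; [|exact IH].
      apply Rlt_le, Rdiv_lt_0_compat; lra.
    + apply Rmult_le_compat_l; [nra|].
      apply Rmult_le_compat_l; [lra|]. apply Rinv_le_contravar; lra.
Qed.

Lemma gauss_limit (A B c : R) :
  0 < A -> 0 < B -> A + B < c ->
  is_lim_seq (fun n => Series (fun k => newton A k * poch_ratio B (c + INR n) k)) 1.
Proof.
  intros HA HB Hc.
  destruct (newton_poch_summable A B c HA HB Hc) as [H0 _].
  set (T := Series (fun k => newton A (S k) * poch_ratio B c (S k))).
  assert (H0' : ex_series (fun k => newton A (S k) * poch_ratio B c (S k))).
  { apply (ex_series_incr_1 (fun k => newton A k * poch_ratio B c k)). exact H0. }
  apply is_lim_seq_le_le with (fun _ => 1) (fun n => 1 + c * T * / (c + INR n)).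
  - intros n. assert (Hn : 0 <= INR n) by apply pos_INR.
    destruct (newton_poch_summable A B (c + INR n) HA HB ltac:(lra)) as [H1 _].
    rewrite Series_incr_1 by exact H1.
    change (newton A 0 * poch_ratio B (c + INR n) 0) with (1 * 1).
    assert (H1' : ex_series
      (fun k => newton A (S k) * poch_ratio B (c + INR n) (S k))).
    { apply (ex_series_incr_1
        (fun k => newton A k * poch_ratio B (c + INR n) k)). exact H1. }
    assert (Hpos : forall k, 0 <= newton A (S k) * poch_ratio B (c + INR n) (S k)).
    { intros k. apply Rmult_le_pos; apply Rlt_le;
        [apply newton_pos | apply poch_ratio_pos]; lra. }
    split.
    + assert (0 <= Series (fun k => newton A (S k) * poch_ratio B (c + INR n) (S k)))
        by (apply Series_ge_0; auto). lra.
    + assert (Series (fun k => newton A (S k) * poch_ratio B (c + INR n) (S k))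
              <= Series (fun k => c / (c + INR n)
                   * (newton A (S k) * poch_ratio B c (S k)))).
      { apply Series_le.
        - intros k. split; [apply Hpos|].
          assert (Hb := poch_ratio_bound B c (INR n) k HB ltac:(lra) Hn).
          assert (Hg := newton_pos A (S k) HA).
          replace (c / (c + INR n) * (newton A (S k) * poch_ratio B c (S k)))
            with (newton A (S k) * (poch_ratio B c (S k) * c / (c + INR n)))
            by (field; lra).
          apply Rmult_le_compat_l; [lra|]. apply -> Rle_div_r; lra.
        - exact (ex_series_scal (c / (c + INR n)) _ H0'). }
      rewrite Series_scal_l in H. fold T in H.
      replace (c * T * / (c + INR n)) with (c / (c + INR n) * T) by (field; lra).
      lra.
  - apply is_lim_seq_const.
  - replace (Finite 1) with (Finite (1 + c * T * 0)) by (f_equal; ring).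
    apply is_lim_seq_plus'; [apply is_lim_seq_const|].
    apply (is_lim_seq_scal_l (fun n => / (c + INR n)) (c * T) 0).
    apply (is_lim_seq_inv (fun n => c + INR n) p_infty); [|discriminate].
    apply (is_lim_seq_plus (fun _ => c) INR c p_infty p_infty).
    + apply is_lim_seq_const.
    + apply is_lim_seq_INR.
    + reflexivity.
Qed.

Fixpoint rpoch (x : R) (n : nat) : R :=
  match n with
  | O => 1
  | S m => rpoch x m * (x + INR m)
  end.

Lemma rpoch_pos (x : R) (n : nat) : 0 < x -> 0 < rpoch x n.
Proof.
  intros Hx. induction n as [|n IH]; simpl; [lra|].
  assert (0 <= INR n) by apply pos_INR. apply Rmult_lt_0_compat; lra.
Qed.

Lemma gauss_iter (A B c : R) (n : nat) :
  0 < A -> 0 < B -> A + B < c ->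
  rpoch c n * rpoch (c - A - B) n * Series (fun k => newton A k * poch_ratio B c k)
  = rpoch (c - A) n * rpoch (c - B) n
    * Series (fun k => newton A k * poch_ratio B (c + INR n) k).
Proof.
  intros HA HB Hc. induction n as [|n IH].
  - simpl. rewrite Rplus_0_r. ring.
  - assert (Hn : 0 <= INR n) by apply pos_INR.
    assert (Hg := gauss_shift A B (c + INR n) HA HB ltac:(lra)).
    rewrite S_INR, <- Rplus_assoc. cbn [rpoch].
    set (S0 := Series (fun k => newton A k * poch_ratio B c k)) in *.
    set (S1 := Series (fun k => newton A k * poch_ratio B (c + INR n) k)) in *.
    set (S2 := Series (fun k => newton A k * poch_ratio B (c + INR n + 1) k)) in *.
    transitivity (rpoch c n * rpoch (c - A - B) n * S0
                  * ((c + INR n) * (c - A - B + INR n))); [ring|].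
    rewrite IH.
    transitivity (rpoch (c - A) n * rpoch (c - B) n
                  * ((c + INR n) * (c + INR n - A - B) * S1)); [ring|].
    rewrite Hg. ring.
Qed.

(** * Improper integrals on the half-line and asymptotics of the Gamma function *)

Lemma half_line_filter (P : R * R -> Prop) :
  (forall a b, 0 < a < 1 -> 1 < b -> P (a, b)) ->
  filter_prod (at_right 0) (Rbar_locally p_infty) P.
Proof.
  intros H. apply Filter_prod with (fun a => 0 < a < 1) (fun b => 1 < b); auto.
  - exists (mkposreal 1 Rlt_0_1). intros y Hy Hy0. split; [exact Hy0|].
    unfold ball in Hy; simpl in Hy. unfold AbsRing_ball, abs, minus, plus, opp in Hy.
    simpl in Hy. apply Rabs_def2 in Hy. lra.
  - exists 1. auto.
Qed.

Lemma is_RInt_gen_half_line_ext (f g : R -> R) (l : R) :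
  (forall t, 0 < t -> f t = g t) ->
  is_RInt_gen f (at_right 0) (Rbar_locally p_infty) l ->
  is_RInt_gen g (at_right 0) (Rbar_locally p_infty) l.
Proof.
  intros H. apply is_RInt_gen_ext. apply half_line_filter.
  simpl. intros a b Ha Hb x Hx. apply H.
  rewrite Rmin_left in Hx by lra. lra.
Qed.

Lemma is_RInt_gen_half_line_le (f g : R -> R) (lf lg : R) :
  (forall t, 0 < t -> f t <= g t) ->
  is_RInt_gen f (at_right 0) (Rbar_locally p_infty) lf ->
  is_RInt_gen g (at_right 0) (Rbar_locally p_infty) lg -> lf <= lg.
Proof.
  intros H Hf Hg.
  assert (Hm := is_RInt_gen_minus _ _ _ _ Hg Hf).
  assert (Hn : norm (minus lg lf) <= minus lg lf).
  { apply (RInt_gen_norm (Fa := at_right 0) (Fb := Rbar_locally p_infty)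
             (fun y => minus (g y) (f y)) (fun y => minus (g y) (f y))); auto.
    - apply half_line_filter. simpl. intros; lra.
    - apply half_line_filter. simpl. intros a b Ha Hb x Hx.
      specialize (H x ltac:(lra)).
      unfold norm, minus, plus, opp; simpl. unfold abs; simpl.
      rewrite Rabs_pos_eq; lra. }
  revert Hn. unfold norm, minus, plus, opp; simpl. unfold abs; simpl.
  intros Hn. assert (H0 := Rabs_pos (lg + - lf)). lra.
Qed.

Lemma is_RInt_gen_half_line_ge (f : R -> R) (l a b : R) :
  (forall t, 0 < t -> 0 <= f t) -> (forall t, 0 < t -> continuous f t) ->
  is_RInt_gen f (at_right 0) (Rbar_locally p_infty) l ->
  0 < a -> a <= b -> RInt f a b <= l.
Proof.
  intros Hf Hc Hl Ha Hab.
  apply Rnot_lt_le. intros Hlt.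
  set (e := RInt f a b - l). assert (He : 0 < e) by (unfold e; lra).
  specialize (Hl (fun y => Rabs (y - l) < e)).
  assert (Hloc : locally l (fun y => Rabs (y - l) < e)).
  { exists (mkposreal e He). intros y Hy. exact Hy. }
  specialize (Hl Hloc). unfold filtermapi in Hl.
  assert (Hp : filter_prod (at_right 0) (Rbar_locally p_infty)
    (fun ab : R * R => 0 < fst ab < a /\ b < snd ab)).
  { apply Filter_prod with (fun x => 0 < x < a) (fun x => b < x).
    - exists (mkposreal a Ha). intros y Hy Hy0. split; [exact Hy0|].
      unfold ball in Hy; simpl in Hy. unfold AbsRing_ball, abs, minus, plus, opp in Hy.
      simpl in Hy. apply Rabs_def2 in Hy. lra.
    - exists b. auto.
    - auto. }
  destruct (filter_ex _ (filter_and _ _ Hl Hp)) as [[x y] [[v [Hv Hve]] [Hx Hy]]].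
  simpl in Hv, Hx, Hy.
  assert (Hex : forall p q, 0 < p -> p <= q -> ex_RInt f p q).
  { intros p q Hp0 Hpq. apply (ex_RInt_continuous (V := R_CompleteNormedModule)). intros z Hz. apply Hc.
    rewrite Rmin_left in Hz by lra. lra. }
  assert (H1 : RInt f x y = RInt f x a + RInt f a b + RInt f b y).
  { rewrite <- (RInt_Chasles f x b y) by (apply Hex; lra).
    rewrite <- (RInt_Chasles f x a b) by (apply Hex; lra). reflexivity. }
  assert (H2 : 0 <= RInt f x a).
  { apply RInt_ge_0; [lra|apply Hex; lra|]. intros; apply Hf; lra. }
  assert (H3 : 0 <= RInt f b y).
  { apply RInt_ge_0; [lra|apply Hex; lra|]. intros; apply Hf; lra. }
  apply (is_RInt_unique (V := R_CompleteNormedModule)) in Hv. rewrite Hv in H1.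
  apply Rabs_def2 in Hve. unfold e in Hve. lra.
Qed.

Lemma exp_mono (x y : R) : x <= y -> exp x <= exp y.
Proof.
  intros [H | ->]; [apply Rlt_le, exp_increasing, H | apply Rle_refl].
Qed.

Definition gamma_kernel (x t : R) : R := Rpower t (x - 1) * exp (- t).

Lemma gamma_kernel_pos (x t : R) : 0 < gamma_kernel x t.
Proof. apply Rmult_lt_0_compat; [apply exp_pos | apply exp_pos]. Qed.

Lemma gamma_kernel_continuous (x t : R) :
  0 < t -> continuous (gamma_kernel x) t.
Proof.
  intros Ht. apply (ex_derive_continuous (gamma_kernel x)).
  unfold gamma_kernel, Rpower. auto_derive. exact Ht.
Qed.

Lemma is_Gamma_pos (x g : R) : is_Gamma x g -> 0 < g.
Proof.
  intros H.
  apply Rlt_le_trans with (RInt (gamma_kernel x) 1 2).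
  - apply RInt_gt_0; [lra | |].
    + intros; apply gamma_kernel_pos.
    + intros; apply gamma_kernel_continuous; lra.
  - apply (is_RInt_gen_half_line_ge (gamma_kernel x)); auto; try lra.
    + intros; apply Rlt_le, gamma_kernel_pos.
    + intros; apply gamma_kernel_continuous; lra.
Qed.

(** For [x <= 0] the integrand is at least [exp (-1) / t] on (0, 1], whose integral diverges at 0.
    In the theorem this turns the existence of Gamma at [c - A - B] into [A + B < c]. *)
Lemma is_Gamma_arg_pos (x g : R) : is_Gamma x g -> 0 < x.
Proof.
  intros H. apply Rnot_le_lt. intros Hx.
  (* Chosen so that the integral of [exp (-1) / t] over [a, 1] is [g + exp (-1)], which exceeds
     [g]. *)
  set (a := exp (- (g * exp 1 + 1))).
  assert (Hg := is_Gamma_pos x g H).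
  assert (He := exp_pos 1).
  assert (Ha0 : 0 < a) by apply exp_pos.
  assert (Ha1 : a < 1).
  { apply Rlt_le_trans with (exp 0); [|rewrite exp_0; lra].
    apply exp_increasing.
    assert (0 < g * exp 1) by (apply Rmult_lt_0_compat; auto). lra. }
  assert (H1 : RInt (gamma_kernel x) a 1 <= g).
  { apply (is_RInt_gen_half_line_ge (gamma_kernel x)); auto; try lra.
    - intros; apply Rlt_le, gamma_kernel_pos.
    - intros; apply gamma_kernel_continuous; lra. }
  assert (H2 : is_RInt (fun t => exp (-1) * / t) a 1 (exp (-1) * (ln 1 - ln a))).
  { apply (is_RInt_scal (fun t => / t) a 1 (exp (-1)) (ln 1 - ln a)).
    apply (is_RInt_derive ln Rinv).
    - intros t Ht. rewrite Rmin_left in Ht by lra. apply is_derive_ln. lra.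
    - intros t Ht. rewrite Rmin_left in Ht by lra. apply continuous_Rinv. lra. }
  assert (H3 : exp (-1) * (ln 1 - ln a) <= RInt (gamma_kernel x) a 1).
  { rewrite <- (is_RInt_unique (V := R_CompleteNormedModule) _ _ _ _ H2). apply RInt_le; [lra| | |].
    - eexists; exact H2.
    - apply (ex_RInt_continuous (V := R_CompleteNormedModule) (gamma_kernel x)). intros z Hz.
      rewrite Rmin_left in Hz by lra. apply gamma_kernel_continuous; lra.
    - intros t Ht. unfold gamma_kernel, Rpower.
      rewrite <- (exp_ln (/ t)) by (apply Rinv_0_lt_compat; lra).
      rewrite <- !exp_plus, ln_Rinv by lra.
      assert (Hl : ln t < 0) by (rewrite <- ln_1; apply ln_increasing; lra).
      apply exp_mono. nra. }
  rewrite ln_1 in H3. unfold a in H3 at 1. rewrite ln_exp in H3.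
  assert (H4 : exp (-1) * exp 1 = 1) by (rewrite <- exp_plus; replace (-1 + 1) with 0 by ring; apply exp_0).
  assert (H5 : exp (-1) > 0) by apply exp_pos.
  nra.
Qed.

Lemma Rpower_exp_lim_0 (x : R) :
  0 < x -> filterlim (fun t => Rpower t x * exp (- t)) (at_right 0) (locally 0).
Proof.
  intros Hx P [eps HP].
  set (d := Rmin 1 (Rpower eps (/ x))).
  assert (Hd : 0 < d).
  { apply Rmin_glb_lt; [lra | apply exp_pos]. }
  exists (mkposreal d Hd). intros t Ht Ht0. apply HP.
  unfold ball in *; simpl in *. unfold AbsRing_ball, abs, minus, plus, opp in *.
  simpl in *. rewrite Ropp_0, Rplus_0_r in *.
  rewrite Rabs_pos_eq in Ht by lra.
  assert (H1 : 0 < Rpower t x) by apply exp_pos.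
  assert (H2 := exp_pos (- t)).
  rewrite Rabs_pos_eq by (apply Rlt_le, Rmult_lt_0_compat; auto).
  assert (H3 : exp (- t) < 1).
  { apply Rlt_le_trans with (exp 0); [|rewrite exp_0; lra].
    apply exp_increasing. lra. }
  assert (H4 : Rpower t x < eps).
  { replace (pos eps) with (Rpower (Rpower eps (/ x)) x).
    - apply Rlt_Rpower_l; auto. split; auto.
      apply Rlt_le_trans with (1 := Ht). apply Rmin_r.
    - rewrite Rpower_mult, Rinv_l by lra. apply Rpower_1. apply cond_pos. }
  nra.
Qed.

Lemma Rpower_exp_lim_infty (x : R) :
  0 < x ->
  filterlim (fun t => Rpower t x * exp (- t)) (Rbar_locally p_infty) (locally 0).
Proof.
  intros Hx.
  assert (Hl := is_lim_div_ln_p). apply is_lim_spec in Hl.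
  (* Once [ln t < t / (2 x)], the exponent [x ln t - t] is below [- t / 2], hence below [ln eps] for
     [t > - 2 ln eps]. *)
  assert (He : 0 < / (2 * x)) by (apply Rinv_0_lt_compat; lra).
  destruct (Hl (mkposreal _ He)) as [M HM]. simpl in HM.
  intros P [eps HP].
  exists (Rmax (Rmax M 0) (- 2 * ln eps)). intros t Ht.
  assert (Ht1 := Rmax_l (Rmax M 0) (- 2 * ln eps)).
  assert (Ht2 := Rmax_r (Rmax M 0) (- 2 * ln eps)).
  assert (Ht3 := Rmax_l M 0). assert (Ht4 := Rmax_r M 0).
  specialize (HM t ltac:(lra)). rewrite Rminus_0_r in HM.
  apply Rabs_def2 in HM. destruct HM as [HM _].
  assert (H1 : ln t < / (2 * x) * t) by (apply Rlt_div_l; [lra | exact HM]).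
  apply HP.
  unfold ball in *; simpl in *. unfold AbsRing_ball, abs, minus, plus, opp in *.
  simpl in *. rewrite Ropp_0, Rplus_0_r.
  unfold Rpower. rewrite <- exp_plus, Rabs_pos_eq by (apply Rlt_le, exp_pos).
  rewrite <- (exp_ln eps) by apply cond_pos. apply exp_increasing.
  assert (H2 : x * ln t < x * (/ (2 * x) * t)) by (apply Rmult_lt_compat_l; auto).
  replace (x * (/ (2 * x) * t)) with (t / 2) in H2 by (field; lra). lra.
Qed.

Lemma Rpower_S (t x : R) : 0 < t -> Rpower t x = Rpower t (x - 1) * t.
Proof.
  intros Ht. rewrite <- (Rpower_1 t) at 3 by auto. rewrite <- Rpower_plus.
  f_equal. ring.
Qed.

(** Integration by parts: [- t^x e^(-t)] vanishes at both ends, and its derivative is the integrand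
    at [x + 1] minus [x] times the integrand at [x]. *)
Lemma is_Gamma_succ (x g : R) : 0 < x -> is_Gamma x g -> is_Gamma (x + 1) (x * g).
Proof.
  intros Hx Hg.
  set (f := fun t => - (Rpower t x * exp (- t))).
  assert (Hd : forall t, 0 < t ->
    is_derive f t (Rpower t x * exp (- t) - x * gamma_kernel x t)).
  { intros t Ht. unfold f, gamma_kernel. rewrite (Rpower_S t x Ht). unfold Rpower.
    auto_derive; [exact Ht|].
    replace (exp (x * ln t)) with (exp ((x - 1) * ln t) * t).
    - field. lra.
    - rewrite <- (exp_ln t) at 2 by auto. rewrite <- exp_plus. f_equal. ring. }
  assert (HD : is_RInt_gen (Derive f) (at_right 0) (Rbar_locally p_infty) (0 - 0)).
  { apply is_RInt_gen_Derive.
    - apply half_line_filter. simpl. intros a b Ha Hb t Ht.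
      rewrite Rmin_left in Ht by lra. eexists. apply Hd. lra.
    - apply half_line_filter. simpl. intros a b Ha Hb t Ht.
      rewrite Rmin_left in Ht by lra. assert (Ht0 : 0 < t) by lra.
      apply continuous_ext_loc with
        (fun t => Rpower t x * exp (- t) - x * gamma_kernel x t).
      + exists (mkposreal t Ht0). intros s Hs. symmetry. apply is_derive_unique, Hd.
        unfold ball in Hs; simpl in Hs.
        unfold AbsRing_ball, abs, minus, plus, opp in Hs.
        simpl in Hs. apply Rabs_def2 in Hs. lra.
      + apply (ex_derive_continuous
          (fun t => Rpower t x * exp (- t) - x * gamma_kernel x t)).
        unfold gamma_kernel, Rpower. auto_derive. auto.
    - assert (H := filterlim_comp _ _ _ _ Ropp _ _ _ (Rpower_exp_lim_0 x Hx)
        (filterlim_opp 0)).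
      rewrite <- Ropp_0 at 2. exact H.
    - assert (H := filterlim_comp _ _ _ _ Ropp _ _ _ (Rpower_exp_lim_infty x Hx)
        (filterlim_opp 0)).
      rewrite <- Ropp_0. exact H. }
  assert (Hs := is_RInt_gen_plus _ _ _ _ HD (is_RInt_gen_scal _ x _ Hg)).
  unfold is_Gamma.
  replace (x * g) with (plus (0 - 0) (scal x g))
    by (unfold plus, scal; simpl; unfold mult; simpl; ring).
  revert Hs. apply is_RInt_gen_half_line_ext. intros t Ht.
  rewrite (is_derive_unique _ _ _ (Hd t Ht)).
  unfold plus, scal; simpl. unfold mult; simpl. unfold gamma_kernel.
  replace (x + 1 - 1) with x by ring. ring.
Qed.

Lemma is_Gamma_add_nat (x g : R) (n : nat) :
  is_Gamma x g -> is_Gamma (x + INR n) (rpoch x n * g).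
Proof.
  intros Hg. assert (Hx := is_Gamma_arg_pos x g Hg).
  induction n as [|n IH].
  - simpl. rewrite Rplus_0_r, Rmult_1_l. exact Hg.
  - rewrite S_INR, <- Rplus_assoc. cbn [rpoch].
    replace (rpoch x n * (x + INR n) * g)
      with ((x + INR n) * (rpoch x n * g)) by ring.
    apply is_Gamma_succ; [|exact IH].
    assert (0 <= INR n) by apply pos_INR. lra.
Qed.

(** For these exponents [v^p] is convex, and the left side is its tangent at [v = 1]. Only
    [1 + u <= exp u] is used in the proof. *)
Lemma Rpower_tangent (v p : R) :
  0 < v -> p <= 0 \/ 1 <= p -> 1 + p * (v - 1) <= Rpower v p.
Proof.
  intros Hv Hp. unfold Rpower. set (L := ln v).
  assert (HvL : v = exp L) by (symmetry; apply exp_ln, Hv).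
  destruct Hp as [Hp | Hp].
  - assert (H1 := exp_ineq1_le L). assert (H2 := exp_ineq1_le (p * L)).
    rewrite HvL. nra.
  - assert (H1 := exp_ineq1_le ((p - 1) * L)).
    assert (H2 := exp_ineq1_le (- L)).
    assert (H3 := exp_pos L).
    assert (H4 : exp L * exp ((p - 1) * L) = exp (p * L))
      by (rewrite <- exp_plus; f_equal; ring).
    assert (H5 : exp L * exp (- L) = 1)
      by (rewrite <- exp_plus, Rplus_opp_r; apply exp_0).
    rewrite HvL. rewrite <- H4.
    assert (H6 : exp L * (1 + (p - 1) * L) <= exp L * exp ((p - 1) * L))
      by (apply Rmult_le_compat_l; lra).
    assert (H7 : exp L * (1 + - L) <= 1)
      by (rewrite <- H5 at 2; apply Rmult_le_compat_l; lra).
    nra.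
Qed.

(** Integrate the tangent bound of [t^p] at [t = y] against [gamma_kernel x], whose first moment is
    [x * g1]. This stands in for the log-convexity of Gamma in the two ratio bounds below. *)
Lemma Gamma_tangent (x y p g1 gp : R) :
  0 < x -> 0 < y -> p <= 0 \/ 1 <= p -> is_Gamma x g1 -> is_Gamma (x + p) gp ->
  Rpower y p * ((1 - p) + p * x / y) * g1 <= gp.
Proof.
  intros Hx Hy Hp H1 Hgp.
  assert (H2 := is_Gamma_succ x g1 Hx H1).
  assert (Hs := is_RInt_gen_plus _ _ _ _
    (is_RInt_gen_scal _ (Rpower y p * (1 - p)) _ H1)
    (is_RInt_gen_scal _ (Rpower y p * p / y) _ H2)).
  replace (Rpower y p * ((1 - p) + p * x / y) * g1)
    with (plus (scal (Rpower y p * (1 - p)) g1)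
               (scal (Rpower y p * p / y) (x * g1)))
    by (unfold plus, scal; simpl; unfold mult; simpl; field; lra).
  refine (is_RInt_gen_half_line_le _ _ _ _ _ Hs Hgp).
  intros t Ht. unfold plus, scal; simpl. unfold mult; simpl.
  replace (x + 1 - 1) with x by ring.
  replace (x + p - 1) with (x - 1 + p) by ring.
  rewrite (Rpower_S t x Ht), Rpower_plus.
  assert (Hv : 0 < t / y) by (apply Rdiv_lt_0_compat; auto).
  assert (Ht1 := Rpower_tangent (t / y) p Hv Hp).
  assert (Hm : Rpower t p = Rpower y p * Rpower (t / y) p).
  { rewrite Rpower_mult_distr by auto. f_equal. field. lra. }
  rewrite Hm.
  assert (He : 0 < Rpower t (x - 1) * exp (- t) * Rpower y p).
  { repeat apply Rmult_lt_0_compat; apply exp_pos. }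
  replace (Rpower y p * (1 - p) * (Rpower t (x - 1) * exp (- t)) +
    Rpower y p * p / y * (Rpower t (x - 1) * t * exp (- t)))
    with (Rpower t (x - 1) * exp (- t) * Rpower y p * (1 + p * (t / y - 1)))
    by (field; lra).
  replace (Rpower t (x - 1) * (Rpower y p * Rpower (t / y) p) * exp (- t))
    with (Rpower t (x - 1) * exp (- t) * Rpower y p * Rpower (t / y) p) by ring.
  apply Rmult_le_compat_l; lra.
Qed.

(** The tangent bound at base point [x + s] with exponent [- s]; taking the tangent at the mean
    [x + s] of the kernel makes the linear factor equal to 1. *)
Lemma Gamma_ratio_upper (x s g gs : R) :
  0 < x -> 0 <= s -> is_Gamma x g -> is_Gamma (x + s) gs ->
  gs <= Rpower (x + s) s * g.
Proof.
  intros Hx Hs H1 H2.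
  assert (H := Gamma_tangent (x + s) (x + s) (- s) gs g).
  replace (x + s + - s) with x in H by ring.
  specialize (H ltac:(lra) ltac:(lra) ltac:(lra) H2 H1).
  replace (1 - - s + - s * (x + s) / (x + s)) with 1 in H by (field; lra).
  rewrite Rpower_Ropp, Rmult_1_r in H.
  assert (Hp : 0 < Rpower (x + s) s) by apply exp_pos.
  apply (Rmult_le_compat_l (Rpower (x + s) s)) in H; [|lra].
  rewrite <- Rmult_assoc, Rinv_r, Rmult_1_l in H by lra. exact H.
Qed.

(** The exponent [s] may lie in (0, 1), where convexity fails, so the tangent bound is used with
    [s + 1] and the surplus factor [x + s] is divided out. *)
Lemma Gamma_ratio_lower (x s g gs : R) :
  0 < x -> 0 <= s -> is_Gamma x g -> is_Gamma (x + s) gs ->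
  Rpower x s * (x / (x + s)) * g <= gs.
Proof.
  intros Hx Hs H1 H2.
  assert (H3 := is_Gamma_succ (x + s) gs ltac:(lra) H2).
  rewrite Rplus_assoc in H3.
  assert (H := Gamma_tangent x x (s + 1) g _ Hx Hx ltac:(right; lra) H1 H3).
  replace (1 - (s + 1) + (s + 1) * x / x) with 1 in H by (field; lra).
  rewrite Rpower_plus, Rpower_1, Rmult_1_r in H by auto.
  replace (Rpower x s * (x / (x + s)) * g)
    with (Rpower x s * x * g / (x + s)) by (field; lra).
  apply Rle_div_l; lra.
Qed.

(** With [y = u + n] the term is the ratio of Gamma at [y + s] to Gamma at [y], divided by [y^s].
    The two ratio bounds squeeze it, the upper one through [(1 + s / y)^s <= exp (s^2 / y)]. *)
Lemma Gamma_ratio_lim (u s g gs : R) :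
  0 <= s -> is_Gamma u g -> is_Gamma (u + s) gs ->
  is_lim_seq (fun n => rpoch (u + s) n * gs
                       / (rpoch u n * g * Rpower (u + INR n) s)) 1.
Proof.
  intros Hs H1 H2.
  assert (Hu := is_Gamma_arg_pos _ _ H1).
  assert (Hinf : is_lim_seq (fun n => / (u + INR n)) 0).
  { apply (is_lim_seq_inv (fun n => u + INR n) p_infty); [|discriminate].
    apply (is_lim_seq_plus (fun _ => u) INR u p_infty p_infty).
    + apply is_lim_seq_const.
    + apply is_lim_seq_INR.
    + reflexivity. }
  apply is_lim_seq_le_le with
    (fun n => / (1 + s * / (u + INR n))) (fun n => exp (s * s * / (u + INR n))).
  - intros n. assert (Hn : 0 <= INR n) by apply pos_INR.
    assert (G1 := is_Gamma_add_nat u g n H1).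
    assert (G2 := is_Gamma_add_nat (u + s) gs n H2).
    set (y := u + INR n) in *.
    replace (u + s + INR n) with (y + s) in G2 by (unfold y; ring).
    assert (Hy : 0 < y) by (unfold y; lra).
    assert (P1 := is_Gamma_pos _ _ G1). assert (P2 := is_Gamma_pos _ _ G2).
    set (a := rpoch u n * g) in *. set (b := rpoch (u + s) n * gs) in *.
    assert (Hp : 0 < Rpower y s) by apply exp_pos.
    assert (Hap : 0 < a * Rpower y s) by (apply Rmult_lt_0_compat; auto).
    split.
    + apply -> Rle_div_r; [|lra].
      assert (HL := Gamma_ratio_lower y s a b Hy Hs G1 G2).
      replace (/ (1 + s * / y) * (a * Rpower y s))
        with (Rpower y s * (y / (y + s)) * a) by (field; lra).
      exact HL.
    + apply Rle_div_l; [lra|].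
      assert (HU := Gamma_ratio_upper y s a b Hy Hs G1 G2).
      apply Rle_trans with (1 := HU).
      assert (HR : Rpower (y + s) s <= exp (s * s * / y) * Rpower y s).
      { unfold Rpower. rewrite <- exp_plus. apply exp_mono.
        replace (y + s) with (y * (1 + s * / y)) by (field; lra).
        assert (Hsy : 0 <= s * / y).
        { apply Rmult_le_pos; [lra|]. apply Rlt_le, Rinv_0_lt_compat, Hy. }
        rewrite ln_mult by lra.
        assert (ln (1 + s * / y) <= s * / y).
        { rewrite <- (ln_exp (s * / y)) at 2. apply ln_le; [lra|]. 
          apply exp_ineq1_le. }
        nra. }
      replace (exp (s * s * / y) * (a * Rpower y s))
        with (exp (s * s * / y) * Rpower y s * a) by ring.
      apply Rmult_le_compat_r; lra.
  - replace (Finite 1) with (Rbar_inv (1 + s * 0)) by (simpl; f_equal; field).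
    apply is_lim_seq_inv.
    + apply is_lim_seq_plus'; [apply is_lim_seq_const|].
      exact (is_lim_seq_scal_l _ s 0 Hinf).
    + simpl. intros H. injection H. lra.
  - replace (Finite 1) with (Finite (exp (s * s * 0)))
      by (rewrite Rmult_0_r, exp_0; reflexivity).
    apply (is_lim_seq_continuous exp (fun n => s * s * / (u + INR n))).
    + apply derivable_continuous_pt, derivable_pt_exp.
    + exact (is_lim_seq_scal_l _ (s * s) 0 Hinf).
Qed.

(** Iterated contiguity pushes [c] to [c + n], where the series tends to 1, and leaves a quotient of
    four Pochhammer symbols. Measured from the common base [u = c - A - B] their arguments are
    shifted by [A + B], 0, [B] and [A], so the powers of [u + n] in the Gamma asymptotics cancel. *)
Lemma gauss_summation (A B c Gc Gcab Gca Gcb : R) :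
  0 < A -> 0 < B ->
  is_Gamma c Gc -> is_Gamma (c - A - B) Gcab ->
  is_Gamma (c - A) Gca -> is_Gamma (c - B) Gcb ->
  Series (fun k => newton A k * poch_ratio B c k) = Gc * Gcab / (Gca * Gcb).
Proof.
  intros HA HB H1 H2 H3 H4.
  set (u := c - A - B) in *.
  assert (Hu := is_Gamma_arg_pos _ _ H2).
  replace c with (u + (A + B)) in H1 by (unfold u; ring).
  replace (c - A) with (u + B) in H3 by (unfold u; ring).
  replace (c - B) with (u + A) in H4 by (unfold u; ring).
  assert (L1 := Gamma_ratio_lim u (A + B) Gcab Gc ltac:(lra) H2 H1).
  assert (L3 := Gamma_ratio_lim u B Gcab Gca ltac:(lra) H2 H3).
  assert (L4 := Gamma_ratio_lim u A Gcab Gcb ltac:(lra) H2 H4).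
  assert (P1 := is_Gamma_pos _ _ H1). assert (P2 := is_Gamma_pos _ _ H2).
  assert (P3 := is_Gamma_pos _ _ H3). assert (P4 := is_Gamma_pos _ _ H4).
  set (S0 := Series (fun k => newton A k * poch_ratio B c k)).
  set (K := Gc * Gcab / (Gca * Gcb)).
  assert (Hc : A + B < c) by (unfold u in Hu; lra).
  assert (LS := gauss_limit A B c HA HB Hc).
  assert (L : is_lim_seq (fun n => K * Series
                (fun k => newton A k * poch_ratio B (c + INR n) k)) S0).
  { assert (L34 := is_lim_seq_mult' _ _ _ _ L3 L4).
    assert (L' := is_lim_seq_mult' _ _ _ _ 
      (is_lim_seq_const S0)
      (is_lim_seq_div' _ _ _ _ L1 L34 ltac:(lra))).
    replace (S0 * (1 / (1 * 1))) with S0 in L' by field.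
    revert L'. apply is_lim_seq_ext. intros n.
    assert (Hn : 0 <= INR n) by apply pos_INR.
    assert (Hi := gauss_iter A B c n HA HB Hc). fold S0 in Hi. fold u in Hi.
    replace (u + (A + B)) with c by (unfold u; ring).
    replace (u + A) with (c - B) by (unfold u; ring).
    replace (u + B) with (c - A) by (unfold u; ring).
    assert (Q1 := rpoch_pos c n ltac:(lra)).
    assert (Q2 := rpoch_pos u n ltac:(lra)).
    assert (Q3 := rpoch_pos (c - A) n ltac:(lra)).
    assert (Q4 := rpoch_pos (c - B) n ltac:(lra)).
    set (T := Series (fun k => newton A k * poch_ratio B (c + INR n) k)) in *.
    rewrite Rpower_plus.
    assert (E1 : 0 < Rpower (u + INR n) A) by apply exp_pos.
    assert (E2 : 0 < Rpower (u + INR n) B) by apply exp_pos.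
    transitivity ((rpoch c n * rpoch u n * S0) * (Gc * Gcab)
                  / (rpoch (c - A) n * rpoch (c - B) n * (Gca * Gcb))).
    - field. repeat split; lra.
    - rewrite Hi. unfold K. field. repeat split; lra. }
  assert (L2 := is_lim_seq_scal_l _ K 1 LS).
  apply is_lim_seq_unique in L. apply is_lim_seq_unique in L2.
  rewrite L in L2. injection L2. intros ->. unfold K. ring.
Qed.

(** * Abel means at -1 *)

(* Taylor coefficients of [((1 + x t) (1 - t))^(-al)]. *)
Definition quad_newton (al x : R) (N : nat) : R :=
  sum_f_R0 (fun k => newton al k * (- x) ^ k * newton al (N - k)) N.

(** The function [g = ((1 + x t) (1 - t))^(-al)] satisfies [(1 - (1 - x) t - x t^2) g' = al (1 - x +
    2 x t) g]; this is the coefficient of [t^(n+1)] on both sides. *)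
Lemma quad_newton_rec (al x : R) (n : nat) :
  INR (S (S n)) * quad_newton al x (S (S n))
  = (1 - x) * (INR (S n) + al) * quad_newton al x (S n)
    + x * (INR n + 2 * al) * quad_newton al x n.
Proof.
  set (p := fun k => newton al k * (- x) ^ k).
  (* [U + V] is [t d/dt] of the product, split by the Leibniz rule. *)
  set (U := fun N => sum_f_R0 (fun k => INR k * p k * newton al (N - k)) N).
  set (V := fun N => sum_f_R0 (fun k => p k * (INR (N - k) * newton al (N - k))) N).
  assert (HUV : forall N, INR N * quad_newton al x N = U N + V N).
  { intros N. unfold U, V, quad_newton. rewrite <- sum_plus, scal_sum.
    apply sum_eq. intros k Hk. fold (p k).
    rewrite (minus_INR _ _ Hk). ring. }
  assert (HU : forall N, U (S N) = - x * (U N + al * quad_newton al x N)).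
  { intros N. unfold U at 1. rewrite decomp_sum by lia.
    change (Init.Nat.pred (S N)) with N. change (INR 0) with 0.
    unfold U, quad_newton. rewrite (scal_sum _ N al), <- sum_plus, scal_sum.
    replace (0 * p 0%nat * newton al (S N - 0)) with 0 by ring.
    rewrite Rplus_0_l. apply sum_eq. intros k Hk.
    change (S N - S k)%nat with (N - k)%nat. unfold p. rewrite <- tech_pow_Rmult.
    replace (INR (S k) * (newton al (S k) * (- x * (- x) ^ k)))
      with (INR (S k) * newton al (S k) * (- x * (- x) ^ k)) by ring.
    rewrite newton_S. ring. }
  assert (HV : forall N, V (S N) = V N + al * quad_newton al x N).
  { intros N. unfold V at 1. rewrite tech5.
    replace (S N - S N)%nat with 0%nat by lia. change (INR 0) with 0.
    unfold V, quad_newton. rewrite (scal_sum _ N al), <- sum_plus.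
    replace (p (S N) * (0 * newton al 0)) with 0 by ring.
    rewrite Rplus_0_r. apply sum_eq. intros k Hk.
    replace (S N - k)%nat with (S (N - k)) by lia. rewrite newton_S.
    fold (p k). ring. }
  rewrite HUV. rewrite (HU (S n)), (HV (S n)).
  assert (H1 := HUV (S n)). assert (H0 := HUV n).
  replace ((1 - x) * (INR (S n) + al) * quad_newton al x (S n))
    with ((1 - x) * (INR (S n) * quad_newton al x (S n))
          + (1 - x) * al * quad_newton al x (S n)) by ring.
  replace (x * (INR n + 2 * al) * quad_newton al x n)
    with (x * (INR n * quad_newton al x n)
          + 2 * x * al * quad_newton al x n) by ring.
  rewrite H1, H0, HU, HV. ring.
Qed.

Lemma quad_newton_crude_bound (al x : R) (N : nat) :
  0 <= x <= 1 ->
  Rabs (quad_newton al x N)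
  <= sum_f_R0 (fun k => Rabs (newton al k) * Rabs (newton al (N - k))) N.
Proof.
  intros Hx. unfold quad_newton.
  apply Rle_trans with (1 := Rsum_abs _ _). apply sum_Rle. intros k Hk.
  rewrite !Rabs_mult, <- RPow_abs, Rabs_Ropp, (Rabs_pos_eq x) by lra.
  assert (x ^ k <= 1) by (rewrite <- (pow1 k); apply pow_incr; lra).
  assert (0 <= x ^ k) by (apply pow_le; lra).
  assert (H1 := Rabs_pos (newton al k)).
  assert (H2 := Rabs_pos (newton al (N - k))).
  apply Rmult_le_compat_r; [auto|]. nra.
Qed.

Lemma sum_f_R0_ge_term (f : nat -> R) (n N : nat) :
  (forall k, 0 <= f k) -> (n <= N)%nat -> f n <= sum_f_R0 f N.
Proof.
  intros Hf Hn. induction Hn as [|N Hn IH].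
  - destruct n as [|n]; simpl; [lra|].
    assert (0 <= sum_f_R0 f n) by (apply cond_pos_sum; auto). lra.
  - simpl. specialize (Hf (S N)). lra.
Qed.

(** The right side of the recurrence weighs an [(n + 1 + al)]-term by [1 - x] and an
    [(n + 2 al)]-term by [x]. For large [n] the sequence [newton al'] passes each of the two bounds
    separately, hence their convex combination, which makes the constant independent of [x]. The
    crude bound serves only for the finitely many initial indices. *)
Lemma quad_newton_bound (al al' : R) :
  al < al' -> 0 < al' ->
  exists C, 0 <= C /\ forall N x, 0 <= x <= 1 ->
    Rabs (quad_newton al x N) <= C * newton al' N.
Proof.
  intros Hal Hal'.
  (* The first condition makes both coefficients of the recurrence nonnegative; the second lets the
     gap [al' - al] absorb the lower-order terms in [Hkey]. *)
  assert (exists N1, 2 * Rabs al <= INR N1 /\ Rabs al <= (al' - al) * INR N1)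
    as [N1 [HN1 HN2]].
  { destruct (INR_unbounded (Rmax (2 * Rabs al) (Rabs al / (al' - al)))) as [N1 HN1].
    exists N1.
    assert (H1 := Rmax_l (2 * Rabs al) (Rabs al / (al' - al))).
    assert (H2 := Rmax_r (2 * Rabs al) (Rabs al / (al' - al))).
    split; [lra|]. rewrite Rmult_comm. apply -> Rle_div_l; lra. }
  set (s := fun N => sum_f_R0
    (fun k => Rabs (newton al k) * Rabs (newton al (N - k))) N / newton al' N).
  assert (Hw : forall N, 0 < newton al' N) by (intros; apply newton_pos; auto).
  assert (Hs : forall N, 0 <= s N).
  { intros N. unfold s. apply Rdiv_le_0_compat; [|apply Hw].
    apply cond_pos_sum. intros k. apply Rmult_le_pos; apply Rabs_pos. }
  exists (sum_f_R0 s (S N1)). set (C := sum_f_R0 s (S N1)).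
  assert (HC : 0 <= C) by (apply cond_pos_sum; auto).
  split; [exact HC|]. intros N x Hx.
  induction N as [N IH] using (well_founded_induction Wf_nat.lt_wf).
  destruct (Nat.le_gt_cases N (S N1)) as [HN | HN].
  - apply Rle_trans with (1 := quad_newton_crude_bound al x N Hx).
    apply Rle_div_l; [apply Hw|]. exact (sum_f_R0_ge_term s N (S N1) Hs HN).
  - destruct N as [|[|n]]; [lia|lia|].
    assert (Hn : (N1 <= n)%nat) by lia. apply le_INR in Hn.
    assert (I1 := IH (S n) ltac:(lia)). assert (I0 := IH n ltac:(lia)). clear IH.
    assert (Hrec := quad_newton_rec al x n).
    assert (Hws := newton_S al' n). assert (Hws1 := newton_S al' (S n)).
    assert (Ha1 : - Rabs al <= al <= Rabs al)
      by (split; [assert (H := Rle_abs (- al)); rewrite Rabs_Ropp in H; lra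
                 |apply Rle_abs]).
    assert (W0 := Hw n). assert (W1 := Hw (S n)). assert (W2 := Hw (S (S n))).
    rewrite S_INR in Hws.
    assert (HSS : 0 < INR (S (S n))) by (apply lt_0_INR; lia).
    apply Rmult_le_reg_l with (1 := HSS).
    rewrite <- (Rabs_pos_eq (INR (S (S n)))) at 1 by lra.
    rewrite <- Rabs_mult, Hrec.
    replace (INR (S (S n)) * (C * newton al' (S (S n))))
      with (C * (INR (S (S n)) * newton al' (S (S n)))) by ring.
    rewrite Hws1, S_INR. clear Hrec Hws1 HSS.
    assert (Hm : 0 <= INR n) by apply pos_INR.
    assert (Habs : 0 <= Rabs al) by apply Rabs_pos.
    set (m := INR n) in *. set (w0 := newton al' n) in *.
    set (w1 := newton al' (S n)) in *.
    set (q0 := quad_newton al x n) in *. set (q1 := quad_newton al x (S n)) in *.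
    assert (K1 : 0 <= (1 - x) * (m + 1 + al)) by (apply Rmult_le_pos; lra).
    assert (K0 : 0 <= x * (m + 2 * al)) by (apply Rmult_le_pos; lra).
    apply Rle_trans with (1 := Rabs_triang _ _).
    rewrite (Rabs_mult _ q1), (Rabs_mult _ q0).
    rewrite (Rabs_pos_eq _ K1), (Rabs_pos_eq _ K0).
    apply Rle_trans with
      ((1 - x) * (m + 1 + al) * (C * w1) + x * (m + 2 * al) * (C * w0)).
    { apply Rplus_le_compat; apply Rmult_le_compat_l; auto. }
    assert (Hkey : (m + 2 * al) * w0 <= (m + 1 + al') * w1).
    { apply Rmult_le_reg_l with (m + 1); [lra|].
      replace ((m + 1) * ((m + 1 + al') * w1))
        with ((m + 1 + al') * ((m + 1) * w1)) by ring.
      rewrite Hws.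
      replace ((m + 1) * ((m + 2 * al) * w0))
        with ((m + 1) * (m + 2 * al) * w0) by ring.
      rewrite <- Rmult_assoc. apply Rmult_le_compat_r; [lra|].
      assert ((al' - al) * INR N1 <= (al' - al) * m)
        by (apply Rmult_le_compat_l; lra).
      nra. }
    replace ((1 - x) * (m + 1 + al) * (C * w1) + x * (m + 2 * al) * (C * w0))
      with (C * ((1 - x) * ((m + 1 + al) * w1) + x * ((m + 2 * al) * w0))) by ring.
    apply Rmult_le_compat_l; [exact HC|].
    assert ((m + 1 + al) * w1 <= (m + 1 + al') * w1)
      by (apply Rmult_le_compat_r; lra).
    replace ((al' + (m + 1)) * w1)
      with ((1 - x) * ((m + 1 + al') * w1) + x * ((m + 1 + al') * w1)) by ring.
    apply Rplus_le_compat; apply Rmult_le_compat_l; lra.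
Qed.

Lemma quad_newton_1 (al : R) (m : nat) :
  quad_newton al 1 (2 * m) = newton al m /\ quad_newton al 1 (2 * m + 1) = 0.
Proof.
  induction m as [|m [IH0 IH1]].
  - unfold quad_newton. simpl. split; [ring|]. field.
  - replace (2 * S m + 1)%nat with (S (S (2 * m + 1))) by lia.
    replace (2 * S m)%nat with (S (S (2 * m))) by lia.
    assert (R0 := quad_newton_rec al 1 (2 * m)).
    assert (R1 := quad_newton_rec al 1 (2 * m + 1)).
    rewrite IH0 in R0. rewrite IH1 in R1.
    assert (H0 : 0 < INR (S (S (2 * m)))) by (apply lt_0_INR; lia).
    assert (H1 : 0 < INR (S (S (2 * m + 1)))) by (apply lt_0_INR; lia).
    split.
    + apply Rmult_eq_reg_l with (INR (S (S (2 * m)))); [|lra].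
      rewrite R0.
      replace (S (S (2 * m))) with (2 * S m)%nat by lia.
      rewrite !mult_INR. change (INR 2) with 2.
      rewrite (Rmult_assoc 2 (INR (S m))), newton_S. ring.
    + apply Rmult_eq_reg_l with (INR (S (S (2 * m + 1)))); [|lra].
      rewrite R1. ring.
Qed.

(** Here [al] may be negative or 0, where coefficients change sign or vanish; the majorant with
    parameter [Rabs al + 1] is positive and passes the ratio test. *)
Lemma newton_pow_summable (al x : R) :
  0 < x < 1 -> ex_series (fun n => Rabs (newton al n) * x ^ n).
Proof.
  intros Hx. set (be := Rabs al + 1).
  assert (Hbe : 0 < be) by (assert (H := Rabs_pos al); unfold be; lra).
  assert (Hle : forall n, Rabs (newton al n) <= newton be n).
  { induction n as [|n IH]; [simpl; rewrite Rabs_R1; lra|].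
    assert (HS : 0 < INR (S n)) by (apply lt_0_INR; lia).
    apply Rmult_le_reg_l with (1 := HS).
    rewrite <- (Rabs_pos_eq (INR (S n))) at 1 by lra.
    rewrite <- Rabs_mult, !newton_S, Rabs_mult.
    apply Rmult_le_compat; try apply Rabs_pos; auto.
    apply Rle_trans with (1 := Rabs_triang _ _).
    rewrite (Rabs_pos_eq (INR n)) by apply pos_INR. unfold be. lra. }
  assert (Hpos : forall n, 0 < newton be n * x ^ n).
  { intros n. apply Rmult_lt_0_compat; [apply newton_pos; auto|].
    apply pow_lt; lra. }
  assert (Hex : ex_series (fun n => Rabs (newton be n * x ^ n))).
  { apply ex_series_DAlembert with x; [lra| |].
    - intros n. specialize (Hpos n). lra.
    - apply is_lim_seq_ext with (fun n => x * (1 + (be - 1) * / (INR n + 1))).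
      + intros n. assert (0 <= INR n) by apply pos_INR.
        assert (Hg := newton_pos be n Hbe).
        assert (Hxn : 0 < x ^ n) by (apply pow_lt; lra).
        rewrite Rabs_pos_eq.
        * cbn [newton]. rewrite <- tech_pow_Rmult, S_INR. field. lra.
        * apply Rlt_le, Rdiv_lt_0_compat; apply Hpos.
      + replace (Finite x) with (Finite (x * (1 + (be - 1) * 0))) by (f_equal; ring).
        apply (is_lim_seq_scal_l _ x (1 + (be - 1) * 0)).
        apply is_lim_seq_plus'; [apply is_lim_seq_const|].
        apply (is_lim_seq_scal_l _ (be - 1) 0).
        apply (is_lim_seq_inv _ p_infty); [|discriminate].
        apply is_lim_seq_ext with (fun n => INR (S n)).
        * intros; apply S_INR.
        * apply -> is_lim_seq_incr_1. apply is_lim_seq_INR. }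
  apply (ex_series_le (V := R_CompleteNormedModule) _ (fun n => Rabs (newton be n * x ^ n))); [|exact Hex].
  intros n. unfold norm; simpl. unfold abs; simpl.
  rewrite (Rabs_pos_eq (newton be n * x ^ n)) by (apply Rlt_le, Hpos).
  assert (0 < x ^ n) by (apply pow_lt; lra).
  rewrite Rabs_mult, Rabs_Rabsolu, (Rabs_pos_eq (x ^ n)) by lra.
  apply Rmult_le_compat_r; [lra|apply Hle].
Qed.

Lemma sum_triangle (p g mu : nat -> R) (L : nat) :
  sum_f_R0 (fun n => p n * sum_f_R0 (fun k => g k * mu (n + k)%nat) (L - n)) L
  = sum_f_R0 (fun N => sum_f_R0 (fun k => p k * g (N - k)%nat) N * mu N) L.
Proof.
  induction L as [|L IH]; [simpl; ring|].
  assert (Hs : sum_f_R0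
      (fun n => p n * sum_f_R0 (fun k => g k * mu (n + k)%nat) (S L - n)) L
    = sum_f_R0 (fun n => p n * sum_f_R0 (fun k => g k * mu (n + k)%nat) (L - n)) L
      + mu (S L) * sum_f_R0 (fun k => p k * g (S L - k)%nat) L).
  { rewrite scal_sum, <- sum_plus. apply sum_eq. intros n Hn.
    replace (S L - n)%nat with (S (L - n)) by lia. rewrite tech5.
    replace (n + S (L - n))%nat with (S L) by lia. ring. }
  rewrite (tech5 (fun N => sum_f_R0 (fun k => p k * g (N - k)%nat) N * mu N) L).
  rewrite <- IH, (tech5 _ L), Hs.
  rewrite (tech5 (fun k => p k * g (S L - k)%nat) L).
  replace (S L - S L)%nat with 0%nat by lia. simpl sum_f_R0.
  rewrite Nat.add_0_r. ring.
Qed.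

Lemma Series_finite (a : nat -> R) (L : nat) :
  (forall n, (L < n)%nat -> a n = 0) -> Series a = sum_f_R0 a L.
Proof.
  intros Ha. apply is_series_unique.
  apply (is_lim_seq_ext_loc (fun _ => sum_f_R0 a L) (sum_n a) (sum_f_R0 a L)).
  - exists L. intros n Hn. rewrite sum_n_Reals. induction Hn as [|n Hn IH]; auto.
    simpl. rewrite Ha by lia. rewrite <- IH. ring.
  - apply is_lim_seq_const.
Qed.

Lemma double_series_diagonal (p g mu nu : nat -> R) :
  (forall N, Rabs (mu N) <= nu N) ->
  (forall n k, nu (n + k)%nat <= nu k) ->
  ex_series (fun n => Rabs (p n)) ->
  ex_series (fun k => Rabs (g k) * nu k) ->
  is_series (fun N => sum_f_R0 (fun k => p k * g (N - k)%nat) N * mu N)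
    (Series (fun n => p n * Series (fun k => g k * mu (n + k)%nat))).
Proof.
  intros Hmu Hnu Hp Hg.
  set (M := Series (fun k => Rabs (g k) * nu k)).
  assert (Hnu0 : forall N, 0 <= nu N).
  { intros N. apply Rle_trans with (2 := Hmu N), Rabs_pos. }
  assert (Hb : forall n k, Rabs (g k * mu (n + k)%nat) <= Rabs (g k) * nu k).
  { intros n k. rewrite Rabs_mult. apply Rmult_le_compat_l; [apply Rabs_pos|].
    apply Rle_trans with (1 := Hmu _). apply Hnu. }
  assert (Hpart : forall n K,
    Rabs (sum_f_R0 (fun k => g k * mu (n + k)%nat) K) <= M).
  { intros n K. apply Rle_trans with (1 := Rsum_abs _ _).
    apply Rle_trans with (sum_f_R0 (fun k => Rabs (g k) * nu k) K).
    - apply sum_Rle. intros k _. apply Hb.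
    - unfold M. rewrite (Series_incr_n _ (S K)); [|lia|exact Hg].
      change (Init.Nat.pred (S K)) with K.
      assert (0 <= Series (fun k => Rabs (g (S K + k)%nat) * nu (S K + k)%nat)).
      { apply Series_ge_0.
        - intros k. apply Rmult_le_pos; [apply Rabs_pos | apply Hnu0].
        - apply (ex_series_incr_n (fun k => Rabs (g k) * nu k) (S K)). exact Hg. }
      lra. }
  assert (HM : 0 <= M).
  { apply Rle_trans with (2 := Hpart O O), Rabs_pos. }
  set (a := fun L n => if (n <=? L)%nat
    then p n * sum_f_R0 (fun k => g k * mu (n + k)%nat) (L - n) else 0).
  assert (Ha : forall L n, Rabs (a L n) <= Rabs (p n) * M).
  { intros L n. unfold a. destruct (n <=? L)%nat.
    - rewrite Rabs_mult. apply Rmult_le_compat_l; [apply Rabs_pos | apply Hpart].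
    - rewrite Rabs_R0. apply Rmult_le_pos; [apply Rabs_pos | exact HM]. }
  assert (Hlim : forall n, is_lim_seq (fun j => a j n)
    (p n * Series (fun k => g k * mu (n + k)%nat))).
  { intros n. apply is_lim_seq_incr_n with n.
    apply is_lim_seq_ext with
      (fun j => p n * sum_n (fun k => g k * mu (n + k)%nat) j).
    - intros j. unfold a. replace (n <=? j + n)%nat with true
        by (symmetry; apply Nat.leb_le; lia).
      rewrite sum_n_Reals. replace (j + n - n)%nat with j by lia. reflexivity.
    - apply (is_lim_seq_scal_l _ (p n)
        (Series (fun k => g k * mu (n + k)%nat))).
      apply (Series_correct (fun k => g k * mu (n + k)%nat)).
      apply (ex_series_le (V := R_CompleteNormedModule) _ (fun k => Rabs (g k) * nu k)); [|exact Hg].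
      intros k. apply Hb. }
  refine (is_lim_seq_ext _ _ _ _ (tannery a _ _ Ha (ex_series_scal_r M _ Hp) Hlim)). intros L. rewrite sum_n_Reals.
  rewrite (Series_finite _ L).
  - rewrite <- sum_triangle. apply sum_eq. intros n Hn. unfold a.
    replace (n <=? L)%nat with true by (symmetry; apply Nat.leb_le; lia).
    reflexivity.
  - intros n Hn. unfold a.
    replace (n <=? L)%nat with false; auto. symmetry. apply Nat.leb_gt. exact Hn.
Qed.

Lemma sum_even_terms (a : nat -> R) (m : nat) :
  (forall k, a (2 * k + 1)%nat = 0) ->
  sum_f_R0 a (2 * m) = sum_f_R0 (fun k => a (2 * k)%nat) m.
Proof.
  intros Ha. induction m as [|m IH]; [reflexivity|].
  replace (2 * S m)%nat with (S (S (2 * m))) by lia.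
  rewrite !tech5, IH. replace (S (2 * m)) with (2 * m + 1)%nat by lia.
  rewrite Ha. replace (S (2 * m + 1)) with (2 * S m)%nat by lia. ring.
Qed.

Lemma Series_even_terms (a : nat -> R) :
  ex_series a -> (forall k, a (2 * k + 1)%nat = 0) ->
  Series a = Series (fun k => a (2 * k)%nat).
Proof.
  intros Hex Ha. symmetry. apply is_series_unique.
  apply (is_lim_seq_ext (fun m => sum_n a (2 * m)) _ (Series a)).
  - intros m. rewrite !sum_n_Reals. apply sum_even_terms. exact Ha.
  - apply (is_lim_seq_subseq (sum_n a) (Series a) (fun m => (2 * m)%nat)).
    + apply eventually_subseq. intros n. lia.
    + exact (Series_correct _ Hex).
Qed.

(* Reading [mu N] as the N-th moment of a measure on [0, 1], the left side is the Abel
   mean of the integral of [(1 + t)^(-al) (1 - t)^(-al)] and the right side is the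
   integral of [(1 - t^2)^(-al)]. *)
Lemma abel_quadratic (al al' : R) (mu nu x : nat -> R) :
  al < al' -> 0 < al' ->
  (forall N, Rabs (mu N) <= nu N) ->
  (forall n k, nu (n + k)%nat <= nu k) ->
  ex_series (fun k => Rabs (newton al k) * nu k) ->
  ex_series (fun k => newton al' k * nu k) ->
  (forall j, 0 < x j < 1) -> is_lim_seq x 1 ->
  is_lim_seq (fun j => Series (fun n => newton al n * (- x j) ^ n
                 * Series (fun k => newton al k * mu (n + k)%nat)))
    (Series (fun m => newton al m * mu (2 * m)%nat)).
Proof.
  intros Hal Hal' Hmu Hnu Hex Hex' Hx Hx1.
  destruct (quad_newton_bound al al' Hal Hal') as [C [HC HCb]].
  assert (Hb : forall y N, 0 <= y <= 1 ->
    Rabs (quad_newton al y N * mu N) <= C * (newton al' N * nu N)).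
  { intros y N Hy. rewrite Rabs_mult, <- Rmult_assoc.
    apply Rmult_le_compat; try apply Rabs_pos; auto. }
  assert (HexC : ex_series (fun N => C * (newton al' N * nu N)))
    by exact (ex_series_scal C _ Hex').
  (* For fixed [x j < 1] the rearrangement is absolutely convergent. Afterwards [x j] occurs only in
     [quad_newton], a polynomial in [x j], and the limit passes under one sum. *)
  apply is_lim_seq_ext with (fun j => Series (fun N => quad_newton al (x j) N * mu N)).
  { intros j. apply is_series_unique.
    apply (double_series_diagonal (fun n => newton al n * (- x j) ^ n) (newton al)
             mu nu Hmu Hnu); [|exact Hex].
    apply ex_series_ext with (fun n => Rabs (newton al n) * x j ^ n).
    - intros n. rewrite Rabs_mult, <- RPow_abs, Rabs_Ropp.
      rewrite (Rabs_pos_eq (x j)); [reflexivity|]. specialize (Hx j). lra.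
    - apply newton_pow_summable, Hx. }
  replace (Series (fun m => newton al m * mu (2 * m)%nat))
    with (Series (fun N => quad_newton al 1 N * mu N)).
  - apply (tannery _ _ (fun N => C * (newton al' N * nu N))); [|exact HexC|].
    + intros j N. apply Hb. specialize (Hx j). lra.
    + intros N. apply (is_lim_seq_scal_r _ (mu N) (quad_newton al 1 N)).
      unfold quad_newton.
      apply (is_lim_seq_sum_f_R0
        (fun j k => newton al k * (- x j) ^ k * newton al (N - k))).
      intros k.
      apply (is_lim_seq_continuous
        (fun y => newton al k * (- y) ^ k * newton al (N - k)) x 1); [|exact Hx1].
      apply continuity_pt_filterlim.
      apply (ex_derive_continuous (fun y => newton al k * (- y) ^ k * newton al (N - k))).
      auto_derive. auto.
  - rewrite Series_even_terms.
    + apply Series_ext. intros m. f_equal. apply quad_newton_1.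
    + apply (ex_series_le (V := R_CompleteNormedModule) _ (fun N => C * (newton al' N * nu N))); [|exact HexC].
      intros N. apply Hb. lra.
    + intros k. rewrite (proj2 (quad_newton_1 al k)). ring.
Qed.

(** Iterates [newton_shift_sum], leaving the total mass as a factor. Positivity is asked of
    [gam - al], not of [gam], because [gam = c - 2] may be nonpositive in the second evaluation;
    [mu] may then change sign, hence the majorant [nu]. *)
Lemma newton_moments (al gam bet : R) (mu nu : nat -> R) :
  (forall N, (gam + INR N) * mu (S N) = (bet + INR N) * mu N) ->
  (forall N, Rabs (mu N) <= nu N) ->
  (forall n k, nu (n + k)%nat <= nu k) ->
  ex_series (fun k => Rabs (newton al k) * nu k) ->
  is_lim_seq (fun k => INR k * (Rabs (newton al k) * nu k)) 0 ->
  0 < gam - al ->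
  forall n, Series (fun k => newton al k * mu (n + k)%nat)
            = poch_ratio bet (gam - al) n * Series (fun k => newton al k * mu k).
Proof.
  intros Hrec Hmu Hnu Hex Hlim Hg n.
  assert (Hb : forall m k, Rabs (newton al k * mu (m + k)%nat)
                           <= Rabs (newton al k) * nu k).
  { intros m k. rewrite Rabs_mult. apply Rmult_le_compat_l; [apply Rabs_pos|].
    apply Rle_trans with (1 := Hmu _), Hnu. }
  assert (Hexn : forall m, ex_series (fun k => newton al k * mu (m + k)%nat)).
  { intros m. apply (ex_series_le (V := R_CompleteNormedModule) _
      (fun k => Rabs (newton al k) * nu k)); [apply Hb | exact Hex]. }
  assert (Hl : forall m, is_lim_seq (fun k => INR k * (newton al k * mu (m + k)%nat)) 0).
  { intros m. apply is_lim_seq_abs_0.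
    apply is_lim_seq_le_le with (fun _ => 0)
      (fun k => INR k * (Rabs (newton al k) * nu k)); [|apply is_lim_seq_const|exact Hlim].
    intros k. split; [apply Rabs_pos|].
    rewrite (Rabs_mult (INR k)), (Rabs_pos_eq (INR k)) by apply pos_INR.
    apply Rmult_le_compat_l; [apply pos_INR | apply Hb]. }
  induction n as [|n IH]; [simpl; ring|].
  assert (H := newton_shift_sum al gam bet mu n Hrec (Hexn n) (Hexn (S n)) (Hl n)).
  assert (Hn : 0 <= INR n) by apply pos_INR.
  cbn [poch_ratio].
  apply Rmult_eq_reg_l with (gam - al + INR n); [|lra].
  rewrite H, IH. field. lra.
Qed.

(** * Evaluation of the two Clausen sums *)

(** The coefficient form of the derivative of [(1 - t)^(1 - A)], which is [(A - 1) (1 - t)^(-A)]; it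
    is the source of the division by [m + 1] in the second sum. *)
Lemma newton_pred (A : R) (m : nat) :
  INR (S m) * newton (A - 1) (S m) = (A - 1) * newton A m.
Proof.
  induction m as [|m IH].
  - cbn [newton]. change (INR 1) with 1. change (INR 0) with 0. field.
  - rewrite newton_S.
    assert (H := newton_S A m).
    assert (HS : 0 < INR (S m)) by (apply lt_0_INR; lia).
    apply Rmult_eq_reg_l with (INR (S m)); [|lra].
    transitivity ((A - 1 + INR (S m)) * (INR (S m) * newton (A - 1) (S m))); [ring|].
    rewrite IH.
    transitivity ((A - 1) * (INR (S m) * newton A (S m))); [|ring].
    rewrite H, S_INR. ring.
Qed.

Lemma newton_diff (A : R) (m : nat) :
  newton (A - 1) (S m) = newton A (S m) - newton A m.
Proof.
  assert (H := newton_S A m). assert (H' := newton_pred A m).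
  assert (HS : 0 < INR (S m)) by (apply lt_0_INR; lia).
  apply Rmult_eq_reg_l with (INR (S m)); [|lra].
  rewrite Rmult_minus_distr_l, H, H', S_INR. ring.
Qed.

(** By [newton_diff] it suffices that consecutive coefficients are comparable, and
    [(k + 1) / (A + k) <= 1 + 1 / A]. Summability with parameter [A] thereby carries over to
    [A - 1], even when [A < 1]. *)
Lemma newton_pred_bound (A : R) (k : nat) :
  0 < A -> Rabs (newton (A - 1) k) <= (2 + / A) * newton A k.
Proof.
  intros HA. assert (HiA := Rinv_0_lt_compat A HA).
  destruct k as [|k].
  - simpl. rewrite Rabs_R1. lra.
  - rewrite newton_diff.
    assert (H0 := newton_pos A k HA). assert (H1 := newton_pos A (S k) HA).
    assert (Hs := newton_S A k). assert (Hk : 0 <= INR k) by apply pos_INR.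
    rewrite S_INR in Hs.
    assert (newton A k <= (1 + / A) * newton A (S k)).
    { apply Rmult_le_reg_l with (INR k + 1); [lra|].
      replace ((INR k + 1) * ((1 + / A) * newton A (S k)))
        with ((1 + / A) * ((INR k + 1) * newton A (S k))) by ring.
      rewrite Hs, <- Rmult_assoc. apply Rmult_le_compat_r; [lra|].
      assert (/ A * A = 1) by (field; lra).
      assert (0 <= / A * INR k) by (apply Rmult_le_pos; lra). nra. }
    apply Rabs_le. lra.
Qed.

Section HypergeometricSums.

Variables A B c : R.
Hypothesis HA : 0 < A.
Hypothesis HB : 0 < B.
Hypothesis HAB : A + B < c.

Let K := Series (fun k => newton A k * poch_ratio B c k).

Lemma Rabs_newton_summable :
  ex_series (fun k => Rabs (newton A k) * poch_ratio B c k) /\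
  is_lim_seq (fun k => INR k * (Rabs (newton A k) * poch_ratio B c k)) 0.
Proof.
  assert (Hp : forall k, Rabs (newton A k) = newton A k)
    by (intros k; apply Rabs_pos_eq, Rlt_le, newton_pos, HA).
  destruct (newton_poch_summable A B c HA HB HAB) as [H1 H2]. split.
  - revert H1. apply ex_series_ext. intros k. rewrite Hp. reflexivity.
  - revert H2. apply is_lim_seq_ext. intros k. rewrite Hp. reflexivity.
Qed.

Lemma newton_poch_moments (n : nat) :
  Series (fun k => newton A k * poch_ratio B c (n + k)) = poch_ratio B (c - A) n * K.
Proof.
  destruct Rabs_newton_summable as [H1 H2].
  apply (newton_moments A c B (poch_ratio B c) (poch_ratio B c)); auto; [| | |lra].
  - intros N. apply poch_ratio_S. assert (0 <= INR N) by apply pos_INR. lra.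
  - intros N. rewrite Rabs_pos_eq; [lra|]. apply Rlt_le, poch_ratio_pos; lra.
  - intros n' k. apply poch_ratio_decr; lra.
Qed.

Lemma clausen_sum_abel (x : nat -> R) (h : R) :
  (forall j, 0 < x j < 1) -> is_lim_seq x 1 ->
  is_lim_seq (fun j => Series (fun n =>
      newton A n * poch_ratio B (c - A) n * (- x j) ^ n)) h ->
  Series (fun m => newton A m * poch_ratio B c (2 * m)) = K * h.
Proof.
  intros Hx Hx1 Hh.
  (* Half of the gap [c - A - B] is spent on enlarging [A]; the other half keeps the majorant
     summable. *)
  assert (H := abel_quadratic A (A + (c - A - B) / 2)
    (poch_ratio B c) (poch_ratio B c) x ltac:(lra) ltac:(lra)).
  assert (H' : is_lim_seq (fun j => Series (fun n => newton A n * (- x j) ^ n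
      * Series (fun k => newton A k * poch_ratio B c (n + k))))
    (Series (fun m => newton A m * poch_ratio B c (2 * m)))).
  { apply H; auto.
    - intros N. rewrite Rabs_pos_eq; [lra|]. apply Rlt_le, poch_ratio_pos; lra.
    - intros n k. apply poch_ratio_decr; lra.
    - apply Rabs_newton_summable.
    - apply newton_poch_summable; lra. }
  assert (L : is_lim_seq (fun j => Series (fun n => newton A n * (- x j) ^ n
      * Series (fun k => newton A k * poch_ratio B c (n + k)))) (K * h)).
  { apply is_lim_seq_ext with (fun j => K * Series (fun n =>
      newton A n * poch_ratio B (c - A) n * (- x j) ^ n)).
    - intros j. rewrite <- Series_scal_l. apply Series_ext. intros n.
      rewrite newton_poch_moments. ring.
    - exact (is_lim_seq_scal_l _ K h Hh). }
  apply is_lim_seq_unique in L. apply is_lim_seq_unique in H'.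
  rewrite L in H'. injection H'. auto.
Qed.

(* [(c - 2) (c - 1) (B - 2)_N / (c - 2)_N], free of the pole at [c = 2]. *)
Definition poch_ratio_pred2 (N : nat) : R :=
  match N with
  | O => (c - 1) * (c - 2)
  | S O => (c - 1) * (B - 2)
  | S (S n) => (B - 2) * (B - 1) * poch_ratio B c n
  end.

(** Lowering the index of [poch_ratio B c] by one costs at most the factor [c / B], since
    [(c + n) / (B + n)] decreases in [n]; two steps cost its square. *)
Lemma poch_ratio_pred2_bound :
  exists D, 0 < D /\ forall N, Rabs (poch_ratio_pred2 N) <= D * poch_ratio B c N.
Proof.
  set (r := c / B).
  assert (Hr : 0 < r) by (apply Rdiv_lt_0_compat; lra).
  set (d0 := Rabs ((c - 1) * (c - 2))). set (d1 := Rabs ((c - 1) * (B - 2))).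
  set (d2 := Rabs ((B - 2) * (B - 1))).
  assert (P0 : 0 <= d0) by apply Rabs_pos. assert (P1 : 0 <= d1) by apply Rabs_pos.
  assert (P2 : 0 <= d2) by apply Rabs_pos.
  exists (1 + d0 + d1 * r + d2 * (r * r)).
  assert (Q1 : 0 <= d1 * r) by (apply Rmult_le_pos; lra).
  assert (Q2 : 0 <= d2 * (r * r)) by (apply Rmult_le_pos; nra).
  split; [lra|].
  assert (Hpr : forall n, 0 < poch_ratio B c n) by (intros; apply poch_ratio_pos; lra).
  assert (Hstep : forall n, poch_ratio B c n <= r * poch_ratio B c (S n)).
  { intros n. cbn [poch_ratio]. assert (0 <= INR n) by apply pos_INR.
    specialize (Hpr n). unfold r.
    replace (c / B * (poch_ratio B c n * (B + INR n) / (c + INR n)))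
      with (poch_ratio B c n * ((c * (B + INR n)) / (B * (c + INR n)))) by (field; lra).
    rewrite <- (Rmult_1_r (poch_ratio B c n)) at 1.
    apply Rmult_le_compat_l; [lra|]. apply -> Rle_div_r; nra. }
  intros [|[|n]]; unfold poch_ratio_pred2.
  - simpl poch_ratio. fold d0. lra.
  - fold d1. assert (H := Hstep O). assert (H' := Hpr 1%nat).
    simpl poch_ratio in H at 1.
    set (p := poch_ratio B c 1) in *.
    apply Rle_trans with (d1 * r * p); [|apply Rmult_le_compat_r; lra].
    rewrite Rmult_assoc. rewrite <- (Rmult_1_r d1) at 1.
    apply Rmult_le_compat_l; lra.
  - rewrite Rabs_mult. fold d2. rewrite (Rabs_pos_eq (poch_ratio B c n))
      by apply Rlt_le, Hpr.
    assert (H0 := Hstep n). assert (H1 := Hstep (S n)).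
    assert (H2 := Hpr (S (S n))).
    set (p := poch_ratio B c (S (S n))) in *.
    apply Rle_trans with (d2 * (r * r) * p); [|apply Rmult_le_compat_r; lra].
    rewrite Rmult_assoc. apply Rmult_le_compat_l; [lra|].
    apply Rle_trans with (1 := H0). rewrite Rmult_assoc.
    apply Rmult_le_compat_l; lra.
Qed.

Hypothesis HcA : A + 1 < c.

(** Since [(1 - t)^(1 - A) = (1 - t) (1 - t)^(-A)], this is the zeroth moment minus the first one,
    that is [K (1 - B / (c - A))]. *)
Lemma newton_pred_sum :
  Series (fun k => newton (A - 1) k * poch_ratio B c k) = K * (c - A - B) / (c - A).
Proof.
  destruct (newton_poch_summable A B c HA HB HAB) as [H0 _].
  assert (H1 : ex_series (fun k => newton A k * poch_ratio B c (1 + k))).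
  { apply (ex_series_le (V := R_CompleteNormedModule) _
      (fun k => newton A k * poch_ratio B c k)); [|exact H0].
    intros k. unfold norm; simpl norm. unfold abs; simpl abs.
    assert (Hn := newton_pos A k HA).
    rewrite Rabs_pos_eq.
    - apply Rmult_le_compat_l; [lra|]. apply poch_ratio_decr; lra.
    - apply Rmult_le_pos; [lra|]. apply Rlt_le, poch_ratio_pos; lra. }
  assert (HS : ex_series (fun k => newton A (S k) * poch_ratio B c (S k)))
    by (apply (ex_series_incr_1 (fun k => newton A k * poch_ratio B c k)); exact H0).
  assert (M := newton_poch_moments 1).
  rewrite Series_incr_1.
  - transitivity (1 + (Series (fun k => newton A (S k) * poch_ratio B c (S k))
                    - Series (fun k => newton A k * poch_ratio B c (1 + k)))).
    + f_equal; [simpl; ring|]. rewrite <- Series_minus by assumption.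
      apply Series_ext. intros k. rewrite newton_diff. simpl Nat.add. ring.
    + rewrite M. assert (HK := Series_incr_1 _ H0). cbv beta in HK. fold K in HK.
      change (newton A 0 * poch_ratio B c 0) with (1 * 1) in HK.
      replace (Series (fun k => newton A (S k) * poch_ratio B c (S k)))
        with (K - 1) by lra.
      simpl poch_ratio. field. lra.
  - apply ex_series_incr_1.
    apply ex_series_ext with (fun k => newton A (S k) * poch_ratio B c (S k)
                                       + opp (newton A k * poch_ratio B c (1 + k))).
    + intros k. rewrite newton_diff. unfold opp; simpl. ring.
    + exact (ex_series_minus _ _ HS H1).
Qed.

(** The sum with parameters [A - 1], [B - 2] has as its terms of index [m + 1] the terms of the sum
    with [1 / (m + 1)], up to the factor [(A - 1) (B - 1) (B - 2)]. Its term of index 0 has no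
    counterpart; it equals [(c - 1) (c - 2)] and is subtracted on the right. *)
Lemma clausen_pred_sum_abel (x : nat -> R) (h : R) :
  B <> 1 -> B <> 2 ->
  (forall j, 0 < x j < 1) -> is_lim_seq x 1 ->
  is_lim_seq (fun j => Series (fun n =>
      newton (A - 1) n * poch_ratio (B - 2) (c - A - 1) n * (- x j) ^ n)) h ->
  ex_series (fun m => newton A m * poch_ratio B c (2 * m) / INR (S m)) ->
  (A - 1) * (B - 1) * (B - 2)
    * Series (fun m => newton A m * poch_ratio B c (2 * m) / INR (S m))
  = K * (c - A - B) * (c - A - 1) * h - (c - 1) * (c - 2).
Proof.
  intros HB1 HB2 Hx Hx1 Hh Hext.
  destruct poch_ratio_pred2_bound as [D [HD Hbound]].
  set (nu := fun N => D * poch_ratio B c N).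
  set (E := 2 + / A).
  assert (HE : 0 < E) by (assert (H := Rinv_0_lt_compat A HA); unfold E; lra).
  assert (Hpr : forall n, 0 < poch_ratio B c n) by (intros; apply poch_ratio_pos; lra).
  destruct (newton_poch_summable A B c HA HB HAB) as [Hs0 Hl0].
  assert (Hdom : forall k, 0 <= Rabs (newton (A - 1) k) * nu k
                           <= E * D * (newton A k * poch_ratio B c k)).
  { intros k. unfold nu.
    assert (0 < D * poch_ratio B c k) by (apply Rmult_lt_0_compat; auto).
    split; [apply Rmult_le_pos; [apply Rabs_pos | lra]|].
    replace (E * D * (newton A k * poch_ratio B c k))
      with (E * newton A k * (D * poch_ratio B c k)) by ring.
    apply Rmult_le_compat_r; [lra | apply newton_pred_bound, HA]. }
  assert (Hex : ex_series (fun k => Rabs (newton (A - 1) k) * nu k)).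
  { apply (ex_series_le (V := R_CompleteNormedModule) _
      (fun k => E * D * (newton A k * poch_ratio B c k))).
    - intros k. unfold norm; simpl norm. unfold abs; simpl abs.
      rewrite Rabs_pos_eq; apply Hdom.
    - exact (ex_series_scal (E * D) _ Hs0). }
  assert (Hlim : is_lim_seq (fun k => INR k * (Rabs (newton (A - 1) k) * nu k)) 0).
  { apply is_lim_seq_le_le with (fun _ => 0)
      (fun k => E * D * (INR k * (newton A k * poch_ratio B c k))).
    - intros k. assert (Hk : 0 <= INR k) by apply pos_INR.
      destruct (Hdom k) as [d1 d2]. split; [apply Rmult_le_pos; auto|].
      replace (E * D * (INR k * (newton A k * poch_ratio B c k)))
        with (INR k * (E * D * (newton A k * poch_ratio B c k))) by ring.
      apply Rmult_le_compat_l; auto.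
    - apply is_lim_seq_const.
    - replace (Finite 0) with (Finite (E * D * 0)) by (f_equal; ring).
      exact (is_lim_seq_scal_l _ (E * D) 0 Hl0). }
  assert (Hnu : forall n k, nu (n + k)%nat <= nu k).
  { intros n k. unfold nu. apply Rmult_le_compat_l; [lra|].
    apply poch_ratio_decr; lra. }
  assert (Hrec : forall N, (c - 2 + INR N) * poch_ratio_pred2 (S N)
                           = (B - 2 + INR N) * poch_ratio_pred2 N).
  { intros [|[|N]]; unfold poch_ratio_pred2; [simpl; ring|simpl; field; lra|].
    assert (Hn : 0 <= INR N) by apply pos_INR.
    assert (H := poch_ratio_S B c N ltac:(lra)).
    rewrite !S_INR.
    transitivity ((B - 2) * (B - 1) * ((c + INR N) * poch_ratio B c (S N))); [ring|].
    rewrite H. ring. }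
  set (S0 := Series (fun k => newton (A - 1) k * poch_ratio_pred2 k)).
  assert (Hmom : forall n, Series (fun k => newton (A - 1) k * poch_ratio_pred2 (n + k))
                           = poch_ratio (B - 2) (c - A - 1) n * S0).
  { intros n.
    replace (c - A - 1) with (c - 2 - (A - 1)) by ring.
    apply (newton_moments (A - 1) (c - 2) (B - 2) poch_ratio_pred2 nu); auto. lra. }
  (* From index 2 on, [poch_ratio_pred2] is a multiple of [poch_ratio B c], so the second moment is
     known from [newton_pred_sum]. Solving for the mass divides by [(B - 2) (B - 1)], hence [B <> 1]
     and [B <> 2]. *)
  assert (HS0 : S0 = K * (c - A - B) * (c - A - 1)).
  { assert (M2 := Hmom 2%nat).
    rewrite (Series_ext _ (fun k => (B - 2) * (B - 1)
               * (newton (A - 1) k * poch_ratio B c k))) in M2.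
    - rewrite Series_scal_l, newton_pred_sum in M2.
      simpl poch_ratio in M2.
      apply Rmult_eq_reg_l with ((B - 2) * (B - 1) / ((c - A - 1) * (c - A))).
      + transitivity (1 * (B - 2 + 0) / (c - A - 1 + 0) * (B - 2 + 1)
                      / (c - A - 1 + 1) * S0); [field; lra|].
        rewrite <- M2. field. lra.
      + unfold Rdiv. repeat apply Rmult_integral_contrapositive_currified; try lra.
        apply Rinv_neq_0_compat. apply Rmult_integral_contrapositive_currified; lra.
    - intros k. simpl Nat.add. unfold poch_ratio_pred2. ring. }
  assert (H' : is_lim_seq (fun j => Series (fun n => newton (A - 1) n * (- x j) ^ n
      * Series (fun k => newton (A - 1) k * poch_ratio_pred2 (n + k))))
    (Series (fun m => newton (A - 1) m * poch_ratio_pred2 (2 * m)))).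
  { apply (abel_quadratic (A - 1) A poch_ratio_pred2 nu x); auto; [lra|].
    apply ex_series_ext with (fun k => D * (newton A k * poch_ratio B c k)).
    - intros k. unfold nu.
      change (D * (newton A k * poch_ratio B c k)
              = newton A k * (D * poch_ratio B c k)). ring.
    - exact (ex_series_scal D _ Hs0). }
  assert (L : is_lim_seq (fun j => Series (fun n => newton (A - 1) n * (- x j) ^ n
      * Series (fun k => newton (A - 1) k * poch_ratio_pred2 (n + k)))) (S0 * h)).
  { apply is_lim_seq_ext with (fun j => S0 * Series (fun n =>
      newton (A - 1) n * poch_ratio (B - 2) (c - A - 1) n * (- x j) ^ n)).
    - intros j. rewrite <- Series_scal_l. apply Series_ext. intros n.
      rewrite Hmom. ring.
    - exact (is_lim_seq_scal_l _ S0 h Hh). }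
  apply is_lim_seq_unique in L. apply is_lim_seq_unique in H'.
  rewrite L in H'. apply (f_equal real) in H'. cbn [real] in H'.
  rewrite HS0 in H'. rewrite H'.
  assert (Hterm : forall m, newton (A - 1) (S m) * poch_ratio_pred2 (2 * S m)
    = (A - 1) * (B - 1) * (B - 2) * (newton A m * poch_ratio B c (2 * m) / INR (S m))).
  { intros m. replace (2 * S m)%nat with (S (S (2 * m))) by lia.
    unfold poch_ratio_pred2. assert (Hp := newton_pred A m).
    assert (HSm : 0 < INR (S m)) by (apply lt_0_INR; lia).
    replace (newton (A - 1) (S m)) with ((A - 1) * newton A m / INR (S m))
      by (rewrite <- Hp; field; lra).
    field. lra. }
  rewrite (Series_incr_1 (fun m => newton (A - 1) m * poch_ratio_pred2 (2 * m))).
  - cbv beta. rewrite (Series_ext _ _ Hterm), Series_scal_l. simpl newton. simpl Nat.mul.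
    unfold poch_ratio_pred2. ring.
  - apply ex_series_incr_1. 
    apply ex_series_ext with (fun m => (A - 1) * (B - 1) * (B - 2)
      * (newton A m * poch_ratio B c (2 * m) / INR (S m))).
    + intros m. symmetry. apply Hterm.
    + exact (ex_series_scal ((A - 1) * (B - 1) * (B - 2)) _ Hext).
Qed.

Lemma clausen_summable : ex_series (fun m => newton A m * poch_ratio B c (2 * m)).
Proof.
  apply (ex_series_le (V := R_CompleteNormedModule) _
    (fun k => newton A k * poch_ratio B c k)).
  - intros k. unfold norm; simpl norm. unfold abs; simpl abs.
    assert (Hn := newton_pos A k HA).
    rewrite Rabs_pos_eq.
    + apply Rmult_le_compat_l; [lra|].
      replace (2 * k)%nat with (k + k)%nat by lia. apply poch_ratio_decr; lra.
    + apply Rmult_le_pos; [lra|]. apply Rlt_le, poch_ratio_pos; lra.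
  - apply newton_poch_summable; lra.
Qed.

End HypergeometricSums.

(** * Complex power series on the unit disk *)

Notation is_Cseries := (is_series (K := C_AbsRing) (V := C_NormedModule)).
Notation is_Cderive := (is_derive (K := C_AbsRing) (V := C_NormedModule)).

Lemma sum_n_Re (a : nat -> C) (n : nat) :
  Re (sum_n (G := C_NormedModule) a n) = sum_n (fun k => Re (a k)) n.
Proof.
  induction n as [|n IH]; [rewrite !sum_O; reflexivity|].
  rewrite !sum_Sn, <- IH. reflexivity.
Qed.

Lemma sum_n_Im (a : nat -> C) (n : nat) :
  Im (sum_n (G := C_NormedModule) a n) = sum_n (fun k => Im (a k)) n.
Proof.
  induction n as [|n IH]; [rewrite !sum_O; reflexivity|].
  rewrite !sum_Sn, <- IH. reflexivity.
Qed.

Lemma is_Cseries_Re_Im (a : nat -> C) (l : C) :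
  is_Cseries a l <->
  is_series (fun n => Re (a n)) (Re l) /\ is_series (fun n => Im (a n)) (Im l).
Proof.
  unfold is_series. split.
  - intros H0. assert (H := proj1 (filterlim_locally _ _) H0).
    split; apply (proj2 (filterlim_locally _ _)); intros eps;
      destruct (H eps) as [N HN]; exists N; intros n Hn; destruct (HN n Hn) as [H1 H2].
    + rewrite <- sum_n_Re. exact H1.
    + rewrite <- sum_n_Im. exact H2.
  - intros [H1' H2']. assert (H1 := proj1 (filterlim_locally _ _) H1').
    assert (H2 := proj1 (filterlim_locally _ _) H2').
    apply (proj2 (filterlim_locally _ _)). intros eps.
    destruct (H1 eps) as [N1 HN1]. destruct (H2 eps) as [N2 HN2].
    exists (Nat.max N1 N2). intros n Hn. split.
    + specialize (HN1 n ltac:(lia)). rewrite <- sum_n_Re in HN1. exact HN1.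
    + specialize (HN2 n ltac:(lia)). rewrite <- sum_n_Im in HN2. exact HN2.
Qed.

Definition CSeries (a : nat -> C) : C :=
  (Series (fun n => Re (a n)), Series (fun n => Im (a n))).

Lemma is_Cseries_unique (a : nat -> C) (l : C) : is_Cseries a l -> CSeries a = l.
Proof.
  intros H. apply is_Cseries_Re_Im in H. destruct H as [H1 H2].
  unfold CSeries. rewrite (is_series_unique _ _ H1), (is_series_unique _ _ H2).
  destruct l; reflexivity.
Qed.

Lemma Im_le_Cmod (z : C) : Rabs (Im z) <= Cmod z.
Proof. apply Rle_trans with (2 := Rmax_Cmod z), Rmax_r. Qed.

Lemma CSeries_correct (a : nat -> C) :
  ex_series (fun n => Cmod (a n)) -> is_Cseries a (CSeries a).
Proof.
  intros H. apply is_Cseries_Re_Im. split; simpl.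
  - apply Series_correct.
    apply (ex_series_le (V := R_CompleteNormedModule) _ (fun n => Cmod (a n))); auto.
    intros n. apply re_le_Cmod.
  - apply Series_correct.
    apply (ex_series_le (V := R_CompleteNormedModule) _ (fun n => Cmod (a n))); auto.
    intros n. apply Im_le_Cmod.
Qed.

Lemma Cmod_series_le (a : nat -> C) (b : nat -> R) (l : C) :
  is_Cseries a l -> ex_series b -> (forall n, Cmod (a n) <= b n) ->
  Cmod l <= Series b.
Proof.
  intros Ha Hb Hab.
  assert (H := filterlim_comp _ _ _ _ norm _ _ _ Ha (filterlim_norm l)).
  apply (is_lim_seq_le (fun n => norm (sum_n (G := C_NormedModule) a n))
           (sum_n b) (Cmod l) (Series b)).
  - intros n. apply Rle_trans with (1 := norm_sum_n_m a 0 n).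
    apply (sum_n_m_le _ b). exact Hab.
  - exact H.
  - exact (Series_correct _ Hb).
Qed.

Lemma pow_n_Cpow (z : C) (n : nat) : pow_n (K := C_AbsRing) z n = (z ^ n)%C.
Proof. induction n as [|n IH]; [reflexivity|]. simpl. rewrite IH. reflexivity. Qed.

Lemma is_pseries_Cseries (al : nat -> C) (z l : C) :
  is_pseries (K := C_AbsRing) (V := C_NormedModule) al z l
  <-> is_Cseries (fun n => (al n * z ^ n)%C) l.
Proof.
  unfold is_pseries.
  assert (E : forall n, scal (pow_n (K := C_AbsRing) z n) (al n) = (al n * z ^ n)%C).
  { intros n. rewrite pow_n_Cpow. apply Cmult_comm. }
  split; apply is_series_ext; intros n; [apply E | symmetry; apply E].
Qed.

(** A condition on the moduli alone, equivalent to convergence on the open disk, so that questions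
    about expansions reduce to real nonnegative series. *)
Definition disk_summable (al : nat -> C) : Prop :=
  forall r, 0 <= r < 1 -> ex_series (fun n => Cmod (al n) * r ^ n).

Lemma ex_series_disk_term (al : nat -> C) (z : C) :
  disk_summable al -> Cmod z < 1 -> ex_series (fun n => Cmod (al n * z ^ n)).
Proof.
  intros H Hz.
  apply ex_series_ext with (fun n => Cmod (al n) * Cmod z ^ n).
  - intros n. rewrite Cmod_mult, Cmod_pow. reflexivity.
  - apply H. split; [apply Cmod_ge_0 | exact Hz].
Qed.

Lemma CPSeries_correct (al : nat -> C) (z : C) :
  disk_summable al -> Cmod z < 1 ->
  is_Cseries (fun n => (al n * z ^ n)%C) (CPSeries al z).
Proof. intros H Hz. apply CSeries_correct, ex_series_disk_term; auto. Qed.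

Lemma disk_summable_expands (al : nat -> C) :
  disk_summable al -> expands_on_disk al (CPSeries al).
Proof.
  intros H z Hz. apply is_pseries_Cseries, CPSeries_correct; auto.
Qed.

Lemma expands_CPSeries (al : nat -> C) (f : C -> C) (z : C) :
  expands_on_disk al f -> disk z -> f z = CPSeries al z.
Proof.
  intros H Hz. symmetry. apply is_Cseries_unique, is_pseries_Cseries, H, Hz.
Qed.

(** Abel's lemma: convergence at the intermediate radius [rho] bounds the terms there, and at radius
    [r] they are then dominated by a geometric series of ratio [r / rho]. *)
Lemma expands_disk_summable (al : nat -> C) (f : C -> C) :
  expands_on_disk al f -> disk_summable al.
Proof.
  intros H r Hr. set (rho := (1 + r) / 2).
  assert (Hrho : 0 < rho < 1) by (unfold rho; lra).
  assert (Hm : Cmod (RtoC rho) = rho) by (rewrite Cmod_R; apply Rabs_pos_eq; lra).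
  assert (Hd : disk (RtoC rho)) by (unfold disk; rewrite Hm; lra).
  specialize (H _ Hd). apply is_pseries_Cseries, is_Cseries_Re_Im in H.
  destruct H as [H1 H2].
  assert (L1 := ex_series_lim_0 _ (ex_intro _ _ H1)).
  assert (L2 := ex_series_lim_0 _ (ex_intro _ _ H2)).
  apply is_lim_seq_spec in L1. apply is_lim_seq_spec in L2.
  destruct (L1 (mkposreal 1 Rlt_0_1)) as [N1 HN1].
  destruct (L2 (mkposreal 1 Rlt_0_1)) as [N2 HN2]. cbn [pos] in HN1, HN2.
  set (N := Nat.max N1 N2).
  apply (ex_series_incr_n (fun n => Cmod (al n) * r ^ n) N).
  apply (ex_series_le (V := R_CompleteNormedModule) _
    (fun n => (r / rho) ^ N * 2 * (r / rho) ^ n)).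
  - intros n. unfold norm; simpl norm. unfold abs; simpl abs.
    rewrite Rabs_pos_eq by (apply Rmult_le_pos; [apply Cmod_ge_0 | apply pow_le; lra]).
    specialize (HN1 (N + n)%nat ltac:(lia)). specialize (HN2 (N + n)%nat ltac:(lia)).
    rewrite Rminus_0_r in HN1, HN2.
    assert (HC : Cmod (al (N + n)%nat * RtoC rho ^ (N + n)) <= 2).
    { set (w := (al (N + n)%nat * RtoC rho ^ (N + n))%C) in *.
      apply Rle_trans with (1 := Cmod_2Rmax w).
      assert (Rmax (Rabs (fst w)) (Rabs (snd w)) <= 1)
        by (apply Rmax_lub; apply Rlt_le; [exact HN1 | exact HN2]).
      assert (0 <= Rmax (Rabs (fst w)) (Rabs (snd w)))
        by (apply Rle_trans with (2 := Rmax_l _ _), Rabs_pos).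
      assert (sqrt 2 <= 2).
      { rewrite <- (sqrt_pow2 2) at 2 by lra. apply sqrt_le_1_alt. lra. }
      assert (0 <= sqrt 2) by apply sqrt_pos. nra. }
    rewrite Cmod_mult, Cmod_pow, Hm in HC.
    replace (r ^ (N + n)) with (rho ^ (N + n) * (r / rho) ^ (N + n)).
    + rewrite <- Rmult_assoc, (pow_add (r / rho)).
      replace ((r / rho) ^ N * 2 * (r / rho) ^ n)
        with (2 * ((r / rho) ^ N * (r / rho) ^ n)) by ring.
      apply Rmult_le_compat_r; [|exact HC].
      assert (0 <= r / rho) by (apply Rdiv_le_0_compat; lra).
      apply Rmult_le_pos; apply pow_le; auto.
    + rewrite <- Rpow_mult_distr. f_equal. field. lra.
  - refine (ex_series_scal ((r / rho) ^ N * 2) _ (ex_series_geom (r / rho) _)).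
    rewrite Rabs_pos_eq by (apply Rdiv_le_0_compat; lra).
    apply Rlt_div_l; unfold rho; lra.
Qed.

Lemma INR_pow_bound (q : R) (n : nat) :
  0 <= q < 1 -> INR n * q ^ n <= / (1 - q).
Proof.
  intros Hq.
  (* Equivalent to [n q^n <= 1 + q + ... + q^(n-1)]; keeping [q^n] on the left is what lets the
     induction close. *)
  assert (H : INR n * q ^ n * (1 - q) + q ^ n <= 1).
  { induction n as [|n IH]; [simpl; lra|].
    apply Rle_trans with (2 := IH). rewrite S_INR, <- tech_pow_Rmult.
    assert (0 <= q ^ n) by (apply pow_le; lra).
    assert (0 <= INR n) by apply pos_INR.
    assert (0 <= (1 - q) * (1 - q) * (q ^ n * (INR n + 1))).
    { apply Rmult_le_pos; [nra|]. apply Rmult_le_pos; lra. }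
    lra. }
  assert (0 <= q ^ n) by (apply pow_le; lra).
  apply Rmult_le_reg_r with (1 - q); [lra|]. rewrite Rinv_l by lra. lra.
Qed.

Lemma disk_summable_mul_INR (al : nat -> C) :
  disk_summable al -> disk_summable (fun n => (RtoC (INR n) * al n)%C).
Proof.
  intros H r Hr. set (rho := (1 + r) / 2).
  assert (Hrho : 0 < rho < 1) by (unfold rho; lra).
  assert (Hq : 0 <= r / rho < 1).
  { split; [apply Rdiv_le_0_compat; lra | apply Rlt_div_l; unfold rho; lra]. }
  apply (ex_series_le (V := R_CompleteNormedModule) _
    (fun n => / (1 - r / rho) * (Cmod (al n) * rho ^ n))).
  - intros n. unfold norm; simpl norm. unfold abs; simpl abs.
    rewrite Rabs_pos_eq by (apply Rmult_le_pos; [apply Cmod_ge_0 | apply pow_le; lra]).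
    rewrite Cmod_mult, Cmod_R, Rabs_pos_eq by apply pos_INR.
    replace (r ^ n) with (rho ^ n * (r / rho) ^ n)
      by (rewrite <- Rpow_mult_distr; f_equal; field; lra).
    assert (Hb := INR_pow_bound (r / rho) n Hq).
    assert (0 <= Cmod (al n) * rho ^ n)
      by (apply Rmult_le_pos; [apply Cmod_ge_0 | apply pow_le; lra]).
    replace (INR n * Cmod (al n) * (rho ^ n * (r / rho) ^ n))
      with (INR n * (r / rho) ^ n * (Cmod (al n) * rho ^ n)) by ring.
    apply Rmult_le_compat_r; auto.
  - refine (ex_series_scal (/ (1 - r / rho)) _ (H rho _)). lra.
Qed.

Definition Cderiv_coef (al : nat -> C) (n : nat) : C := (RtoC (INR (S n)) * al (S n))%C.

Lemma disk_summable_deriv (al : nat -> C) :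
  disk_summable al -> disk_summable (Cderiv_coef al).
Proof.
  intros H r Hr. apply disk_summable_mul_INR in H.
  destruct (Req_dec r 0) as [->|Hr0].
  - apply ex_series_incr_1. apply ex_series_ext with (fun _ => 0).
    + intros n. simpl. unfold zero; simpl. rewrite Rmult_0_l, Rmult_0_r. reflexivity.
    + exists 0. apply is_series_Reals. intros eps He. exists O. intros n _.
      rewrite sum_cte, Rmult_0_l. unfold Rdist. rewrite Rminus_0_r, Rabs_R0. exact He.
  - specialize (H r Hr). apply ex_series_incr_1 in H.
    generalize (ex_series_scal (/ r) _ H). apply ex_series_ext. intros n.
    change (/ r * (Cmod (Cderiv_coef al n) * r ^ S n) = Cmod (Cderiv_coef al n) * r ^ n).
    rewrite <- tech_pow_Rmult. field. exact Hr0.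
Qed.

Lemma is_Cderive_intro (f : C -> C) (z l : C) (d M : R) :
  0 < d -> 0 <= M ->
  (forall y, Cmod (y - z) < d ->
     Cmod (f y - f z - (y - z) * l) <= M * (Cmod (y - z) * Cmod (y - z))) ->
  is_Cderive f z l.
Proof.
  intros Hd HM H. split; [apply (is_linear_scal_l (K := C_AbsRing))|].
  intros x Hx. apply (is_filter_lim_locally_unique (V := AbsRing_NormedModule C_AbsRing)) in Hx.
  subst x. intros eps.
  assert (He : 0 < Rmin d (eps / (M + 1))).
  { apply Rmin_glb_lt; auto. apply Rdiv_lt_0_compat; [apply cond_pos | lra]. }
  exists (mkposreal _ He). intros y Hy.
  change (Cmod (y - z) < Rmin d (eps / (M + 1))) in Hy.
  change (Cmod (f y - f z - (y - z) * l) <= eps * Cmod (y - z)).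
  assert (H1 := Rmin_l d (eps / (M + 1))). assert (H2 := Rmin_r d (eps / (M + 1))).
  apply Rle_trans with (1 := H y ltac:(lra)).
  rewrite <- Rmult_assoc. assert (Hc := Cmod_ge_0 (y - z)).
  apply Rmult_le_compat_r; [auto|].
  assert (H3 : Cmod (y - z) * (M + 1) < eps) by (apply Rlt_div_r; lra).
  nra.
Qed.

Lemma Cpow_diff_bound (y z : C) (rho : R) (n : nat) :
  0 < rho -> Cmod y <= rho -> Cmod z <= rho ->
  Cmod (y ^ n - z ^ n) <= INR n * (rho ^ n / rho) * Cmod (y - z).
Proof.
  intros Hr Hy Hz. induction n as [|n IH].
  - simpl. replace (1 - 1)%C with (RtoC 0) by ring. rewrite Cmod_0. lra.
  - replace (y ^ S n - z ^ S n)%C with (y * (y ^ n - z ^ n) + (y - z) * z ^ n)%C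
      by (rewrite !Cpow_S; ring).
    apply Rle_trans with (1 := Cmod_triangle _ _).
    rewrite !Cmod_mult, Cmod_pow, S_INR, <- tech_pow_Rmult.
    assert (Hzn : Cmod z ^ n <= rho ^ n)
      by (apply pow_incr; split; [apply Cmod_ge_0 | exact Hz]).
    assert (Hc := Cmod_ge_0 (y - z)).
    assert (H1 : Cmod y * Cmod (y ^ n - z ^ n)
                 <= rho * (INR n * (rho ^ n / rho) * Cmod (y - z)))
      by (apply Rmult_le_compat; auto; apply Cmod_ge_0).
    assert (H2 : Cmod (y - z) * Cmod z ^ n <= Cmod (y - z) * rho ^ n)
      by (apply Rmult_le_compat_l; auto).
    replace ((INR n + 1) * (rho * rho ^ n / rho) * Cmod (y - z))
      with (rho * (INR n * (rho ^ n / rho) * Cmod (y - z)) + Cmod (y - z) * rho ^ n)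
      by (field; lra).
    lra.
Qed.

(** One step multiplies the remainder by [y] and adds [n z^(n-1) (y - z)^2]. The factor [n^2] is not
    sharp, but polynomial growth is all that the summation over [n] requires. *)
Lemma Cpow_taylor_bound (y z : C) (rho : R) (n : nat) :
  0 < rho -> Cmod y <= rho -> Cmod z <= rho ->
  Cmod (y ^ n - z ^ n - (y - z) * (RtoC (INR n) * z ^ pred n))
  <= INR n * INR n * rho ^ n / (rho * rho) * (Cmod (y - z) * Cmod (y - z)).
Proof.
  intros Hr Hy Hz. induction n as [|n IH].
  - simpl. replace (1 - 1 - (y - z) * (0 * 1))%C with (RtoC 0) by ring.
    rewrite Cmod_0. right. field. lra.
  - replace (y ^ S n - z ^ S n - (y - z) * (RtoC (INR (S n)) * z ^ pred (S n)))%C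
      with (y * (y ^ n - z ^ n - (y - z) * (RtoC (INR n) * z ^ pred n))
            + RtoC (INR n) * z ^ pred n * ((y - z) * (y - z)))%C.
    2: { simpl pred. rewrite !Cpow_S, S_INR, RtoC_plus.
         destruct n as [|n]; [simpl; ring|]. simpl pred. rewrite !Cpow_S. ring. }
    apply Rle_trans with (1 := Cmod_triangle _ _).
    rewrite !Cmod_mult, Cmod_pow, Cmod_R, (Rabs_pos_eq (INR n)) by apply pos_INR.
    set (h := Cmod (y - z)) in *. assert (Hh : 0 <= h) by apply Cmod_ge_0.
    assert (Hn := pos_INR n).
    set (w := Cmod (y ^ n - z ^ n - (y - z) * (RtoC (INR n) * z ^ pred n))) in *.
    assert (Hw : 0 <= w) by apply Cmod_ge_0.
    assert (H1 : Cmod y * w <= rho * (INR n * INR n * rho ^ n / (rho * rho) * (h * h)))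
      by (apply Rmult_le_compat; auto; apply Cmod_ge_0).
    assert (Hrn : 0 < rho ^ n) by (apply pow_lt; lra).
    assert (H2 : INR n * Cmod z ^ pred n <= INR n * (rho ^ n / rho)).
    { destruct n as [|n]; [simpl; lra|]. simpl pred.
      apply Rmult_le_compat_l; [auto|]. rewrite <- tech_pow_Rmult.
      replace (rho * rho ^ n / rho) with (rho ^ n) by (field; lra).
      apply pow_incr. split; [apply Cmod_ge_0 | exact Hz]. }
    assert (H3 : INR n * Cmod z ^ pred n * (h * h) <= INR n * (rho ^ n / rho) * (h * h))
      by (apply Rmult_le_compat_r; nra).
    rewrite S_INR, <- tech_pow_Rmult.
    replace ((INR n + 1) * (INR n + 1) * (rho * rho ^ n) / (rho * rho) * (h * h))
      with (rho * (INR n * INR n * rho ^ n / (rho * rho) * (h * h))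
            + INR n * (rho ^ n / rho) * (h * h)
            + (INR n + 1) * (rho ^ n / rho) * (h * h)) by (field; lra).
    assert (0 <= (INR n + 1) * (rho ^ n / rho) * (h * h)).
    { apply Rmult_le_pos; [|nra]. apply Rmult_le_pos; [lra|].
      apply Rdiv_le_0_compat; lra. }
    lra.
Qed.

Lemma is_Cseries_deriv (al : nat -> C) (z : C) :
  disk_summable al -> Cmod z < 1 ->
  is_Cseries (fun n => (al n * (RtoC (INR n) * z ^ pred n))%C)
    (CPSeries (Cderiv_coef al) z).
Proof.
  intros H Hz. apply is_series_decr_1.
  replace (plus (CPSeries (Cderiv_coef al) z) _) with (CPSeries (Cderiv_coef al) z).
  - apply is_series_ext with (fun n => (Cderiv_coef al n * z ^ n)%C).
    + intros n. unfold Cderiv_coef. simpl pred.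
      change (RtoC (INR (S n)) * al (S n) * z ^ n
              = al (S n) * (RtoC (INR (S n)) * z ^ n))%C. ring.
    + apply CPSeries_correct; auto. apply disk_summable_deriv, H.
  - change (CPSeries (Cderiv_coef al) z
      = CPSeries (Cderiv_coef al) z + - (al 0%nat * (RtoC (INR 0) * z ^ pred 0)))%C.
    simpl. ring.
Qed.

(** Points [y] closer to [z] than half the distance from [z] to the circle stay within radius [rho];
    there the quadratic remainders add up, because [n^2 |al n| rho^n] is summable. *)
Lemma CPSeries_derive (al : nat -> C) (z : C) :
  disk_summable al -> Cmod z < 1 ->
  is_Cderive (CPSeries al) z (CPSeries (Cderiv_coef al) z).
Proof.
  intros H Hz. set (rho := (1 + Cmod z) / 2).
  assert (Hz0 := Cmod_ge_0 z).
  assert (Hrho : 0 < rho < 1) by (unfold rho; lra).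
  assert (H2 := disk_summable_mul_INR _ (disk_summable_mul_INR _ H)).
  specialize (H2 rho ltac:(lra)).
  set (b := fun n => / (rho * rho)
    * (Cmod (RtoC (INR n) * (RtoC (INR n) * al n)) * rho ^ n)).
  assert (Hb : ex_series b) by exact (ex_series_scal (/ (rho * rho)) _ H2).
  assert (Hb0 : forall n, 0 <= b n).
  { intros n. unfold b. apply Rmult_le_pos.
    - apply Rlt_le, Rinv_0_lt_compat. nra.
    - apply Rmult_le_pos; [apply Cmod_ge_0 | apply pow_le; lra]. }
  apply (is_Cderive_intro _ _ _ ((1 - Cmod z) / 2) (Series b));
    [lra | apply Series_ge_0; auto |].
  intros y Hy.
  assert (Hyr : Cmod y <= rho).
  { replace y with ((y - z) + z)%C by ring.
    apply Rle_trans with (1 := Cmod_triangle _ _). unfold rho. lra. }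
  assert (Hs : is_Cseries (fun n => (al n
      * (y ^ n - z ^ n - (y - z) * (RtoC (INR n) * z ^ pred n)))%C)
    (CPSeries al y - CPSeries al z - (y - z) * CPSeries (Cderiv_coef al) z)%C).
  { assert (S1 := CPSeries_correct al y H ltac:(lra)).
    assert (S2 := CPSeries_correct al z H Hz).
    assert (S3 := is_Cseries_deriv al z H Hz).
    assert (S4 := is_series_minus _ _ _ _ (is_series_minus _ _ _ _ S1 S2)
      (is_series_scal (y - z)%C _ _ S3)).
    refine (is_series_ext _ _ _ _ S4). intros n.
    change ((al n * y ^ n + - (al n * z ^ n)
             + - ((y - z) * (al n * (RtoC (INR n) * z ^ pred n)))
      = al n * (y ^ n - z ^ n - (y - z) * (RtoC (INR n) * z ^ pred n)))%C). ring. }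
  set (h := Cmod (y - z) * Cmod (y - z)).
  rewrite <- (Series_scal_r h b).
  apply (Cmod_series_le _ _ _ Hs).
  - apply (ex_series_scal_r h b Hb).
  - intros n. rewrite Cmod_mult.
    assert (Ht := Cpow_taylor_bound y z rho n ltac:(lra) Hyr ltac:(unfold rho; lra)).
    fold h in Ht. unfold b.
    rewrite !Cmod_mult, !Cmod_R, !(Rabs_pos_eq (INR n)) by apply pos_INR.
    replace (/ (rho * rho) * (INR n * (INR n * Cmod (al n)) * rho ^ n) * h)
      with (Cmod (al n) * (INR n * INR n * rho ^ n / (rho * rho) * h)) by (field; lra).
    apply Rmult_le_compat_l; [apply Cmod_ge_0 | exact Ht].
Qed.

Lemma disk_open (z : C) : disk z ->
  locally (T := AbsRing_UniformSpace C_AbsRing) z disk.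
Proof.
  intros Hz. unfold disk in *. assert (Hd : 0 < 1 - Cmod z) by lra.
  exists (mkposreal _ Hd). intros y Hy.
  change (Cmod (y - z) < 1 - Cmod z) in Hy.
  replace y with ((y - z) + z)%C by ring.
  apply Rle_lt_trans with (1 := Cmod_triangle _ _). lra.
Qed.

Lemma C_derive_disk (al : nat -> C) (f : C -> C) :
  disk_summable al -> (forall z, disk z -> f z = CPSeries al z) ->
  forall z, disk z -> C_derive f z = CPSeries (Cderiv_coef al) z.
Proof.
  intros H Hf z Hz. apply is_C_derive_unique.
  apply (is_derive_ext_loc (K := C_AbsRing) (V := C_NormedModule) (CPSeries al)).
  - apply filter_imp with (2 := disk_open z Hz). intros y Hy. symmetry. auto.
  - apply CPSeries_derive; auto.
Qed.

Lemma CPSeries_0 (al : nat -> C) : disk_summable al -> CPSeries al 0 = al O.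
Proof.
  intros H. apply is_Cseries_unique. apply is_series_decr_1.
  replace (plus (al O) _) with (RtoC 0).
  - apply is_series_ext with (fun _ => RtoC 0).
    + intros n. rewrite Cpow_S. change (RtoC 0 = al (S n) * (0 * 0 ^ n))%C. ring.
    + apply is_Cseries_Re_Im. simpl. split; apply is_series_Reals; intros eps He;
        exists O; intros n _; rewrite sum_cte, Rmult_0_l; unfold Rdist;
        rewrite Rminus_0_r, Rabs_R0; exact He.
  - change (RtoC 0 = al 0%nat + - (al 0%nat * 0 ^ 0))%C. simpl. ring.
Qed.

Lemma Cderiv_coef_iter (al : nat -> C) (n k : nat) :
  (RtoC (INR (fact k)) * Nat.iter n Cderiv_coef al k
   = RtoC (INR (fact (n + k))) * al (n + k)%nat)%C.
Proof.
  revert k. induction n as [|n IH]; intros k; [reflexivity|].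
  simpl Nat.iter. unfold Cderiv_coef at 1.
  replace (S n + k)%nat with (n + S k)%nat by lia. rewrite <- IH.
  rewrite fact_simpl, mult_INR, RtoC_mult. ring.
Qed.

Lemma taylor_coef_expands (al : nat -> C) (f : C -> C) (n : nat) :
  expands_on_disk al f -> taylor_coef f n = al n.
Proof.
  intros Hf. assert (H := expands_disk_summable al f Hf).
  assert (Hn : disk_summable (Nat.iter n Cderiv_coef al) /\
    forall z, disk z -> Nat.iter n C_derive f z = CPSeries (Nat.iter n Cderiv_coef al) z).
  { induction n as [|n [IH1 IH2]]; simpl.
    - split; auto. intros z Hz. apply expands_CPSeries; auto.
    - split; [apply disk_summable_deriv, IH1|]. apply C_derive_disk; auto. }
  destruct Hn as [H1 H2]. unfold taylor_coef.
  rewrite H2 by (unfold disk; rewrite Cmod_0; lra). rewrite CPSeries_0 by exact H1.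
  assert (Hi := Cderiv_coef_iter al n 0). rewrite Nat.add_0_r in Hi.
  simpl (INR (fact 0)) in Hi. rewrite Cmult_1_l in Hi. rewrite Hi.
  field. intros E. injection E. apply INR_fact_neq_0.
Qed.

(** * The Caratheodory coefficient estimate *)

(** The upper end is excluded, which suits averages over the N roots of unity [j < N]; [sum_n]
    includes it, whence the shift in [Csum_sum_n]. *)
Fixpoint Csum (f : nat -> C) (n : nat) : C :=
  match n with
  | O => RtoC 0
  | S m => (Csum f m + f m)%C
  end.

Lemma Csum_ext (f g : nat -> C) (n : nat) :
  (forall k, (k < n)%nat -> f k = g k) -> Csum f n = Csum g n.
Proof.
  intros H. induction n as [|n IH]; [reflexivity|]. simpl.
  rewrite IH, H by (intros; auto; lia). reflexivity.
Qed.

Lemma Csum_plus (f g : nat -> C) (n : nat) :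
  Csum (fun k => (f k + g k)%C) n = (Csum f n + Csum g n)%C.
Proof. induction n as [|n IH]; simpl; [ring|]. rewrite IH. ring. Qed.

Lemma Csum_scal (c : C) (f : nat -> C) (n : nat) :
  Csum (fun k => (c * f k)%C) n = (c * Csum f n)%C.
Proof. induction n as [|n IH]; simpl; [ring|]. rewrite IH. ring. Qed.

Lemma Csum_switch (f : nat -> nat -> C) (m n : nat) :
  Csum (fun i => Csum (f i) n) m = Csum (fun j => Csum (fun i => f i j) m) n.
Proof.
  induction m as [|m IH]; simpl.
  - induction n as [|n IHn]; simpl; [reflexivity|]. rewrite <- IHn. ring.
  - rewrite IH, <- Csum_plus. reflexivity.
Qed.

Lemma Csum_const (c : C) (n : nat) : Csum (fun _ => c) n = (RtoC (INR n) * c)%C.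
Proof.
  induction n as [|n IH]; [simpl; ring|].
  simpl Csum. rewrite IH, S_INR, RtoC_plus. ring.
Qed.

Lemma Csum_single (f : nat -> C) (m n : nat) :
  (m < n)%nat -> (forall k, (k < n)%nat -> k <> m -> f k = RtoC 0) -> Csum f n = f m.
Proof.
  intros Hm H. induction n as [|n IH]; [lia|]. simpl.
  destruct (Nat.eq_dec m n) as [->|Hne].
  - rewrite (Csum_ext f (fun _ => RtoC 0)) by (intros; apply H; lia).
    rewrite Csum_const. ring.
  - rewrite IH by (auto; lia || (intros; apply H; lia)).
    rewrite (H n) by lia. ring.
Qed.

Lemma Csum_zero (f : nat -> C) (n : nat) :
  (forall k, (k < n)%nat -> f k = RtoC 0) -> Csum f n = RtoC 0.
Proof.
  intros H. rewrite (Csum_ext f (fun _ => RtoC 0)) by exact H.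
  rewrite Csum_const. ring.
Qed.

Lemma Cmod_Csum_le (f : nat -> C) (b : nat -> R) (n : nat) :
  (forall k, Cmod (f k) <= b k) -> Cmod (Csum f n) <= Re (Csum (fun k => RtoC (b k)) n).
Proof.
  intros H. induction n as [|n IH]; simpl.
  - rewrite Cmod_0. lra.
  - apply Rle_trans with (1 := Cmod_triangle _ _). apply Rplus_le_compat; auto.
Qed.

Lemma Re_Csum_affine (f : nat -> C) (e : R) (n : nat) :
  Re (Csum (fun k => RtoC (2 * Re (f k) + e)) n) = 2 * Re (Csum f n) + INR n * e.
Proof.
  induction n as [|n IH]; [unfold Re; simpl; ring|].
  cbn [Csum]. rewrite S_INR, !re_plus, IH, re_RtoC. ring.
Qed.

Lemma geometric_root_of_unity (q : C) (N : nat) :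
  (q ^ N)%C = RtoC 1 -> q <> RtoC 1 -> Csum (fun j => (q ^ j)%C) N = RtoC 0.
Proof.
  intros HN Hq.
  assert (H : forall n, ((q - 1) * Csum (fun j => q ^ j) n = q ^ n - 1)%C).
  { induction n as [|n IH]; simpl; [ring|]. rewrite Cmult_plus_distr_l, IH. ring. }
  specialize (H N). rewrite HN in H.
  assert (Hq1 : (q - 1)%C <> RtoC 0).
  { intros E. apply Hq. replace q with ((q - 1) + 1)%C by ring. rewrite E. ring. }
  replace (Csum (fun j => (q ^ j)%C) N)
    with (/ (q - 1) * ((q - 1) * Csum (fun j => q ^ j) N))%C by (field; exact Hq1).
  rewrite H. ring.
Qed.

Definition unit_root (N : nat) : C := (cos (2 * PI / INR N), sin (2 * PI / INR N)).

Lemma Cpow_cis (t : R) (k : nat) :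
  ((cos t, sin t) ^ k)%C = (cos (INR k * t), sin (INR k * t)).
Proof.
  induction k as [|k IH].
  - simpl. rewrite Rmult_0_l, cos_0, sin_0. reflexivity.
  - rewrite Cpow_S, IH, S_INR.
    replace ((INR k + 1) * t) with (t + INR k * t) by ring.
    rewrite cos_plus, sin_plus. unfold Cmult. simpl. f_equal; ring.
Qed.

Lemma Cmod_cis (t : R) : Cmod (cos t, sin t) = 1.
Proof.
  unfold Cmod. simpl.
  replace (cos t * (cos t * 1) + sin t * (sin t * 1)) with 1.
  - apply sqrt_1.
  - assert (H := sin2_cos2 t). unfold Rsqr in H. lra.
Qed.

Lemma unit_root_pow_N (N : nat) : (0 < N)%nat -> (unit_root N ^ N)%C = RtoC 1.
Proof.
  intros HN. unfold unit_root. rewrite Cpow_cis.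
  replace (INR N * (2 * PI / INR N)) with (2 * PI)
    by (field; apply not_0_INR; lia).
  rewrite cos_2PI, sin_2PI. reflexivity.
Qed.

Lemma unit_root_pow_neq_1 (N k : nat) :
  (0 < k)%nat -> (k < N)%nat -> (unit_root N ^ k)%C <> RtoC 1.
Proof.
  intros Hk HkN E. unfold unit_root in E. rewrite Cpow_cis in E.
  apply (f_equal Re) in E. simpl in E.
  assert (HN0 : 0 < INR N) by (apply lt_0_INR; lia).
  assert (Hk0 : 0 < INR k) by (apply lt_0_INR; lia).
  apply lt_INR in HkN.
  set (x := INR k * PI / INR N).
  replace (INR k * (2 * PI / INR N)) with (2 * x) in E by (unfold x; field; lra).
  rewrite cos_2a_sin in E.
  assert (HP := PI_RGT_0).
  assert (0 < sin x).
  { apply sin_gt_0; unfold x.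
    - apply Rdiv_lt_0_compat; [apply Rmult_lt_0_compat|]; lra.
    - apply Rlt_div_l; [lra|]. nra. }
  nra.
Qed.

Lemma Cconj_mult_unit (w : C) : Cmod w = 1 -> (w * Cconj w)%C = RtoC 1.
Proof. intros H. rewrite <- Cmod2_conj, H. f_equal. ring. Qed.

Section FiniteFourier.

Variables (al : nat -> C) (r : R) (M n : nat).
Hypothesis HnM : (n <= M)%nat.
Hypothesis Hn : (0 < n)%nat.

(** The order exceeds every frequency that occurs: differences of exponents up to [M], and sums
    [m + n] with [m <= M]. Averages over the N-th roots of unity therefore extract coefficients of
    [P] exactly. *)
Let N := (M + n + 1)%nat.
Let w := unit_root N.
Let P (z : C) : C := Csum (fun m => (al m * z ^ m)%C) (S M).
Let z (j : nat) : C := (RtoC r * w ^ j)%C.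

Lemma unit_root_sum_zero (m l : nat) (q : C) :
  (q = w ^ m * Cconj w ^ l)%C -> (m < N)%nat -> (l < N)%nat -> m <> l ->
  Csum (fun j => (q ^ j)%C) N = RtoC 0.
Proof.
  intros Hq Hm Hl Hml.
  assert (Hw1 : (w * Cconj w)%C = RtoC 1) by (apply Cconj_mult_unit, Cmod_cis).
  assert (HN : (0 < N)%nat) by (unfold N; lia).
  assert (HwN : (w ^ N)%C = RtoC 1) by (apply unit_root_pow_N, HN).
  apply geometric_root_of_unity.
  - rewrite Hq, Cpow_mult_l, <- !Cpow_mult_r, !(Nat.mul_comm _ N), !Cpow_mult_r.
    rewrite <- Cpow_conj, HwN, Cpow_1_l.
    replace (Cconj (RtoC 1)) with (RtoC 1)
      by (unfold Cconj; simpl; rewrite Ropp_0; reflexivity).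
    rewrite Cpow_1_l. ring.
  - intros E. rewrite E in Hq. clear E.
    assert (E : (w ^ l = w ^ m)%C).
    { transitivity (w ^ l * (w ^ m * Cconj w ^ l))%C; [rewrite <- Hq; ring|].
      transitivity (w ^ m * (w * Cconj w) ^ l)%C; [rewrite Cpow_mult_l; ring|].
      rewrite Hw1, Cpow_1_l. ring. }
    assert (Hnz : forall k, (w ^ k)%C <> RtoC 0).
    { intros k Ek. assert (Hk : Cmod (w ^ k) = 1)
        by (rewrite Cmod_pow; unfold w, unit_root; rewrite Cmod_cis; apply pow1).
      rewrite Ek, Cmod_0 in Hk. lra. }
    assert (Hkey : forall a b, (a < b)%nat -> (b < N)%nat -> (w ^ a)%C <> (w ^ b)%C).
    { intros a b Hab Hb Eab. apply (unit_root_pow_neq_1 N (b - a)); [lia|lia|].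
      fold w. replace b with (a + (b - a))%nat in Eab by lia.
      rewrite Cpow_add_r in Eab.
      transitivity (/ (w ^ a) * (w ^ a * w ^ (b - a)))%C; [field; apply Hnz|].
      rewrite <- Eab. field. apply Hnz. }
    destruct (Nat.lt_total m l) as [H|[H|H]]; [|lia|].
    + apply (Hkey m l H Hl). auto.
    + apply (Hkey l m H Hm). auto.
Qed.

Lemma fourier_coef (l : nat) :
  (l <= M)%nat ->
  Csum (fun j => (P (z j) * (Cconj w ^ l) ^ j)%C) N
  = (RtoC (INR N) * (al l * RtoC r ^ l))%C.
Proof.
  intros Hl.
  rewrite (Csum_ext _ (fun j => Csum (fun m =>
    (al m * RtoC r ^ m * (w ^ m * Cconj w ^ l) ^ j)%C) (S M))).
  - rewrite Csum_switch, (Csum_single _ l).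
    + rewrite Csum_scal.
      rewrite (Csum_ext _ (fun _ => RtoC 1)).
      * rewrite Csum_const. ring.
      * intros j _. rewrite <- Cpow_mult_l, Cconj_mult_unit by apply Cmod_cis.
        rewrite Cpow_1_l. apply Cpow_1_l.
    + lia.
    + intros m Hm Hml. rewrite Csum_scal.
      rewrite (unit_root_sum_zero m l); auto; unfold N; try lia. ring.
  - intros j _. unfold P. rewrite Cmult_comm, <- Csum_scal. apply Csum_ext.
    intros m _. unfold z. rewrite !Cpow_mult_l, <- !Cpow_mult_r, (Nat.mul_comm m j). ring.
Qed.

Lemma Cconj_Csum (f : nat -> C) (k : nat) :
  Cconj (Csum f k) = Csum (fun i => Cconj (f i)) k.
Proof.
  induction k as [|k IH]; simpl.
  - unfold Cconj; simpl. rewrite Ropp_0. reflexivity.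
  - rewrite <- IH. unfold Cconj, Cplus; simpl. rewrite Ropp_plus_distr. reflexivity.
Qed.

(** The conjugate of [P] has only frequencies [-m] with [m <= M]; lowered by [n] they lie strictly
    between [-N] and 0, so every average vanishes. *)
Lemma fourier_conj_coef :
  Csum (fun j => (Cconj (P (z j)) * (Cconj w ^ n) ^ j)%C) N = RtoC 0.
Proof.
  rewrite (Csum_ext _ (fun j => Csum (fun m =>
    (Cconj (al m) * Cconj (RtoC r) ^ m * (Cconj w ^ (m + n)) ^ j)%C) (S M))).
  - rewrite Csum_switch. apply Csum_zero. intros m Hm. rewrite Csum_scal.
    rewrite (unit_root_sum_zero 0 (m + n)); unfold N; try lia; simpl; ring.
  - intros j _. unfold P. rewrite Cconj_Csum, Cmult_comm, <- Csum_scal. apply Csum_ext.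
    intros m _. unfold z.
    rewrite Cmult_conj, Cpow_conj, Cmult_conj, Cpow_conj, Cpow_mult_l.
    rewrite Cpow_add_r, Cpow_mult_l, <- !Cpow_mult_r, (Nat.mul_comm m j). ring.
Qed.

(** Adding the vanishing conjugate average replaces [P] by [2 Re P] in the formula for the n-th
    coefficient. Where [Re P >= - eps] one has [|2 Re P| <= 2 Re P + 4 eps], and the average of
    [Re P] is the real part of [al 0]. The slack [eps] is for partial sums of a series with
    nonnegative real part. *)
Lemma fourier_positive_bound (eps : R) :
  0 <= eps -> (forall j, - eps <= Re (P (z j))) -> 0 <= r ->
  Cmod (al n) * r ^ n <= 2 * Re (al 0%nat) + 4 * eps.
Proof.
  intros Heps Hpos Hr.
  assert (HN : 0 < INR N) by (apply lt_0_INR; unfold N; lia).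
  assert (E : Csum (fun j => (RtoC (2 * Re (P (z j))) * (Cconj w ^ n) ^ j)%C) N
              = (RtoC (INR N) * (al n * RtoC r ^ n))%C).
  { rewrite <- (fourier_coef n HnM).
    rewrite <- (Cplus_0_r (Csum (fun j => (P (z j) * (Cconj w ^ n) ^ j)%C) N)).
    rewrite <- fourier_conj_coef, <- Csum_plus. apply Csum_ext. intros j _.
    rewrite <- Cmult_plus_distr_r. f_equal.
    generalize (P (z j)). intros [u v].
    unfold Cconj, Cplus, RtoC, Re; simpl. f_equal; ring. }
  assert (E0 : Re (Csum (fun j => RtoC (2 * Re (P (z j)) + 4 * eps)) N)
               = INR N * (2 * Re (al 0%nat) + 4 * eps)).
  { assert (H0 := fourier_coef 0 ltac:(lia)).
    assert (H1 : Re (Csum (fun j => P (z j)) N) = INR N * Re (al 0%nat)).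
    { rewrite (Csum_ext _ (fun j => (P (z j) * (Cconj w ^ 0) ^ j)%C)).
      - rewrite H0. unfold Re; simpl. ring.
      - intros j _. simpl. rewrite Cpow_1_l. ring. }
    transitivity (2 * Re (Csum (fun j => P (z j)) N) + INR N * (4 * eps)).
    - apply (Re_Csum_affine (fun j => P (z j))).
    - rewrite H1. ring. }
  assert (H : Cmod (RtoC (INR N) * (al n * RtoC r ^ n))
              <= INR N * (2 * Re (al 0%nat) + 4 * eps)).
  { rewrite <- E, <- E0. apply Cmod_Csum_le. intros j.
    rewrite Cmod_mult, Cmod_pow, Cmod_pow, Cmod_conj. unfold w, unit_root.
    rewrite Cmod_cis, !pow1, Rmult_1_r, Cmod_R.
    specialize (Hpos j). apply Rabs_le. fold (unit_root N). lra. }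
  rewrite !Cmod_mult, Cmod_pow, !Cmod_R, (Rabs_pos_eq r), (Rabs_pos_eq (INR N)) in H by lra.
  apply Rmult_le_reg_l with (1 := HN). exact H.
Qed.

End FiniteFourier.

Lemma Csum_sum_n (f : nat -> C) (n : nat) :
  sum_n (G := C_NormedModule) f n = Csum f (S n).
Proof.
  induction n as [|n IH].
  - rewrite sum_O. simpl. ring.
  - rewrite sum_Sn, IH. reflexivity.
Qed.

(** On the circle of radius [r] a long partial sum differs from the series by less than [e / 4], so
    the finite estimate holds with total slack [e]; afterwards [e] tends to 0 and [r] to 1. *)
Lemma caratheodory_coef (al : nat -> C) (n : nat) :
  disk_summable al -> (forall z, disk z -> 0 <= Re (CPSeries al z)) ->
  (0 < n)%nat -> Cmod (al n) <= 2 * Re (al 0%nat).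
Proof.
  intros Hs Hre Hn.
  assert (Hr : forall r, 0 < r < 1 -> Cmod (al n) * r ^ n <= 2 * Re (al 0%nat)).
  { intros r Hr. apply le_epsilon. intros e He.
    assert (Hsr := Hs r ltac:(lra)).
    assert (Ht := Series_tail_lim _ Hsr). apply is_lim_seq_spec in Ht.
    assert (He4 : 0 < e / 4) by lra.
    destruct (Ht (mkposreal _ He4)) as [M0 HM0].
    set (M := (M0 + n)%nat). specialize (HM0 M ltac:(unfold M; lia)).
    cbn [pos] in HM0. rewrite Rminus_0_r in HM0. apply Rabs_def2 in HM0.
    replace e with (4 * (e / 4)) by field.
    apply (fourier_positive_bound al r M n ltac:(unfold M; lia) Hn); [lra| |lra].
    intros j. set (zj := (RtoC r * unit_root (M + n + 1) ^ j)%C).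
    assert (Hz : Cmod zj = r).
    { unfold zj. rewrite Cmod_mult, Cmod_pow, Cmod_R, Rabs_pos_eq by lra.
      unfold unit_root. rewrite Cmod_cis, pow1. ring. }
    assert (Hd : disk zj) by (unfold disk; lra).
    specialize (Hre zj Hd).
    set (Q := Csum (fun m => (al m * zj ^ m)%C) (S M)).
    set (D := (CPSeries al zj - Q)%C).
    assert (Htail : is_Cseries (fun k => (al (S M + k)%nat * zj ^ (S M + k))%C) D).
    { apply (is_series_incr_n (fun k => (al k * zj ^ k)%C)); [lia|].
      change (Init.Nat.pred (S M)) with M. rewrite Csum_sum_n. fold Q.
      assert (Hc := CPSeries_correct al zj Hs Hd).
      replace (CPSeries al zj) with (plus (G := C_NormedModule) D Q) in Hc; [exact Hc|].
      unfold D. change (CPSeries al zj - Q + Q = CPSeries al zj)%C. ring. }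
    assert (HD : Cmod D <= Series (fun k => Cmod (al (S M + k)%nat) * r ^ (S M + k))).
    { apply (Cmod_series_le _ _ _ Htail).
      - apply (ex_series_incr_n (fun k => Cmod (al k) * r ^ k) (S M)). exact Hsr.
      - intros k. rewrite Cmod_mult, Cmod_pow, Hz. lra. }
    assert (HRe : Rabs (Re D) <= Cmod D) by apply re_le_Cmod.
    assert (HQ : Re Q = Re (CPSeries al zj) - Re D).
    { unfold D, Cminus. rewrite re_plus, re_opp. ring. }
    assert (Re D <= Rabs (Re D)) by apply Rle_abs.
    rewrite HQ. lra. }
  assert (L : is_lim_seq (fun j => Cmod (al n) * abel_seq j ^ n) (Cmod (al n))).
  { replace (Finite (Cmod (al n))) with (Finite (Cmod (al n) * 1 ^ n))
      by (rewrite pow1, Rmult_1_r; reflexivity).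
    apply (is_lim_seq_continuous (fun y => Cmod (al n) * y ^ n) _ 1);
      [|exact abel_seq_lim].
    apply continuity_pt_filterlim.
    apply (ex_derive_continuous (fun y => Cmod (al n) * y ^ n)). auto_derive. auto. }
  refine (is_lim_seq_le _ (fun _ => 2 * Re (al 0%nat)) _ _ _ L (is_lim_seq_const _)).
  intros j. apply Hr, abel_seq_bounds.
Qed.

(** * A coefficient criterion for the class S_p *)

Lemma Cmod_sqr (z : C) : Cmod z * Cmod z = Re z * Re z + Im z * Im z.
Proof. assert (H := Cmod2_alt z). simpl in H. lra. Qed.

(** By Cauchy-Schwarz the real inner product of [w] and [u] is at most [s |w|^2], so the foot of the
    perpendicular from [u] to the ray of [w] does not lie beyond [s w]; shortening [w] to [s w] only
    approaches [u]. *)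
Lemma shrink_closer (w u : C) (s : R) :
  0 <= s <= 1 -> Cmod u <= s * Cmod w -> Cmod (RtoC s * w - u) <= Cmod (w - u).
Proof.
  intros Hs Hu.
  assert (H1 := Cmod_ge_0 (w - u)). assert (H2 := Cmod_ge_0 (RtoC s * w - u)).
  apply Rsqr_incr_0_var; [|exact H1]. unfold Rsqr. rewrite !Cmod_sqr.
  assert (Hd : Re w * Re u + Im w * Im u <= s * (Cmod w * Cmod w)).
  { apply Rle_trans with (Cmod w * Cmod u).
    - assert (H := re_le_Cmod (w * Cconj u)).
      rewrite Cmod_mult, Cmod_conj, re_mult in H.
      apply Rle_trans with (2 := H).
      replace (Re w * Re u + Im w * Im u) with (Re w * Re (Cconj u) - Im w * Im (Cconj u))
        by (unfold Cconj, Re, Im; simpl; ring).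
      apply Rle_abs.
    - assert (Hw := Cmod_ge_0 w). nra. }
  assert (Hw := Cmod_sqr w).
  destruct w as [w1 w2], u as [u1 u2]. unfold Re, Im in *. simpl in *.
  rewrite Hw in Hd.
  assert (K1 : 0 <= (1 - s) * (s * (w1 * w1 + w2 * w2) - (w1 * u1 + w2 * u2)))
    by (apply Rmult_le_pos; lra).
  assert (K2 : 0 <= (1 - s) * (1 - s) * (w1 * w1 + w2 * w2)).
  { apply Rmult_le_pos; [|nra]. apply Rmult_le_pos; lra. }
  nra.
Qed.

(** Beyond the Lipschitz bound for powers this needs [s |w - z| <= |w - s z|], which is
    [shrink_closer] for [u = s z]; hence the assumption [|z| <= |w|]. *)
Lemma Cpow_starlike_bound (w z : C) (s : R) (n : nat) :
  0 <= s <= 1 -> Cmod z <= Cmod w -> Cmod w <= 1 ->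
  Cmod (w ^ S n - RtoC s * z ^ S n) <= INR (S n) * Cmod (w - RtoC s * z).
Proof.
  intros Hs Hzw Hw.
  replace (w ^ S n - RtoC s * z ^ S n)%C
      with (w ^ n * (w - RtoC s * z) + RtoC s * z * (w ^ n - z ^ n))%C
      by (rewrite !Cpow_S; ring).
    apply Rle_trans with (1 := Cmod_triangle _ _).
    rewrite !Cmod_mult, Cmod_pow, Cmod_R, (Rabs_pos_eq s) by lra.
    assert (Hd := Cpow_diff_bound w z 1 n ltac:(lra) Hw ltac:(lra)).
    replace (1 ^ n / 1) with 1 in Hd by (rewrite pow1; field).
    rewrite Rmult_1_r in Hd.
    assert (Hc : s * Cmod (w - z) <= Cmod (w - RtoC s * z)).
    { rewrite <- (Rabs_pos_eq s) at 1 by lra. rewrite <- Cmod_R, <- Cmod_mult.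
      replace (RtoC s * (w - z))%C with (RtoC s * w - RtoC s * z)%C by ring.
      apply shrink_closer; [exact Hs|].
      rewrite Cmod_mult, Cmod_R, Rabs_pos_eq by lra. nra. }
    set (d := Cmod (w - RtoC s * z)) in *.
    assert (Hd0 : 0 <= d) by apply Cmod_ge_0.
    assert (Hwn : Cmod w ^ n <= 1)
      by (rewrite <- (pow1 n); apply pow_incr; split; [apply Cmod_ge_0 | lra]).
    assert (Hz0 := Cmod_ge_0 z). assert (Hn := pos_INR n).
    assert (Hq := Cmod_ge_0 (w ^ n - z ^ n)).
    assert (K1 : Cmod w ^ n * d <= 1 * d) by (apply Rmult_le_compat_r; auto).
    assert (K2 : s * Cmod z * Cmod (w ^ n - z ^ n) <= s * 1 * (INR n * Cmod (w - z))).
    { apply Rmult_le_compat; auto; [nra|nra]. }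
    assert (K3 : INR n * (s * Cmod (w - z)) <= INR n * d)
      by (apply Rmult_le_compat_l; auto).
    rewrite S_INR. lra.
Qed.

Lemma Cmod_sub_sym (u v : C) : Cmod (u - v) = Cmod (v - u).
Proof. rewrite <- Cmod_opp. f_equal. ring. Qed.

(** The nearest-point projection onto the closed disk of radius [r]. *)
Definition disk_proj (r : R) (y : C) : C :=
  if Rle_dec (Cmod y) r then y else (RtoC (r / Cmod y) * y)%C.

Lemma disk_proj_le (r : R) (y : C) : 0 <= r -> Cmod (disk_proj r y) <= r.
Proof.
  intros Hr. unfold disk_proj. destruct (Rle_dec (Cmod y) r) as [H|H]; [exact H|].
  rewrite Cmod_mult, Cmod_R, Rabs_pos_eq.
  - right. field. lra.
  - apply Rdiv_le_0_compat; lra.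
Qed.

(** Let [u] be the point of larger modulus. If both lie outside, pull [u] back to the circle through
    [v], which approaches [v] by [shrink_closer], and then scale both by [r / |v| <= 1]. *)
Lemma disk_proj_nonexpansive (r : R) (y x : C) :
  0 <= r -> Cmod (disk_proj r y - disk_proj r x) <= Cmod (y - x).
Proof.
  intros Hr.
  assert (Hout : forall u v : C, Cmod v <= Cmod u -> r < Cmod u ->
            Cmod (disk_proj r u - disk_proj r v) <= Cmod (u - v)).
  { intros u v Huv Hu. unfold disk_proj.
    destruct (Rle_dec (Cmod u) r) as [H|H]; [lra|clear H].
    assert (Hru : 0 <= r / Cmod u <= 1).
    { split; [apply Rdiv_le_0_compat; lra | apply Rle_div_l; lra]. }
    destruct (Rle_dec (Cmod v) r) as [Hv|Hv].
    - apply shrink_closer; [exact Hru|].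
      replace (r / Cmod u * Cmod u) with r by (field; lra). exact Hv.
    - assert (Hv0 : r < Cmod v) by lra.
      set (s := Cmod v / Cmod u).
      assert (Hs : 0 <= s <= 1).
      { unfold s. split; [apply Rdiv_le_0_compat; lra | apply Rle_div_l; lra]. }
      replace (RtoC (r / Cmod u) * u - RtoC (r / Cmod v) * v)%C
        with (RtoC (r / Cmod v) * (RtoC s * u - v))%C.
      + rewrite Cmod_mult, Cmod_R, Rabs_pos_eq by (apply Rdiv_le_0_compat; lra).
        assert (Hrv : r / Cmod v <= 1) by (apply Rle_div_l; lra).
        assert (Hsh : Cmod (RtoC s * u - v) <= Cmod (u - v)).
        { apply shrink_closer; [exact Hs|]. unfold s.
          replace (Cmod v / Cmod u * Cmod u) with (Cmod v) by (field; lra). lra. }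
        assert (H0 := Cmod_ge_0 (RtoC s * u - v)). nra.
      + replace (r / Cmod u) with (r / Cmod v * s) by (unfold s; field; lra).
        rewrite RtoC_mult. ring. }
  destruct (Rle_lt_dec (Cmod x) r) as [Hx|Hx]; destruct (Rle_lt_dec (Cmod y) r) as [Hy|Hy].
  - unfold disk_proj. destruct (Rle_dec (Cmod y) r), (Rle_dec (Cmod x) r); lra.
  - apply Hout; lra.
  - rewrite Cmod_sub_sym, (Cmod_sub_sym y x). apply Hout; lra.
  - destruct (Rle_lt_dec (Cmod x) (Cmod y)) as [H|H].
    + apply Hout; lra.
    + rewrite Cmod_sub_sym, (Cmod_sub_sym y x). apply Hout; lra.
Qed.

Lemma contraction_fixed_point (Psi : C -> C) (r q : R) :
  0 <= r -> 0 <= q < 1 ->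
  (forall w, Cmod w <= r -> Cmod (Psi w) <= r) ->
  (forall w w', Cmod w <= r -> Cmod w' <= r ->
     Cmod (Psi w - Psi w') <= q * Cmod (w - w')) ->
  exists w, Cmod w <= r /\ Psi w = w.
Proof.
  intros Hr Hq Hself Hlip.
  set (it := fun n => Nat.iter n Psi (RtoC 0)).
  assert (Hit : forall n, Cmod (it n) <= r).
  { induction n as [|n IH]; [simpl; rewrite Cmod_0; lra|]. apply Hself, IH. }
  set (d := fun n => (it (S n) - it n)%C).
  assert (Hd : forall n, Cmod (d n) <= r * q ^ n).
  { induction n as [|n IH].
    - unfold d. replace (it 1%nat - it 0%nat)%C with (it 1%nat) by (simpl; ring).
      simpl pow. rewrite Rmult_1_r. apply Hit.
    - apply Rle_trans with (1 := Hlip _ _ (Hit (S n)) (Hit n)).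
      rewrite <- tech_pow_Rmult. fold (d n).
      replace (r * (q * q ^ n)) with (q * (r * q ^ n)) by ring.
      apply Rmult_le_compat_l; lra. }
  assert (Hgeom : ex_series (fun n => r * q ^ n)).
  { refine (ex_series_scal r _ (ex_series_geom q _)). rewrite Rabs_pos_eq; lra. }
  assert (Hconv : is_Cseries d (CSeries d)).
  { apply CSeries_correct.
    apply (ex_series_le (V := R_CompleteNormedModule) _ (fun n => r * q ^ n)); auto.
    intros n. unfold norm; simpl norm. unfold abs; simpl abs.
    rewrite Rabs_pos_eq by apply Cmod_ge_0. apply Hd. }
  set (L := CSeries d) in *.
  assert (Hsum : forall n, sum_n (G := C_NormedModule) d n = it (S n)).
  { induction n as [|n IH].
    - rewrite sum_O. unfold d. simpl. ring.
    - rewrite sum_Sn, IH. unfold d.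
      change (it (S n) + (it (S (S n)) - it (S n)) = it (S (S n)))%C. ring. }
  assert (Hlim : forall e, 0 < e ->
            exists N, forall n, (N <= n)%nat -> Cmod (it (S n) - L) < e).
  { intros e He.
    assert (H := proj1 (filterlim_locally_ball_norm _ _) Hconv (mkposreal e He)).
    destruct H as [N HN]. exists N. intros n Hn. specialize (HN n Hn).
    rewrite Hsum in HN. exact HN. }
  assert (HL : Cmod L <= r).
  { apply le_epsilon. intros e He. destruct (Hlim e He) as [n Hn].
    specialize (Hn n (le_n n)).
    replace L with (it (S n) + - (it (S n) - L))%C by ring.
    apply Rle_trans with (1 := Cmod_triangle _ _). rewrite Cmod_opp.
    specialize (Hit (S n)). lra. }
  exists L. split; [exact HL|].
  assert (H0 : Cmod (Psi L - L) <= 0).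
  { apply le_epsilon. intros e He. destruct (Hlim (e / 2) ltac:(lra)) as [n Hn].
    assert (H1 := Hn n (le_n n)). assert (H2 := Hn (S n) (Nat.le_succ_diag_r n)).
    replace (Psi L - L)%C with (- (it (S (S n)) - Psi L) + (it (S (S n)) - L))%C by ring.
    apply Rle_trans with (1 := Cmod_triangle _ _). rewrite Cmod_opp.
    assert (H3 := Hlip _ _ (Hit (S n)) HL).
    change (Psi (it (S n))) with (it (S (S n))) in H3.
    assert (H4 := Cmod_ge_0 (it (S n) - L)). nra. }
  assert (H1 := Cmod_ge_0 (Psi L - L)).
  replace (Psi L) with ((Psi L - L) + L)%C by ring.
  rewrite (Cmod_eq_0 (Psi L - L)) by lra. ring.
Qed.

Lemma RtoC_neq_0 (x : R) : x <> 0 -> RtoC x <> RtoC 0.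
Proof. intros H E. apply H. exact (f_equal Re E). Qed.

Section CoefficientCriterion.

Variable A : nat -> C.
Hypothesis A0 : A 0%nat = RtoC 0.
Hypothesis A1 : A 1%nat = RtoC 1.

(** The index is shifted by 2, so the weight [2 m - 1] of the coefficient [m = n + 2] reads
    [2 n + 3]. *)
Let wt (n : nat) : R := Cmod (A (S (S n))).

Hypothesis Hex : ex_series (fun n => (2 * INR n + 3) * wt n).
Hypothesis Hle : Series (fun n => (2 * INR n + 3) * wt n) <= 1.

Lemma criterion_wt_ge_0 (n : nat) : 0 <= wt n.
Proof. apply Cmod_ge_0. Qed.

Lemma criterion_ex_series (u : nat -> R) (k : R) :
  (forall n, 0 <= u n <= k * (2 * INR n + 3)) -> ex_series (fun n => u n * wt n).
Proof.
  intros Hu.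
  apply (ex_series_le (V := R_CompleteNormedModule) _
    (fun n => k * ((2 * INR n + 3) * wt n))).
  - intros n. unfold norm; simpl norm. unfold abs; simpl abs.
    assert (Hw := criterion_wt_ge_0 n). specialize (Hu n).
    rewrite Rabs_pos_eq by (apply Rmult_le_pos; lra).
    rewrite <- Rmult_assoc. apply Rmult_le_compat_r; lra.
  - exact (ex_series_scal k _ Hex).
Qed.

Lemma criterion_Series_le (u : nat -> R) (k : R) :
  (forall n, 0 <= u n <= k * (2 * INR n + 3)) -> Series (fun n => u n * wt n) <= k.
Proof.
  intros Hu.
  apply Rle_trans with (Series (fun n => k * ((2 * INR n + 3) * wt n))).
  - apply Series_le.
    + intros n. assert (Hw := criterion_wt_ge_0 n). specialize (Hu n). split.
      * apply Rmult_le_pos; lra.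
      * rewrite <- Rmult_assoc. apply Rmult_le_compat_r; lra.
    + exact (ex_series_scal k _ Hex).
  - rewrite Series_scal_l. assert (Hk := Hu O). simpl INR in Hk.
    rewrite <- (Rmult_1_r k) at 2. apply Rmult_le_compat_l; lra.
Qed.

Lemma criterion_disk_summable : disk_summable A.
Proof.
  intros r Hr. apply (ex_series_incr_n (fun n => Cmod (A n) * r ^ n) 2).
  apply (ex_series_le (V := R_CompleteNormedModule) _ (fun n => 1 * wt n)).
  - intros n. unfold norm; simpl norm. unfold abs; simpl abs.
    assert (Hw := criterion_wt_ge_0 n).
    assert (0 <= r ^ (2 + n)) by (apply pow_le; lra).
    assert (r ^ (2 + n) <= 1) by (rewrite <- (pow1 (2 + n)); apply pow_incr; lra).
    rewrite Rabs_pos_eq by (apply Rmult_le_pos; auto).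
    rewrite Rmult_comm. apply Rmult_le_compat_r; [exact Hw | assumption].
  - apply (criterion_ex_series (fun _ => 1) 1). intros n.
    assert (0 <= INR n) by apply pos_INR. lra.
Qed.

Let F := CPSeries A.
Let phi (z : C) : C := (F z - z)%C.

Lemma criterion_phi_series (z : C) :
  disk z -> is_Cseries (fun n => (A (S (S n)) * z ^ S (S n))%C) (phi z).
Proof.
  intros Hz.
  apply (is_series_incr_1 (fun n => (A (S n) * z ^ S n)%C)).
  apply (is_series_incr_1 (fun n => (A n * z ^ n)%C)).
  assert (Hc := CPSeries_correct A z criterion_disk_summable Hz).
  replace (CPSeries A z) with (plus (G := C_NormedModule)
    (plus (G := C_NormedModule) (phi z) (A 1%nat * z ^ 1)%C) (A 0%nat * z ^ 0)%C) in Hc;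
    [exact Hc|].
  rewrite A0, A1. unfold phi, F.
  change (CPSeries A z - z + 1 * z ^ 1 + 0 * z ^ 0 = CPSeries A z)%C. simpl. ring.
Qed.

(* The coefficient bound gives [sum n |A n| <= 2/3] over [n >= 2]. *)
Lemma criterion_phi_contracts (w z : C) (s : R) :
  0 <= s <= 1 -> Cmod z <= Cmod w -> disk w ->
  Cmod (phi w - RtoC s * phi z) <= 2 / 3 * Cmod (w - RtoC s * z).
Proof.
  intros Hs Hzw Hw.
  assert (Hz : disk z) by (unfold disk in *; lra).
  assert (S1 := criterion_phi_series w Hw). assert (S2 := criterion_phi_series z Hz).
  assert (S3 := is_series_minus _ _ _ _ S1 (is_series_scal (RtoC s) _ _ S2)).
  assert (Hn : forall n, 0 <= INR (S (S n)) <= 2 / 3 * (2 * INR n + 3)).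
  { intros n. rewrite !S_INR. assert (0 <= INR n) by apply pos_INR. lra. }
  apply Rle_trans with (Series (fun n => INR (S (S n)) * wt n * Cmod (w - RtoC s * z))).
  - apply (Cmod_series_le _ _ _ S3).
    + apply (ex_series_scal_r (Cmod (w - RtoC s * z)) (fun n => INR (S (S n)) * wt n)).
      apply (criterion_ex_series _ (2 / 3) Hn).
    + intros n. change (Cmod (A (S (S n)) * w ^ S (S n)
                        - RtoC s * (A (S (S n)) * z ^ S (S n)))
        <= INR (S (S n)) * wt n * Cmod (w - RtoC s * z)).
      replace (A (S (S n)) * w ^ S (S n) - RtoC s * (A (S (S n)) * z ^ S (S n)))%C
        with (A (S (S n)) * (w ^ S (S n) - RtoC s * z ^ S (S n)))%C by ring.
      rewrite Cmod_mult. fold (wt n).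
      replace (INR (S (S n)) * wt n * Cmod (w - RtoC s * z))
        with (wt n * (INR (S (S n)) * Cmod (w - RtoC s * z))) by ring.
      apply Rmult_le_compat_l; [apply criterion_wt_ge_0|].
      apply Cpow_starlike_bound; auto. unfold disk in Hw. lra.
  - rewrite Series_scal_r. apply Rmult_le_compat_r; [apply Cmod_ge_0|].
    apply criterion_Series_le. exact Hn.
Qed.

Lemma criterion_phi_lipschitz (w z : C) :
  disk w -> disk z -> Cmod (phi w - phi z) <= 2 / 3 * Cmod (w - z).
Proof.
  assert (H : forall u v, disk u -> Cmod v <= Cmod u ->
            Cmod (phi u - phi v) <= 2 / 3 * Cmod (u - v)).
  { intros u v Hu Huv.
    assert (H := criterion_phi_contracts u v 1 ltac:(lra) Huv Hu).
    rewrite !Cmult_1_l in H. exact H. }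
  intros Hw Hz. destruct (Rle_lt_dec (Cmod z) (Cmod w)) as [Hc|Hc].
  - apply H; auto.
  - rewrite Cmod_sub_sym, (Cmod_sub_sym w z). apply H; auto. lra.
Qed.

Lemma Csub_eq_0 (u v : C) : Cmod (u - v) <= 0 -> u = v.
Proof.
  intros H. assert (H1 := Cmod_ge_0 (u - v)).
  replace u with ((u - v) + v)%C by ring.
  rewrite (Cmod_eq_0 (u - v)) by lra. ring.
Qed.

(** [F] is the identity plus [phi], whose Lipschitz constant 2/3 is below 1. *)
Lemma criterion_univalent : univalent F.
Proof.
  intros z w Hz Hw HF. apply Csub_eq_0.
  assert (H := criterion_phi_lipschitz w z Hw Hz).
  replace (phi w - phi z)%C with (z - w)%C in H by (unfold phi; rewrite HF; ring).
  rewrite (Cmod_sub_sym w z) in H. assert (H1 := Cmod_ge_0 (z - w)). lra.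
Qed.

(* A solution [w] of [F w = t F z] is a fixed point of [w |-> t F z - phi w]; this map
   need not preserve the disk of radius [|z|], so it is composed with the projection,
   and a fixed point at which the projection is active would have to equal [t z]. *)
Lemma criterion_starlike : starlike_image F.
Proof.
  intros z t Hz Ht. set (r := Cmod z).
  assert (Hr : 0 <= r) by apply Cmod_ge_0.
  assert (Hr1 : r < 1) by exact Hz.
  set (y := fun w : C => (RtoC t * F z - phi w)%C).
  destruct (contraction_fixed_point (fun w => disk_proj r (y w)) r (2 / 3))
    as [w [Hw Hfix]]; [exact Hr|lra| | |].
  - intros w _. apply disk_proj_le, Hr.
  - intros w w' Hw Hw'. apply Rle_trans with (1 := disk_proj_nonexpansive r _ _ Hr).
    replace (y w - y w')%C with (phi w' - phi w)%C by (unfold y; ring).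
    rewrite (Cmod_sub_sym w w').
    apply criterion_phi_lipschitz; unfold disk; lra.
  - exists w. assert (Hwd : disk w) by (unfold disk; lra). split; [exact Hwd|].
    assert (Hy : y w = w -> F w = (RtoC t * F z)%C).
    { intros E. unfold y, phi in E.
      replace (RtoC t * F z)%C with ((RtoC t * F z - (F w - w)) + (F w - w))%C by ring.
      rewrite E. ring. }
    apply Hy. destruct (Rle_dec (Cmod (y w)) r) as [H|H].
    + unfold disk_proj in Hfix. destruct (Rle_dec (Cmod (y w)) r); [exact Hfix|lra].
    + exfalso. apply H.
      assert (Htz : Cmod (RtoC t * z) <= r).
      { rewrite Cmod_mult, Cmod_R, Rabs_pos_eq by lra. fold r. nra. }
      assert (Hwr : Cmod w = r).
      { rewrite <- Hfix. unfold disk_proj.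
        destruct (Rle_dec (Cmod (y w)) r) as [H'|_]; [lra|].
        rewrite Cmod_mult, Cmod_R, Rabs_pos_eq.
        - field. lra.
        - apply Rdiv_le_0_compat; lra. }
      (* The projection sends [y w] to [w] and fixes [t z], so [|w - t z| <= |phi w - t phi z|]. As
         [|w| = |z|], [criterion_phi_contracts] bounds the right side by 2/3 of the left, which
         forces [w = t z]. *)
      assert (P := disk_proj_nonexpansive r (y w) (RtoC t * z) Hr).
      rewrite Hfix in P. unfold disk_proj in P.
      destruct (Rle_dec (Cmod (RtoC t * z)) r) as [_|H']; [|lra].
      assert (Q := criterion_phi_contracts w z t Ht ltac:(fold r; lra) Hwd).
      replace (y w - RtoC t * z)%C with (- (phi w - RtoC t * phi z))%C in P
        by (unfold y, phi; ring).
      rewrite Cmod_opp in P. assert (Hc := Cmod_ge_0 (w - RtoC t * z)).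
      assert (E1 : w = (RtoC t * z)%C) by (apply Csub_eq_0; lra).
      assert (E2 : phi w = (RtoC t * phi z)%C).
      { apply Csub_eq_0. replace (w - RtoC t * z)%C with (RtoC 0) in Q
          by (rewrite <- E1; ring).
        rewrite Cmod_0 in Q. lra. }
      replace (y w) with (RtoC t * z)%C; [exact Htz|].
      unfold y. rewrite E2. unfold phi. ring.
Qed.

Lemma criterion_Sstar : class_Sstar F.
Proof.
  split; [|split; [apply criterion_univalent | apply criterion_starlike]].
  exists A. split; [exact A0|]. split; [exact A1|].
  apply disk_summable_expands, criterion_disk_summable.
Qed.

(** The coefficients of the [f] with [z f' = F]. At [n = 0] the numerator is 0, so the division by 0
    is harmless. *)
Let primitive_coef (n : nat) : C := (A n / RtoC (INR n))%C.

Lemma criterion_primitive_summable : disk_summable primitive_coef.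
Proof.
  intros r Hr. apply ex_series_incr_1.
  assert (H := criterion_disk_summable r Hr). apply ex_series_incr_1 in H.
  refine (ex_series_le (V := R_CompleteNormedModule) _ _ _ H).
  intros n. unfold norm; simpl norm. unfold abs; simpl abs.
  assert (Hrn : 0 <= r ^ S n) by (apply pow_le; lra).
  rewrite Rabs_pos_eq by (apply Rmult_le_pos; [apply Cmod_ge_0 | exact Hrn]).
  apply Rmult_le_compat_r; [exact Hrn|]. unfold primitive_coef.
  assert (HS : 1 <= INR (S n)) by (apply (le_INR 1); lia).
  rewrite Cmod_div, Cmod_R, Rabs_pos_eq by (try apply RtoC_neq_0; lra).
  apply Rle_div_l; [lra|]. assert (H0 := Cmod_ge_0 (A (S n))). nra.
Qed.

(** The coefficients of [F z / z], which is [f']. *)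
Let shifted (n : nat) : C := A (S n).

Lemma criterion_shifted_summable : disk_summable shifted.
Proof.
  intros r Hr.
  apply ex_series_ext with (fun n => Cmod (Cderiv_coef primitive_coef n) * r ^ n).
  - intros n. do 2 f_equal. unfold Cderiv_coef, primitive_coef, shifted. field.
    apply RtoC_neq_0, not_0_INR. lia.
  - apply disk_summable_deriv; [apply criterion_primitive_summable | exact Hr].
Qed.

Lemma criterion_primitive_deriv (z : C) :
  disk z -> C_derive (CPSeries primitive_coef) z = CPSeries shifted z.
Proof.
  intros Hz.
  rewrite (C_derive_disk primitive_coef _ criterion_primitive_summable
             (fun z _ => eq_refl) z Hz).
  unfold CPSeries. f_equal; apply Series_ext; intros n; do 2 f_equal;
    unfold Cderiv_coef, primitive_coef, shifted; field;
    apply RtoC_neq_0, not_0_INR; lia.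
Qed.

Lemma criterion_F_eq (z : C) : disk z -> F z = (z * CPSeries shifted z)%C.
Proof.
  intros Hz. apply is_Cseries_unique. apply is_series_decr_1.
  replace (plus (z * CPSeries shifted z)%C _) with (z * CPSeries shifted z)%C.
  - apply is_series_ext with (fun n => (z * (shifted n * z ^ n))%C).
    + intros n. unfold shifted.
      change (z * (A (S n) * z ^ n) = A (S n) * z ^ S n)%C. rewrite Cpow_S. ring.
    + apply (is_series_scal z (fun n => (shifted n * z ^ n)%C)).
      apply CPSeries_correct; [apply criterion_shifted_summable | exact Hz].
  - rewrite A0.
    change (z * CPSeries shifted z = z * CPSeries shifted z + - (0 * z ^ 0))%C. ring.
Qed.

(** With [f' = F z / z], [|f' - 1|] is at most the sum of [wt n] and [|f''|] at most the sum of
    [(n + 1) wt n]. The weight [2 n + 3 = 1 + 2 (n + 1)] is exactly what makes the first sum plus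
    twice the second at most 1, so [|f'| >= 2 |f''|]. The first sum alone is at most 1/3, whence
    [f'] has no zero. *)
Lemma criterion_deriv_bounds (z : C) :
  disk z ->
  2 * Cmod (CPSeries (Cderiv_coef shifted) z) <= Cmod (CPSeries shifted z) /\
  CPSeries shifted z <> RtoC 0.
Proof.
  intros Hz.
  assert (Hzp : forall n, 0 <= Cmod z ^ n <= 1).
  { intros n. split; [apply pow_le, Cmod_ge_0|].
    rewrite <- (pow1 n). apply pow_incr. unfold disk in Hz. split; [apply Cmod_ge_0 | lra]. }
  assert (Hb0 : forall n, 0 <= 1 <= 1 / 3 * (2 * INR n + 3)).
  { intros n. assert (0 <= INR n) by apply pos_INR. lra. }
  assert (Hb1 : forall n, 0 <= INR n + 1 <= 1 * (2 * INR n + 3)).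
  { intros n. assert (0 <= INR n) by apply pos_INR. lra. }
  assert (X0 := criterion_ex_series _ _ Hb0). assert (X1 := criterion_ex_series _ _ Hb1).
  cbv beta in X0, X1.
  assert (D0 : Cmod (CPSeries shifted z - 1) <= Series (fun n => 1 * wt n)).
  { apply (Cmod_series_le (fun n => (shifted (S n) * z ^ S n)%C)); [|exact X0|].
    - apply (is_series_incr_1 (fun n => (shifted n * z ^ n)%C)).
      assert (Hc := CPSeries_correct shifted z criterion_shifted_summable Hz).
      replace (CPSeries shifted z) with (plus (G := C_NormedModule)
        (CPSeries shifted z - 1)%C (shifted 0%nat * z ^ 0)%C) in Hc; [exact Hc|].
      unfold shifted at 2. rewrite A1.
      change (CPSeries shifted z - 1 + 1 * z ^ 0 = CPSeries shifted z)%C. simpl. ring.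
    - intros n. rewrite Cmod_mult, Cmod_pow. fold (wt n).
      change (wt n * Cmod z ^ S n <= 1 * wt n).
      assert (Hw := criterion_wt_ge_0 n). specialize (Hzp (S n)). nra. }
  assert (D1 : Cmod (CPSeries (Cderiv_coef shifted) z)
               <= Series (fun n => (INR n + 1) * wt n)).
  { apply (Cmod_series_le (fun n => (Cderiv_coef shifted n * z ^ n)%C)); [|exact X1|].
    - apply CPSeries_correct; [|exact Hz].
      apply disk_summable_deriv, criterion_shifted_summable.
    - intros n. unfold Cderiv_coef, shifted. rewrite !Cmod_mult, Cmod_pow, Cmod_R.
      rewrite Rabs_pos_eq by apply pos_INR. fold (wt n). rewrite S_INR.
      assert (Hw := criterion_wt_ge_0 n). assert (Hn := pos_INR n).
      assert (0 <= (INR n + 1) * wt n) by (apply Rmult_le_pos; lra).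
      specialize (Hzp n). nra. }
  assert (E : Series (fun n => 1 * wt n) + 2 * Series (fun n => (INR n + 1) * wt n)
              = Series (fun n => (2 * INR n + 3) * wt n)).
  { rewrite <- Series_scal_l, <- Series_plus.
    - apply Series_ext. intros n. ring.
    - exact X0.
    - exact (ex_series_scal 2 _ X1). }
  assert (B0 := criterion_Series_le _ _ Hb0). cbv beta in B0.
  assert (T : 1 <= Cmod (CPSeries shifted z) + Cmod (CPSeries shifted z - 1)).
  { rewrite <- Cmod_1 at 1.
    replace (RtoC 1) with (CPSeries shifted z + - (CPSeries shifted z - 1))%C at 1 by ring.
    rewrite <- (Cmod_opp (CPSeries shifted z - 1)). apply Cmod_triangle. }
  split; [lra|]. intros Z.
  assert (Z' : Cmod (CPSeries shifted z) = 0) by (rewrite Z; apply Cmod_0). lra.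
Qed.

Lemma criterion_UCV : class_UCV (CPSeries primitive_coef).
Proof.
  split.
  - exists primitive_coef. unfold primitive_coef at 1 2. rewrite A0, A1.
    split; [unfold Cdiv; ring|]. split; [simpl; field|].
    apply disk_summable_expands, criterion_primitive_summable.
  - intros z zeta Hz Hzeta.
    rewrite (C_derive_disk shifted (C_derive (CPSeries primitive_coef))
      criterion_shifted_summable criterion_primitive_deriv z Hz).
    rewrite criterion_primitive_deriv by exact Hz.
    destruct (criterion_deriv_bounds z Hz) as [Hb Hnz].
    split; [exact Hnz|].
    set (f1 := CPSeries shifted z) in *. set (f2 := CPSeries (Cderiv_coef shifted) z) in *.
    rewrite re_plus, re_RtoC.
    set (q := ((z - zeta) * f2 / f1)%C).
    (* Two points of the disk are less than 2 apart, which the factor 2 in [criterion_deriv_bounds]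
       compensates. *)
    assert (Hq : Cmod q < 1).
    { unfold q. rewrite Cmod_div by exact Hnz. rewrite Cmod_mult.
      assert (H1 : 0 < Cmod f1) by (apply Cmod_gt_0, Hnz).
      apply Rlt_div_l; [exact H1|].
      assert (H2 : Cmod (z - zeta) < 2).
      { apply Rle_lt_trans with (1 := Cmod_triangle _ _). rewrite Cmod_opp.
        unfold disk in *. lra. }
      assert (H3 := Cmod_ge_0 f2). assert (H4 := Cmod_ge_0 (z - zeta)). nra. }
    assert (H := re_le_Cmod q). apply Rabs_le_between in H. lra.
Qed.

Lemma class_Sp_of_coef : class_Sp (CPSeries A).
Proof.
  split; [exact criterion_Sstar|].
  exists (CPSeries primitive_coef). split; [exact criterion_UCV|].
  intros z Hz. rewrite criterion_primitive_deriv by exact Hz. apply criterion_F_eq, Hz.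
Qed.

End CoefficientCriterion.

(** * The Clausen operator on R(beta) *)

(** Caratheodory's estimate for [g = e^(i t) (f' - beta)], whose constant coefficient has real part
    [cos t (1 - beta)], at most [1 - beta]; the rotation leaves the moduli of the other coefficients
    unchanged. *)
Lemma class_R_coef_bound (beta : R) (f : C -> C) (al : nat -> C) (n : nat) :
  beta < 1 -> class_R beta f -> expands_on_disk al f -> al 1%nat = RtoC 1 ->
  INR (S (S n)) * Cmod (al (S (S n))) <= 2 * (1 - beta).
Proof.
  intros Hbeta [_ [t Ht]] Hal H1.
  assert (Hs := expands_disk_summable al f Hal).
  assert (Hd := disk_summable_deriv al Hs).
  assert (Hf : forall z, disk z -> C_derive f z = CPSeries (Cderiv_coef al) z).
  { apply C_derive_disk; auto. intros z Hz. apply expands_CPSeries; auto. }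
  set (e := (cos t, sin t) : C).
  assert (He : Cmod e = 1) by apply Cmod_cis.
  set (g := fun k => (e * (Cderiv_coef al k - match k with O => RtoC beta | _ => RtoC 0 end))%C).
  assert (Hgs : disk_summable g).
  { intros r Hr. apply ex_series_incr_1. generalize (Hd r Hr). intros H.
    apply ex_series_incr_1 in H. revert H. apply ex_series_ext. intros k.
    unfold g. rewrite Cmod_mult, He.
    replace (Cderiv_coef al (S k) - RtoC 0)%C with (Cderiv_coef al (S k)) by ring.
    symmetry. f_equal. apply Rmult_1_l. }
  assert (Hg : forall z, disk z -> CPSeries g z = (e * (C_derive f z - RtoC beta))%C).
  { intros z Hz. rewrite (Hf z Hz). apply is_Cseries_unique.
    assert (S1 := CPSeries_correct _ z Hd Hz).
    apply is_series_decr_1.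
    set (D := CPSeries (Cderiv_coef al) z) in *.
    replace (plus (e * (D - RtoC beta))%C _)
      with (scal (V := C_NormedModule) e (D - Cderiv_coef al 0)%C).
    - apply is_series_ext with
        (fun k => scal (V := C_NormedModule) e (Cderiv_coef al (S k) * z ^ S k)%C).
      + intros k. unfold g.
        change (e * (Cderiv_coef al (S k) * z ^ S k)
                = e * (Cderiv_coef al (S k) - 0) * z ^ S k)%C. ring.
      + apply (is_series_scal e (fun k => (Cderiv_coef al (S k) * z ^ S k)%C)).
        apply (is_series_incr_1 (fun k => (Cderiv_coef al k * z ^ k)%C)).
        replace D with (plus (G := C_NormedModule)
          (D - Cderiv_coef al 0)%C (Cderiv_coef al 0 * z ^ 0)%C) in S1; [exact S1|].
        change (D - Cderiv_coef al 0 + Cderiv_coef al 0 * z ^ 0 = D)%C. simpl. ring.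
    - change (e * (D - Cderiv_coef al 0)
        = e * (D - RtoC beta) + - (e * (Cderiv_coef al 0 - RtoC beta) * z ^ 0))%C.
      simpl. ring. }
  assert (Hc := caratheodory_coef g (S n) Hgs).
  assert (Hn : Cmod (g (S n)) = INR (S (S n)) * Cmod (al (S (S n)))).
  { unfold g, Cderiv_coef. rewrite Cmod_mult, He.
    replace (RtoC (INR (S (S n))) * al (S (S n)) - RtoC 0)%C
      with (RtoC (INR (S (S n))) * al (S (S n)))%C by ring.
    rewrite Cmod_mult, Cmod_R, Rabs_pos_eq by apply pos_INR. ring. }
  assert (H0 : Re (g 0%nat) = cos t * (1 - beta)).
  { unfold g, Cderiv_coef, e. rewrite H1. unfold Re. simpl. ring. }
  rewrite Hn, H0 in Hc.
  assert (Hcos := COS_bound t).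
  apply Rle_trans with (2 * (cos t * (1 - beta))).
  - apply Hc; [|lia]. intros z Hz. rewrite (Hg z Hz). apply Rlt_le, Ht, Hz.
  - nra.
Qed.

Lemma poch_RtoC (x : R) (n : nat) : poch (RtoC x) n = RtoC (rpoch x n).
Proof.
  induction n as [|n IH]; [reflexivity|]. simpl poch. cbn [rpoch].
  rewrite IH, RtoC_mult, RtoC_plus. reflexivity.
Qed.

Lemma Cmod_poch_le (a : C) (x : R) (n : nat) :
  Cmod a <= x -> Cmod (poch a n) <= rpoch x n.
Proof.
  intros Ha. induction n as [|n IH].
  - simpl. rewrite Cmod_1. lra.
  - simpl poch. cbn [rpoch]. rewrite Cmod_mult.
    apply Rmult_le_compat; try apply Cmod_ge_0; [exact IH|].
    apply Rle_trans with (1 := Cmod_triangle _ _).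
    rewrite Cmod_R, Rabs_pos_eq by apply pos_INR. lra.
Qed.

Lemma rpoch_newton (x : R) (n : nat) : rpoch x n = newton x n * rpoch 1 n.
Proof.
  induction n as [|n IH]; [simpl; ring|].
  cbn [rpoch newton]. rewrite IH, S_INR. assert (0 <= INR n) by apply pos_INR.
  field. lra.
Qed.

Lemma rpoch_ratio (b c : R) (n : nat) :
  0 < c -> rpoch b n = poch_ratio b c n * rpoch c n.
Proof.
  intros Hc. induction n as [|n IH]; [simpl; ring|].
  cbn [rpoch poch_ratio]. rewrite IH. assert (0 <= INR n) by apply pos_INR.
  field. lra.
Qed.

(* The duplication [(x)_(2n) = 4^n (x/2)_n ((x+1)/2)_n], with the powers of 4 cancelled. *)
Lemma rpoch_half_ratio (b c : R) (n : nat) :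
  0 < c ->
  rpoch (b / 2) n * rpoch ((b + 1) / 2) n
  = poch_ratio b c (2 * n) * (rpoch (c / 2) n * rpoch ((c + 1) / 2) n).
Proof.
  intros Hc. induction n as [|n IH]; [simpl; ring|].
  replace (2 * S n)%nat with (S (S (2 * n))) by lia.
  cbn [rpoch]. change (poch_ratio b c (S (S (2 * n))))
    with (poch_ratio b c (2 * n) * (b + INR (2 * n)) / (c + INR (2 * n))
          * (b + INR (S (2 * n))) / (c + INR (S (2 * n)))).
  assert (0 <= INR n) by apply pos_INR.
  rewrite S_INR, mult_INR. change (INR 2) with 2.
  transitivity (rpoch (b / 2) n * rpoch ((b + 1) / 2) n
                * ((b / 2 + INR n) * ((b + 1) / 2 + INR n))); [ring|].
  rewrite IH. field. lra.
Qed.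

Lemma hyp2F1_coef_RtoC (a b c : R) (n : nat) :
  0 < c ->
  hyp2F1_coef (RtoC a) (RtoC b) (RtoC c) n = RtoC (newton a n * poch_ratio b c n).
Proof.
  intros Hc. unfold hyp2F1_coef. rewrite !poch_RtoC.
  assert (H1 := rpoch_pos 1 n Rlt_0_1). assert (Hcn := rpoch_pos c n Hc).
  rewrite <- !RtoC_mult, <- RtoC_div by (apply Rgt_not_eq, Rmult_lt_0_compat; auto).
  f_equal. rewrite (rpoch_newton a), (rpoch_ratio b c n Hc). field. lra.
Qed.

Lemma hyp3F2_coef_bound (a b : C) (c : R) (n : nat) :
  0 < c ->
  Cmod (hyp3F2_coef a (b / 2) ((b + 1) / 2) (RtoC c / 2) ((RtoC c + 1) / 2) n)
  <= newton (Cmod a) n * poch_ratio (Cmod b) c (2 * n).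
Proof.
  intros Hc. unfold hyp3F2_coef.
  assert (H2 : RtoC 2 <> RtoC 0) by (apply RtoC_neq_0; lra).
  replace (RtoC c / 2)%C with (RtoC (c / 2)) by (rewrite RtoC_div by lra; reflexivity).
  replace ((RtoC c + 1) / 2)%C with (RtoC ((c + 1) / 2))
    by (rewrite RtoC_div by lra; rewrite RtoC_plus; reflexivity).
  rewrite !poch_RtoC, <- !RtoC_mult.
  assert (P1 := rpoch_pos 1 n Rlt_0_1).
  assert (P2 := rpoch_pos (c / 2) n ltac:(lra)).
  assert (P3 := rpoch_pos ((c + 1) / 2) n ltac:(lra)).
  assert (PD : 0 < rpoch (c / 2) n * rpoch ((c + 1) / 2) n * rpoch 1 n)
    by (repeat apply Rmult_lt_0_compat; auto).
  rewrite Cmod_div by (apply RtoC_neq_0; lra).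
  rewrite Cmod_R, (Rabs_pos_eq (_ * _)) by lra.
  apply Rle_div_l; [lra|].
  rewrite !Cmod_mult.
  assert (Hm2 : Cmod (RtoC 2) = 2) by (rewrite Cmod_R; apply Rabs_pos_eq; lra).
  assert (B1 : Cmod (b / 2) <= Cmod b / 2) by (rewrite Cmod_div, Hm2 by auto; lra).
  assert (B2 : Cmod ((b + 1) / 2) <= (Cmod b + 1) / 2).
  { rewrite Cmod_div, Hm2 by auto. apply Rmult_le_compat_r; [lra|].
    apply Rle_trans with (1 := Cmod_triangle _ _). rewrite Cmod_1. lra. }
  assert (Ha := Cmod_poch_le a (Cmod a) n (Rle_refl _)).
  assert (Hb1 := Cmod_poch_le _ _ n B1). assert (Hb2 := Cmod_poch_le _ _ n B2).
  replace (newton (Cmod a) n * poch_ratio (Cmod b) c (2 * n)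
           * (rpoch (c / 2) n * rpoch ((c + 1) / 2) n * rpoch 1 n))
    with (rpoch (Cmod a) n * rpoch (Cmod b / 2) n * rpoch ((Cmod b + 1) / 2) n).
  - apply Rmult_le_compat; auto; try (apply Rmult_le_pos); try apply Cmod_ge_0.
    apply Rmult_le_compat; auto; apply Cmod_ge_0.
  - rewrite Rmult_assoc, (rpoch_half_ratio (Cmod b) c n Hc), (rpoch_newton (Cmod a)).
    ring.
Qed.

Lemma is_hyp2F1_abel (a b c h : R) :
  0 < c ->
  is_hyp2F1 (RtoC a) (RtoC b) (RtoC c) (RtoC (-1)) (RtoC h) ->
  is_lim_seq (fun j => Series (fun n =>
    newton a n * poch_ratio b c n * (- abel_seq j) ^ n)) h.
Proof.
  intros Hc [Hslit [F [Hder [Hexp HF]]]].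
  assert (Hcont := ex_derive_continuous (K := C_AbsRing) (V := C_NormedModule)
    F _ (Hder _ Hslit)).
  assert (Hval : forall j, Series (fun n =>
      newton a n * poch_ratio b c n * (- abel_seq j) ^ n) = Re (F (RtoC (- abel_seq j)))).
  { intros j. assert (Hj := abel_seq_bounds j).
    assert (Hd : disk (RtoC (- abel_seq j))).
    { unfold disk. rewrite Cmod_R, Rabs_Ropp, Rabs_pos_eq; lra. }
    specialize (Hexp _ Hd). apply is_pseries_Cseries, is_Cseries_Re_Im in Hexp.
    destruct Hexp as [HRe _]. rewrite <- (is_series_unique _ _ HRe).
    apply Series_ext. intros n.
    rewrite hyp2F1_coef_RtoC by exact Hc.
    rewrite <- RtoC_pow, <- RtoC_mult, re_RtoC. reflexivity. }
  apply is_lim_seq_ext with (fun j => Re (F (RtoC (- abel_seq j)))).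
  { intros j. symmetry. apply Hval. }
  apply is_lim_seq_spec. intros eps.
  assert (Hb := proj1 (filterlim_locally_ball_norm _ _) Hcont eps).
  destruct Hb as [d Hd].
  assert (Hl := abel_seq_lim). apply is_lim_seq_spec in Hl.
  destruct (Hl d) as [N HN]. exists N. intros j Hj. specialize (HN j Hj).
  specialize (Hd (RtoC (- abel_seq j))).
  assert (Hball : Cmod (RtoC (- abel_seq j) - RtoC (-1)) < d).
  { rewrite <- RtoC_minus, Cmod_R, Rabs_minus_sym.
    replace (-1 - - abel_seq j) with (abel_seq j - 1) by ring. exact HN. }
  specialize (Hd Hball).
  change (Cmod (F (RtoC (- abel_seq j)) - F (RtoC (-1))) < eps) in Hd.
  rewrite HF in Hd.
  apply Rle_lt_trans with (2 := Hd).
  apply Rle_trans with (2 := re_le_Cmod _).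
  unfold Cminus. rewrite re_plus, re_opp, re_RtoC. apply Rle_refl.
Qed.

Theorem theorem5p2 :
  forall (a b : C) (c beta : R),
    a <> RtoC 0 -> b <> RtoC 0 ->
    0 < c ->
    Cmod a <> 1 -> Cmod b <> 1 -> Cmod b <> 2 ->
    Rmax (Cmod a + 1) (Cmod a + Cmod b - 1) < c ->
    0 <= beta < 1 ->
    forall G_c G_cab G_ca G_cb : R,
      is_Gamma c G_c ->
      is_Gamma (c - Cmod a - Cmod b) G_cab ->
      is_Gamma (c - Cmod a) G_ca ->
      is_Gamma (c - Cmod b) G_cb ->
    forall H1 H2 : R,
      is_hyp2F1 (RtoC (Cmod a)) (RtoC (Cmod b)) (RtoC (c - Cmod a))
        (RtoC (-1)) (RtoC H1) ->
      is_hyp2F1 (RtoC (Cmod a - 1)) (RtoC (Cmod b - 2)) (RtoC (c - Cmod a - 1))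
        (RtoC (-1)) (RtoC H2) ->
      G_c * G_cab / (G_ca * G_cb) *
        (2 * H1
         - (c - Cmod a - 1) * (c - Cmod a - Cmod b)
           / ((Cmod a - 1) * (Cmod b - 1) * (Cmod b - 2)) * H2)
      + (c - 1) * (c - 2) / ((Cmod a - 1) * (Cmod b - 1) * (Cmod b - 2))
      <= 1 / (2 * (1 - beta)) + 1 ->
    forall f : C -> C,
      class_R beta f -> class_Sp (clausen_op a b (RtoC c) f).
Proof.
  intros a b c beta Ha Hb Hc Ha1 Hb1 Hb2 Hmax Hbeta G_c G_cab G_ca G_cb
    HGc HGcab HGca HGcb H1 H2 HH1 HH2 Hcond f Hf.
  apply Cmod_gt_0 in Ha. apply Cmod_gt_0 in Hb.
  set (A := Cmod a) in *. set (B := Cmod b) in *.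
  assert (Hcab := is_Gamma_arg_pos _ _ HGcab).
  assert (HcA : A + 1 < c) by (apply Rle_lt_trans with (2 := Hmax), Rmax_l).
  assert (HAB : A + B < c) by lra.
  assert (HK := gauss_summation A B c G_c G_cab G_ca G_cb Ha Hb HGc HGcab HGca HGcb).
  assert (L1 := is_hyp2F1_abel A B (c - A) H1 ltac:(lra) HH1).
  assert (L2 := is_hyp2F1_abel (A - 1) (B - 2) (c - A - 1) H2 ltac:(lra) HH2).
  set (t := fun m => newton A m * poch_ratio B c (2 * m)).
  assert (Ht0 : forall m, 0 < t m).
  { intros m. apply Rmult_lt_0_compat; [apply newton_pos, Ha | apply poch_ratio_pos; lra]. }
  assert (Hts : ex_series t) by (apply clausen_summable; auto).
  assert (Hts' : ex_series (fun m => t m / INR (S m))).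
  { apply (ex_series_le (V := R_CompleteNormedModule) _ t); [|exact Hts].
    intros m. unfold norm; simpl norm. unfold abs; simpl abs.
    assert (HS : 1 <= INR (S m)) by (apply (le_INR 1); lia).
    specialize (Ht0 m). rewrite Rabs_pos_eq by (apply Rdiv_le_0_compat; lra).
    apply Rle_div_l; nra. }
  assert (S1 := clausen_sum_abel A B c Ha Hb HAB abel_seq H1
    abel_seq_bounds abel_seq_lim L1).
  assert (S2 := clausen_pred_sum_abel A B c Ha Hb HAB HcA abel_seq H2 Hb1 Hb2
    abel_seq_bounds abel_seq_lim L2 Hts').
  fold t in S1. change (fun m => newton A m * poch_ratio B c (2 * m) / INR (S m))
    with (fun m => t m / INR (S m)) in S2.
  rewrite HK in S1, S2.
  set (K := G_c * G_cab / (G_ca * G_cb)) in *.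
  set (D := (A - 1) * (B - 1) * (B - 2)) in *.
  assert (HD : D <> 0).
  { unfold D. repeat apply Rmult_integral_contrapositive_currified; lra. }
  assert (Hsum : 2 * Series t - Series (fun m => t m / INR (S m))
                 <= 1 / (2 * (1 - beta)) + 1).
  { refine (Rle_trans _ _ _ _ Hcond). right. rewrite S1.
    replace (Series (fun m => t m / INR (S m)))
      with ((D * Series (fun m => t m / INR (S m))) / D) by (field; exact HD).
    rewrite S2. field. exact HD. }
  destruct Hf as [[al [al0 [al1 Hal]]] Hphi].
  assert (Hf : class_R beta f) by (split; [exists al; auto | exact Hphi]).
  assert (Hop : clausen_op a b (RtoC c) f
    = CPSeries (fun n => clausen_coef a b (RtoC c) n * taylor_coef f n)%C) by reflexivity.
  rewrite Hop.
  set (A' := fun n => (clausen_coef a b (RtoC c) n * taylor_coef f n)%C).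
  set (k := 2 * (1 - beta)). assert (Hk : 0 < k) by (unfold k; lra).
  (* For [m = n + 1] the weight [2 n + 3] divided by the [n + 2] of the bound for R(beta) is
     [2 - 1 / (m + 1)]. *)
  assert (Hcoef : forall n, (2 * INR n + 3) * Cmod (A' (S (S n)))
            <= k * (2 * t (S n) - t (S n) / INR (S (S n)))).
  { intros n. unfold A'. rewrite (taylor_coef_expands al f _ Hal), Cmod_mult.
    assert (Hb3 := hyp3F2_coef_bound a b c (S n) Hc).
    change (hyp3F2_coef a (b / 2) ((b + 1) / 2) (RtoC c / 2) ((RtoC c + 1) / 2) (S n))
      with (clausen_coef a b (RtoC c) (S (S n))) in Hb3.
    fold A B in Hb3. fold (t (S n)) in Hb3.
    assert (HR := class_R_coef_bound beta f al n ltac:(lra) Hf Hal al1). fold k in HR.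
    specialize (Ht0 (S n)).
    assert (HN : INR (S (S n)) = INR n + 2) by (rewrite !S_INR; ring).
    rewrite HN in *. assert (Hn := pos_INR n).
    set (x := Cmod (clausen_coef a b (RtoC c) (S (S n)))) in *.
    set (y := Cmod (al (S (S n)))) in *.
    assert (Hx : 0 <= x) by apply Cmod_ge_0. assert (Hy : 0 <= y) by apply Cmod_ge_0.
    assert (Hxy : x * ((INR n + 2) * y) <= t (S n) * k).
    { apply Rmult_le_compat; auto. apply Rmult_le_pos; lra. }
    replace (k * (2 * t (S n) - t (S n) / (INR n + 2)))
      with (t (S n) * k * ((2 * INR n + 3) / (INR n + 2))) by (field; lra).
    replace ((2 * INR n + 3) * (x * y))
      with (x * ((INR n + 2) * y) * ((2 * INR n + 3) / (INR n + 2))) by (field; lra).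
    apply Rmult_le_compat_r; [apply Rdiv_le_0_compat; lra | exact Hxy]. }
  assert (U1 : ex_series (fun n => t (S n))) by (apply ex_series_incr_1 in Hts; exact Hts).
  assert (U2 : ex_series (fun n => t (S n) / INR (S (S n))))
    by (apply ex_series_incr_1 in Hts'; exact Hts').
  assert (U3 : ex_series (fun n => 2 * t (S n))) by exact (ex_series_scal 2 _ U1).
  assert (U4 : ex_series (fun n => 2 * t (S n) - t (S n) / INR (S (S n))))
    by exact (ex_series_minus _ _ U3 U2).
  assert (U : ex_series (fun n => k * (2 * t (S n) - t (S n) / INR (S (S n)))))
    by exact (ex_series_scal k _ U4).
  assert (Hpos : forall n, 0 <= (2 * INR n + 3) * Cmod (A' (S (S n)))).
  { intros n. assert (Hn := pos_INR n). apply Rmult_le_pos; [lra | apply Cmod_ge_0]. }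
  apply class_Sp_of_coef.
  - unfold A'. simpl. ring.
  - unfold A'. rewrite (taylor_coef_expands al f 1 Hal), al1.
    unfold clausen_coef, hyp3F2_coef. simpl. field.
  - apply (ex_series_le (V := R_CompleteNormedModule) _
      (fun n => k * (2 * t (S n) - t (S n) / INR (S (S n))))); [|exact U].
    intros n. unfold norm; simpl norm. unfold abs; simpl abs.
    rewrite Rabs_pos_eq by apply Hpos. apply Hcoef.
  - apply Rle_trans with (Series (fun n => k * (2 * t (S n) - t (S n) / INR (S (S n))))).
    + apply Series_le; [|exact U]. intros n. split; [apply Hpos | apply Hcoef].
    + rewrite Series_scal_l, Series_minus, Series_scal_l by assumption.
      assert (V1 := Series_incr_1 t Hts). assert (V2 := Series_incr_1 _ Hts').
      cbv beta in V2. change (INR 1) with 1 in V2.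
      (* The sums above start at [m = 1]. The missing term [2 t_0 - t_0 = 1] cancels the summand 1
         on the right of the hypothesis and leaves [1 / k]. *)
      change (t 0%nat) with (1 * 1) in V1, V2.
      assert (Hle : 2 * Series (fun n => t (S n)) - Series (fun n => t (S n) / INR (S (S n)))
                    <= / k).
      { replace (1 / (2 * (1 - beta))) with (/ k) in Hsum by (unfold k; field; lra).
        lra. }
      apply Rmult_le_reg_l with (/ k); [apply Rinv_0_lt_compat, Hk|].
      rewrite <- Rmult_assoc, Rinv_l, Rmult_1_l, Rmult_1_r by lra. exact Hle.
Qed.
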